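(* Let $p>7$ be a prime. If $p\equiv1\pmod3$ and $p=x^2+3y^2$ with $x,y\in\mathbb Z$, then $$\sum_{k=0}^{p-4}\frac{\binom{2k}k^2\binom{3k}k}{108^k(k+3)}\equiv\frac{32}{25}x^2-\frac{16}{25}p-\frac{99p^2}{2800x^2}\pmod{p^3}.$$ If $p\equiv2\pmod3$, then $$\sum_{k=0}^{p-4}\frac{\binom{2k}k^2\binom{3k}k}{108^k(k+3)}\equiv-\frac5{14}\binom{(p-1)/2}{(p-5)/6}^2\Big(1+p\Big(2+\frac43q_p(2)-\frac32q_p(3)\Big)+p^2\Big(1+\frac83q_p(2)+\frac29q_p(2)^2-3q_p(3)-2q_p(2)q_p(3)+\frac{15}8q_p(3)^2+\frac34U_{p-3}\Big)\Big)-\frac4{25}p^2\binom{(p-1)/2}{(p-5)/6}^{-2}\pmod{p^3}.$$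
   Context: Congruences modulo $p^3$ are between rational numbers whose denominators are not divisible by $p$. For $a$ not divisible by $p$, $q_p(a)=(a^{p-1}-1)/p$. The sequence $\{U_n\}$ is given by $U_{2n-1}=0$, $U_0=1$, $U_{2n}=-2\sum_{k=1}^n\binom{2n}{2k}U_{2n-2k}$ for $n=1,2,3,\ldots$. *)

(* Defs.v *)
From mathcomp Require Import all_boot all_order all_algebra.

Set Implicit Arguments.
Unset Strict Implicit.
Unset Printing Implicit Defensive.

Import GRing.Theory.
Local Open Scope ring_scope.

Definition p_integral (p : nat) (a : rat) : Prop := ~~ (p%:Z %| denq a)%Z.

(* When a and b are p-integral, so is a - b, and its reduced numerator being
   divisible by p ^ r says that a - b lies in p ^ r Z_(p). *)
Definition rat_congr (p r : nat) (a b : rat) : Prop :=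
  [/\ p_integral p a, p_integral p b & ((p ^ r)%N%:Z %| numq (a - b))%Z].

Definition fermat_quotient (p : nat) (a : int) : rat :=
  (a%:Q ^+ p.-1 - 1) / p%:Q.

(* Useq n is the list [:: U 0; U 2; ...; U (2 * n)]. *)
Fixpoint Useq (n : nat) : seq int :=
  if n is m.+1 then
    let s := Useq m in
    rcons s (- 2 * \sum_(1 <= k < n.+1) 'C(2 * n, 2 * k)%:Z * s`_(n - k))
  else [:: 1].

Definition U (n : nat) : int := if odd n then 0 else (Useq n./2)`_(n./2).

Lemma U_zero : U 0 = 1.
Proof. by []. Qed.

Lemma U_odd (n : nat) : (0 < n)%N -> U (2 * n - 1) = 0.
Proof. by case: n => // n _; rewrite /U mul2n doubleS subn1 /= odd_double. Qed.

Lemma size_Useq (n : nat) : size (Useq n) = n.+1.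
Proof. by elim: n => //= n IHn; rewrite size_rcons IHn. Qed.

Lemma nth_Useq (n i : nat) : (i <= n)%N -> (Useq n)`_i = U (2 * i).
Proof.
rewrite /U oddM /= mul2n doubleK.
elim: n => [|n IHn]; first by case: i.
rewrite leq_eqVlt => /orP[/eqP -> //|lt_in].
by rewrite /= nth_rcons size_Useq lt_in IHn.
Qed.

Lemma U_even (n : nat) : (0 < n)%N ->
  U (2 * n) = - 2 * \sum_(1 <= k < n.+1) 'C(2 * n, 2 * k)%:Z * U (2 * n - 2 * k).
Proof.
case: n => // n _; rewrite -(@nth_Useq n.+1) // [Useq _]/=.
rewrite nth_rcons size_Useq ltnn eqxx; congr (_ * _).
apply: eq_big_nat => k /andP[k_gt0 _]; rewrite -mulnBr nth_Useq //.
by rewrite leq_subLR -add1n leq_add2r.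
Qed.

(* Main.v *)
(* Write (a)_k for the rising factorial and w_k(a) = (a)_k (1-a)_k.  A telescoping
   identity reduces the sum, mod p^3, to 8/25 T - 5/126 V, where
   T = sum w_k(1/3) (1/2)_k / k!^3 and V = sum w_k(1/3) (3/2)_k / (k! (k+1)!^2).

   Let T(x) and V(x) be the same sums with 1/3 + p x in place of 1/3.  At x = -s
   and x = 2 s, where s = 1/3 or -1/3 according to p mod 3, the parameter a or
   1 - a is a nonpositive integer and Zeilberger recurrences give T(x) and V(x) in
   closed form.  The combination 2 T(-s) + T(2s) - 3 T(0), a second difference, is
   unchanged mod p^3 when the other parameters are perturbed by multiples of p so
   that a terminating Whipple sum evaluates all three terms; hence T(0) and V(0).
   The products that occur are written 1 + p l + p^2 l^2 / 2 mod p^3, with l a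
   combination of harmonic numbers, and the latter are expressed by Fermat
   quotients and U_(p-3).

   For p = 6 t - 1 this is the claim.  For p = 6 t + 1, T(0) turns out to be J^2 and
   V(0) to be -9/2 p^2 / J^2, with J a Jacobi sum of a cubic and the quadratic
   character of F_p, taken in Z_p; J is expanded mod p^3 into six binomial
   coefficients by means of Teichmueller representatives.  Since J has norm p,
   J + p / J is 2 x up to sign. *)
Require Import Defs.
From HB Require Import structures.
From mathcomp Require Import all_boot all_order all_fingroup all_algebra all_field.
From mathcomp Require Import ring lra zify.
Set Implicit Arguments.
Unset Strict Implicit.
Unset Printing Implicit Defensive.
Import Order.TTheory GRing.Theory Num.Theory.
Local Open Scope ring_scope.

(** The closed forms at [x = -s] and [x = 2 s] determine T(0) only mod p^2: interpolation with
    weights 2/3 and 1/3 leaves an error of order p^2. Its coefficient matters only mod p, where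
    moving the remaining parameters by multiples of p is harmless; this is why a different series,
    one that Whipple's theorem sums, can supply it.

    For p = 6 t + 1 the outcome involves C(3t, t) and harmonic numbers rather than x. The classical
    link, J = -C(3t, t) mod p for a Jacobi sum J, is too weak by two powers of p. So J is computed
    from Teichmueller representatives, with the quadratic character replaced by a quintic polynomial
    in its residue (1 - tau)^((p-1)/2). The harmonic numbers in J then match those in T(0), and no
    Fermat quotient enters. The exponent of the cubic character is the one for which J is a unit;
    its conjugate p / J is divisible by p.

    All of this stays inside the rationals: congruences mod p^3 stand for p-adic numbers, and the
    norm of J comes from counting in F_p, not from a complex absolute value. *)

(** * The ring of p-integral rationals and congruences mod p^n *)

(** The localization of Z at p; the boolean form lets the generic subring lemmas apply to it. *)
Definition zp_pred (p : nat) : {pred rat} := fun a => coprime p `|denq a|%N.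
Definition zp (p : nat) := [qualify a a : rat | zp_pred p a].

Lemma zpP (p : nat) (a : rat) :
  reflect (exists n : int, exists2 d : nat, coprime p d & a * d%:R = n%:~R) (a \is a zp p).
Proof.
apply: (iffP idP) => [h|[n [d cd ad]]].
  exists (numq a), `|denq a|%N => //.
  rewrite -[X in X * _]divq_num_den pmulrn absz_denq divfK //.
  by rewrite intr_eq0 denq_neq0.
rewrite qualifE /= /zp_pred.
have : (numq a * d%:Z)%:~R = (n * denq a)%:~R :> rat.
  rewrite !intrM -ad mulrC [RHS]mulrC mulrA [X in _ = X * _]mulrC.
  by rewrite -[X in _ = X * _ * _]divq_num_den divfK ?intr_eq0 ?denq_neq0 // -pmulrn mulrC.
move/eqP; rewrite eqr_int => /eqP e.
have : (`|denq a| %| d)%N.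
  have : (`|denq a| %| `|numq a| * d)%N.
    have := congr1 absz e; rewrite !abszM absz_nat => ->; exact: dvdn_mull.
  by rewrite Gauss_dvdr // coprime_sym coprime_num_den.
by move=> dd; apply: coprime_dvdr cd.
Qed.

Lemma zp_subring_closed (p : nat) : subring_closed (zp p).
Proof.
split.
- by apply/zpP; exists 1, 1%N; rewrite ?coprimen1 // mulr1.
- move=> a b /zpP [n [d cd ad]] /zpP [m [k ck bk]].
  apply/zpP; exists (n * k%:Z - m * d%:Z), (d * k)%N; first by rewrite coprimeMr cd.
  by rewrite natrM rmorphB !rmorphM /= -ad -bk -!pmulrn; ring.
- move=> a b /zpP [n [d cd ad]] /zpP [m [k ck bk]].
  apply/zpP; exists (n * m), (d * k)%N; first by rewrite coprimeMr cd.
  by rewrite natrM intrM /= -ad -bk; ring.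
Qed.

HB.instance Definition _ (p : nat) :=
  GRing.isSubringClosed.Build rat (zp_pred p) (zp_subring_closed p).

Lemma zpV (p n : nat) : coprime p n -> (n%:R^-1 : rat) \is a zp p.
Proof.
case: n => [|n] cn; first by rewrite mulr0n invr0 rpred0.
by apply/zpP; exists 1, n.+1 => //; rewrite mulVf // pnatr_eq0.
Qed.

Ltac zp_solve :=
  lazymatch goal with
  | |- is_true (in_mem ?x _) =>
    match goal with
    | h : is_true (in_mem x _) |- _ => exact h
    | _ =>
      lazymatch x with
      | 0 => exact: rpred0
      | 1 => exact: rpred1
      | _%:R => exact: rpred_nat
      | _%:~R => exact: rpred_int
      | - _ => apply: rpredNr; zp_solve
      | _ + _ => apply: rpredD; zp_solve
      | _ * _ => apply: rpredM; zp_solve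
      | _ ^+ _ => apply: rpredX; zp_solve
      | _ => assumption
      end
    end
  end.

(** Stated by division, so that neither side has to be p-integral by itself. *)
Definition eqm (p n : nat) (a b : rat) := (a - b) / p%:R ^+ n \is a zp p.

Section Congr.
Variables (p : nat) (pr : prime p).
Local Notation P := (p%:R : rat).

Lemma P_neq0 : P != 0. Proof. by rewrite pnatr_eq0 -lt0n prime_gt0. Qed.
Hint Resolve P_neq0 : core.

Lemma zp_P n : P ^+ n \is a zp p. Proof. by rewrite rpredX // rpred_nat. Qed.

Lemma eqmP n a b : reflect (exists2 r, r \is a zp p & a = b + P ^+ n * r) (eqm p n a b).
Proof.
apply: (iffP idP) => [h|[r rz ->]].
  by exists ((a - b) / P ^+ n); rewrite // mulrC divfK ?expf_neq0 // addrC subrK.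
by rewrite /eqm addrC addKr mulrC mulKf ?expf_neq0.
Qed.

Lemma eqm_refl n a : eqm p n a a.
Proof. by rewrite /eqm subrr mul0r rpred0. Qed.

Lemma eqm_sym n a b : eqm p n a b -> eqm p n b a.
Proof. by rewrite /eqm -opprB mulNr rpredN. Qed.

Lemma eqm_trans n b a c : eqm p n a b -> eqm p n b c -> eqm p n a c.
Proof.
rewrite /eqm => h1 h2.
have -> : a - c = (a - b) + (b - c) by ring.
by rewrite mulrDl rpredD.
Qed.

Lemma eqmD n a b c d : eqm p n a b -> eqm p n c d -> eqm p n (a + c) (b + d).
Proof.
rewrite /eqm => h1 h2.
have -> : a + c - (b + d) = (a - b) + (c - d) by ring.
by rewrite mulrDl rpredD.
Qed.

Lemma eqmN n a b : eqm p n a b -> eqm p n (- a) (- b).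
Proof. by rewrite /eqm -opprD mulNr rpredN. Qed.

Lemma eqmB n a b c d : eqm p n a b -> eqm p n c d -> eqm p n (a - c) (b - d).
Proof. by move=> h1 h2; apply: eqmD => //; apply: eqmN. Qed.

Lemma eqm_zpl n a b : eqm p n a b -> b \is a zp p -> a \is a zp p.
Proof. by case/eqmP => r rz -> bz; rewrite rpredD // rpredM // zp_P. Qed.

Lemma eqmM n a b c d : b \is a zp p -> c \is a zp p ->
  eqm p n a b -> eqm p n c d -> eqm p n (a * c) (b * d).
Proof.
rewrite /eqm => bz cz h1 h2.
have -> : a * c - b * d = (a - b) * c + b * (c - d) by ring.
by rewrite mulrDl mulrAC -[b * _ / _]mulrA rpredD // rpredM.
Qed.

Lemma eqmMl n c a b : c \is a zp p -> eqm p n a b -> eqm p n (c * a) (c * b).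
Proof. by rewrite /eqm => cz h; rewrite -mulrBr -mulrA rpredM. Qed.

Lemma eqmMr n c a b : c \is a zp p -> eqm p n a b -> eqm p n (a * c) (b * c).
Proof. by rewrite ![_ * c]mulrC; apply: eqmMl. Qed.

Lemma eqmX n k a b : a \is a zp p -> b \is a zp p ->
  eqm p n a b -> eqm p n (a ^+ k) (b ^+ k).
Proof.
move=> az bz h; elim: k => [|k IH]; first exact: eqm_refl.
by rewrite !exprS; apply: eqmM => //; rewrite rpredX.
Qed.

Lemma eqm_mulP m n a b : eqm p n a b -> eqm p (m + n) (P ^+ m * a) (P ^+ m * b).
Proof.
case/eqmP => r rz ->; apply/eqmP; exists r => //.
by rewrite exprD; ring.
Qed.

Lemma eqmW m n a b : (m <= n)%N -> eqm p n a b -> eqm p m a b.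
Proof.
move=> le_mn /eqmP [r rz ->]; apply/eqmP; exists (P ^+ (n - m) * r).
  by rewrite rpredM // zp_P.
by rewrite mulrA -exprD subnKC.
Qed.

Lemma eqm_sum n (I : Type) (s : seq I) (Q : pred I) (F G : I -> rat) :
  (forall i, Q i -> eqm p n (F i) (G i)) ->
  eqm p n (\sum_(i <- s | Q i) F i) (\sum_(i <- s | Q i) G i).
Proof.
move=> h; apply: (big_ind2 (eqm p n)) => //; first exact: eqm_refl.
by move=> *; apply: eqmD.
Qed.

Lemma eqm_sum_nat n (l m : nat) (F G : nat -> rat) :
  (forall i, (l <= i < m)%N -> eqm p n (F i) (G i)) ->
  eqm p n (\sum_(l <= i < m) F i) (\sum_(l <= i < m) G i).
Proof.
by move=> h; rewrite !big_nat; apply: eqm_sum.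
Qed.

Lemma eqm_prod n (I : Type) (s : seq I) (Q : pred I) (F G : I -> rat) :
  (forall i, Q i -> [/\ F i \is a zp p, G i \is a zp p & eqm p n (F i) (G i)]) ->
  eqm p n (\prod_(i <- s | Q i) F i) (\prod_(i <- s | Q i) G i).
Proof.
move=> h; suff [] : [/\ \prod_(i <- s | Q i) F i \is a zp p,
  \prod_(i <- s | Q i) G i \is a zp p & eqm p n (\prod_(i <- s | Q i) F i)
  (\prod_(i <- s | Q i) G i)] by [].
apply: (big_ind2 (fun a b => [/\ a \is a zp p, b \is a zp p & eqm p n a b])) => //.
  by split; rewrite ?rpred1 //; exact: eqm_refl.
by move=> a b c d [? ? ?] [? ? ?]; split; rewrite ?rpredM //; exact: eqmM.
Qed.

(** Units of Z_(p). Since [0^-1 = 0] is p-integral, [a != 0] has to be required separately. *)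
Definition zpu (a : rat) := [&& a \is a zp p, a^-1 \is a zp p & a != 0].

Lemma zpuE a : zpu a -> [/\ a \is a zp p, a^-1 \is a zp p & a != 0].
Proof. by case/and3P. Qed.

Lemma zpu_nat n : (0 < n < p)%N -> zpu n%:R.
Proof.
case/andP=> n0 np; rewrite /zpu rpred_nat pnatr_eq0 -lt0n n0 andbT /= zpV //.
by rewrite prime_coprime // gtnNdvd.
Qed.

Lemma zpu_natC n : coprime p n -> zpu n%:R.
Proof.
move=> c; rewrite /zpu rpred_nat /= zpV // pnatr_eq0.
by apply: contraTneq c => ->; rewrite /coprime gcdn0 gtn_eqF // prime_gt1.
Qed.

Lemma zpuM a b : zpu a -> zpu b -> zpu (a * b).
Proof.
case/and3P=> ? ? ? /and3P[? ? ?]; rewrite /zpu invfM !rpredM //=.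
by rewrite mulf_neq0.
Qed.

Lemma zpuV a : zpu a -> zpu a^-1.
Proof. by case/and3P=> ? ? ?; rewrite /zpu invrK invr_eq0; apply/and3P. Qed.

Lemma zpuN a : zpu a -> zpu (- a).
Proof. by case/and3P=> ? ? ?; rewrite /zpu invrN !rpredN oppr_eq0; apply/and3P. Qed.

Lemma zpu1 : zpu 1. Proof. by rewrite /zpu invr1 rpred1 oner_eq0. Qed.

Lemma zpuX a n : zpu a -> zpu (a ^+ n).
Proof. by move=> h; elim: n => [|n IH]; rewrite ?expr0 ?zpu1 // exprS zpuM. Qed.

Lemma zpu_prod (I : Type) (s : seq I) (Q : pred I) (F : I -> rat) :
  (forall i, Q i -> zpu (F i)) -> zpu (\prod_(i <- s | Q i) F i).
Proof. by move=> h; apply: (big_ind zpu) => //; [exact: zpu1 | exact: zpuM]. Qed.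

(** Clearing denominators leaves p^n dividing [numq a] times a number prime to p. This passes from
    [eqm] to the divisibility used in [rat_congr]. *)
Lemma zp_num_dvd a n : a \is a zp p -> eqm p n a 0 ->
   ((p ^ n)%N%:Z %| numq a)%Z.
Proof.
move=> az /eqmP [r /zpP [m [d cd rd]]]; rewrite add0r => ar.
have ad : a * (denq a)%:~R = (numq a)%:~R.
  by rewrite -[X in X * _]divq_num_den divfK // intr_eq0 denq_neq0.
have : (numq a * d%:Z)%:~R = ((p ^ n)%N%:Z * m * denq a)%:~R :> rat.
  rewrite !rmorphM /= -rd -!pmulrn natrX -ad.
  by set D := (denq a)%:~R; rewrite ar; ring.
move/eqP; rewrite eqr_int => /eqP e.
have : (`|(p ^ n)%N%:Z| %| `|numq a| * d)%N.
  have := congr1 absz e; rewrite !abszM !absz_nat => ->.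
  by rewrite -mulnA dvdn_mulr.
by rewrite absz_nat Gauss_dvdl ?coprimeXl.
Qed.

Lemma zp_unit a : a \is a zp p -> ~ eqm p 1 a 0 -> zpu a.
Proof.
move=> az na.
have a0 : a != 0 by apply/eqP => a0; apply: na; rewrite a0 eqm_refl.
rewrite /zpu az a0 andbT /=.
have ad : a * (denq a)%:~R = (numq a)%:~R.
  by rewrite -[X in X * _]divq_num_den divfK // intr_eq0 denq_neq0.
apply/zpP; exists (Num.sg (numq a) * denq a), `|numq a|%N.
  rewrite prime_coprime //; apply/negP => /dvdnP [q e]; apply: na.
  apply/eqmP; exists ((Num.sg (numq a))%:~R * q%:R * (denq a)%:~R^-1).
    rewrite rpredM ?rpredM ?rpred_int ?rpred_nat //.
    by have := @zpV p `|denq a|%N az; rewrite pmulrn absz_denq.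
  have e2 : (numq a)%:~R = (Num.sg (numq a))%:~R * q%:R * P.
    by rewrite [X in X%:~R = _]numEsg -abszE e rmorphM /= -pmulrn natrM mulrA.
  rewrite -[LHS]divq_num_den {1}e2; set A := _%:~R; set B := _%:~R; ring.
apply: (mulfI a0); rewrite mulrA divff // mul1r rmorphM /= mulrCA ad -rmorphM /=.
by rewrite pmulrn abszE normrEsg.
Qed.

Lemma eqm1_unit a : zpu a -> ~ eqm p 1 a 0.
Proof.
case/and3P=> az aVz a0 h.
have := eqmMl aVz h; rewrite mulr0 mulVf // => /(zp_num_dvd (rpred1 _)).
by rewrite expn1 dvdz1 absz_nat => /eqP p1; move: pr; rewrite p1.
Qed.

Lemma eqm_zpu n a b : (0 < n)%N -> eqm p n a b -> zpu b -> zpu a.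
Proof.
move=> n0 /(eqmW n0) h bu; have [bz _ _] := zpuE bu.
apply: zp_unit; first exact: eqm_zpl h bz.
by move=> ha; apply: (eqm1_unit bu); apply: eqm_trans ha; apply: eqm_sym.
Qed.

Lemma eqmV n a b : (0 < n)%N -> zpu a -> zpu b -> eqm p n a b -> eqm p n a^-1 b^-1.
Proof.
move=> n0 /zpuE [_ aV a0] /zpuE [_ bV b0] /eqm_sym h.
have := eqmMl (rpredM aV bV) h.
by rewrite divfK // mulrAC mulVf // mul1r.
Qed.

Lemma rat_congrI n a b : a \is a zp p -> b \is a zp p -> eqm p n a b ->
  rat_congr p n a b.
Proof.
move=> az bz h.
have zpi x : x \is a zp p -> p_integral p x.
  rewrite qualifE /= /zp_pred prime_coprime // /p_integral; exact: contra.
split; [exact: zpi | exact: zpi |].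
by apply: zp_num_dvd; rewrite ?rpredB // /eqm subr0.
Qed.

End Congr.

(** * The truncated exponential mod p^3 *)

Section TruncatedExp.
Variables (p : nat) (pr : prime p) (p_gt3 : (3 < p)%N).
Local Notation P := (p%:R : rat).

Lemma zp_half : 2^-1 \is a zp p.
Proof. by apply: zpV; rewrite prime_coprime // gtnNdvd // ltnW. Qed.

Lemma zp_third : 3^-1 \is a zp p.
Proof. by apply: zpV; rewrite prime_coprime // gtnNdvd. Qed.

(** The exponential of p l without its terms from p^3 l^3 / 6 on. As p > 3 it stays additive mod
    p^3, and l counts only mod p^2. *)
Definition texp (l : rat) : rat := 1 + P * l + P ^+ 2 * l ^+ 2 * 2^-1.

Local Notation "a =3 b" := (eqm p 3 a b) (at level 70).

Lemma texp_zp l : l \is a zp p -> texp l \is a zp p.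
Proof. by move=> lz; have h2 := zp_half; rewrite /texp; zp_solve. Qed.

Lemma texpD a b : a \is a zp p -> b \is a zp p ->
  texp a * texp b =3 texp (a + b).
Proof.
move=> az bz; have h2 := zp_half; apply/(eqmP pr).
exists (a * b * (a + b) * 2^-1 + P * a ^+ 2 * b ^+ 2 * 2^-1 * 2^-1); first by zp_solve.
by rewrite /texp; field.
Qed.

Lemma texp_eqm a b : a \is a zp p -> b \is a zp p -> eqm p 2 a b -> texp a =3 texp b.
Proof.
move=> az bz /(eqmP pr) [r rz ->]; have h2 := zp_half; apply/(eqmP pr).
exists (r + P * b * r + P ^+ 3 * r ^+ 2 * 2^-1); first by zp_solve.
by rewrite /texp; field.
Qed.

Lemma texp0 : texp 0 = 1.
Proof. by rewrite /texp; ring. Qed.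

Lemma texp_unit a : a \is a zp p -> zpu p (texp a).
Proof.
move=> az; apply: (@eqm_zpu p pr 1 _ 1) => //; last exact: (zpu1 p).
apply/(eqmP pr); exists (a + P * a ^+ 2 * 2^-1); last by rewrite /texp; ring.
by have h2 := zp_half; zp_solve.
Qed.

Lemma texpN a : a \is a zp p -> (texp a)^-1 =3 texp (- a).
Proof.
move=> az; have [tz tVz t0] := zpuE (texp_unit az).
have naz : - a \is a zp p by rewrite rpredN.
apply: eqm_sym; have := eqmMl tVz (texpD az naz).
by rewrite subrr texp0 mulr1 mulKf.
Qed.

(** The exponent is log(1 + p x) / p, truncated mod p^2. *)
Lemma texp1 x : x \is a zp p -> 1 + P * x =3 texp (x - P * x ^+ 2 * 2^-1).
Proof.
move=> xz; have h2 := zp_half; apply/(eqmP pr).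
exists (x ^+ 3 * 2^-1 - P * x ^+ 4 * 2^-1 * 2^-1 * 2^-1); first by zp_solve.
by rewrite /texp; field.
Qed.

Lemma texp_prod (I : Type) (s : seq I) (Q : pred I) (F : I -> rat) :
  (forall i, Q i -> F i \is a zp p) ->
  \prod_(i <- s | Q i) (1 + P * F i) =3
  texp (\sum_(i <- s | Q i) F i - P * (\sum_(i <- s | Q i) F i ^+ 2) * 2^-1).
Proof.
move=> Fz; have h2 := zp_half.
suff [] : [/\ \sum_(i <- s | Q i) F i \is a zp p,
   \sum_(i <- s | Q i) F i ^+ 2 \is a zp p &
   \prod_(i <- s | Q i) (1 + P * F i) =3
   texp (\sum_(i <- s | Q i) F i - P * (\sum_(i <- s | Q i) F i ^+ 2) * 2^-1)] by [].
apply: (big_rec3 (fun a b c => [/\ a \is a zp p, b \is a zp p &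
    c =3 texp (a - P * b * 2^-1)])) => [|i a b c Qi [az bz h]].
  split; rewrite ?rpred0 //.
  rewrite mulr0 mul0r subr0 texp0; exact: eqm_refl.
have := Fz i Qi; set x := F i => xz.
split; [by zp_solve | by zp_solve |].
have hx := texp1 xz.
have -> : x + a - P * (x ^+ 2 + b) * 2^-1 = (x - P * x ^+ 2 * 2^-1) + (a - P * b * 2^-1) by ring.
apply: eqm_trans (texpD _ _); [|by zp_solve..].
apply: (eqmM _ _ hx h); first by apply: texp_zp; zp_solve.
by apply: (eqm_zpl pr h); apply: texp_zp; zp_solve.
Qed.

(** The difference of the two values is p (a - b) (1 + p (a + b) / 2), whose last factor is a
    unit. *)
Lemma texp_inj a b : a \is a zp p -> b \is a zp p -> texp a =3 texp b -> eqm p 2 a b.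
Proof.
move=> az bz h; have h2 := zp_half.
have P0 := P_neq0 pr.
have e : (a - b) * (1 + P * (a + b) * 2^-1) = (texp a - texp b) / P by rewrite /texp; field.
have u : zpu p (1 + P * (a + b) * 2^-1).
  apply: (@eqm_zpu p pr 1 _ 1) => //; last exact: (zpu1 p).
  apply/(eqmP pr); exists ((a + b) * 2^-1); first by zp_solve.
  by ring.
have [_ uV u0] := zpuE u.
rewrite /eqm; have -> : a - b = (texp a - texp b) / P / (1 + P * (a + b) * 2^-1).
  by rewrite -e mulfK.
have -> : (texp a - texp b) / P / (1 + P * (a + b) * 2^-1) / P ^+ 2 =
  (1 + P * (a + b) * 2^-1)^-1 * ((texp a - texp b) / P ^+ 3).
  by set c := (1 + _)^-1; field.
by rewrite rpredM.
Qed.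

End TruncatedExp.

(** * Harmonic numbers and Fermat quotients *)

Definition harm (e n : nat) : rat := \sum_(1 <= k < n.+1) k%:R ^- e.

Lemma harm0 e : harm e 0 = 0. Proof. by rewrite /harm big_geq. Qed.

Lemma harmS e n : harm e n.+1 = harm e n + n.+1%:R ^- e.
Proof. by rewrite /harm big_nat_recr. Qed.

Lemma harm_sub e m n : (m <= n)%N ->
  \sum_(m.+1 <= k < n.+1) k%:R ^- e = harm e n - harm e m.
Proof.
move=> mn; rewrite /harm [in RHS](big_cat_nat (n := m.+1)) //=.
by rewrite addrAC subrr add0r.
Qed.

Lemma sum_reflect (F : nat -> rat) p k : (k < p)%N ->
  \sum_(1 <= i < p - k) F i + \sum_(1 <= j < k.+1) F (p - j)%N = \sum_(1 <= i < p) F i.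
Proof.
elim: k => [|k IH] kp; first by rewrite subn0 [X in _ + X]big_geq // addr0.
rewrite -IH 1?ltnW // [X in _ + X]big_nat_recr //= addrA addrAC.
congr (_ + _); rewrite (_ : p - k = (p - k.+1).+1)%N; last by lia.
by rewrite big_nat_recr //=; lia.
Qed.

(** With p = 2 h + 1 an odd k is p - 2 j, so both halves become sums over consecutive integers, the
    second one ending at h. *)
Lemma sum_parity (F : nat -> rat) h N : (N <= 2 * h)%N ->
  \sum_(1 <= k < N.+1) F k =
  \sum_(1 <= l < N./2.+1) F (2 * l)%N
   + \sum_((h - uphalf N).+1 <= j < h.+1) F ((2 * h).+1 - 2 * j)%N.
Proof.
elim: N => [|N IH] Nh; first by rewrite /= subn0 !big_geq ?addr0.
rewrite big_nat_recr //= IH 1?ltnW //.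
have := odd_double_half N; rewrite uphalf_half; case: (odd N) => /= eN.
  rewrite [in RHS]big_nat_recr //= add1n addrAC; congr (_ + F _ + _); lia.
rewrite add0n in eN *; rewrite -addrA; congr (_ + _).
rewrite [in RHS]big_nat_recl /=; last by lia.
rewrite addrC; congr (F _ + _); first by lia.
rewrite big_add1 (_ : (h - N./2) = (h - N./2.+1).+1)%N //; lia.
Qed.

Lemma divn_range a q d : (q * d <= a < q.+1 * d)%N -> (a %/ d = q)%N.
Proof.
move=> /andP [h1 h2]; have d0 : (0 < d)%N by case: d h1 h2 => // _; rewrite !muln0.
rewrite -(subnKC h1) divnMDl // divn_small ?addn0 //.
by rewrite ltn_subLR // -mulSnr.
Qed.

Section Wolstenholme.
Variables (p : nat) (pr : prime p) (p_gt3 : (3 < p)%N).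
Local Notation P := (p%:R : rat).
Local Notation h := (p./2).

Lemma p_half : p = (2 * h).+1.
Proof.
have [p2|op] := even_prime pr; first by move: p_gt3; rewrite p2.
by rewrite -[LHS]odd_double_half op mul2n.
Qed.

Lemma natV_zp k : (0 < k < p)%N -> (k%:R^-1 : rat) \is a zp p.
Proof. by move=> /(zpu_nat pr) /zpuE []. Qed.

Lemma natVX_zp e k : (0 < k < p)%N -> (k%:R ^- e : rat) \is a zp p.
Proof. by move=> hk; rewrite -exprVn rpredX // natV_zp. Qed.

Lemma harm_zp e n : (n < p)%N -> harm e n \is a zp p.
Proof.
move=> np; rewrite /harm big_nat; apply: rpred_sum => k /andP [k0 kn].
by apply: natVX_zp; rewrite k0; apply: leq_ltn_trans np.
Qed.

Lemma recip_sub k : (0 < k < p)%N ->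
  eqm p 2 ((p - k)%:R ^- 1) (- (k%:R ^- 1) - P * k%:R ^- 2).
Proof.
move=> hk; have hk' : (0 < p - k < p)%N by lia.
have kz := natV_zp hk; have kz' := natV_zp hk'.
have [_ _ k0] := zpuE (zpu_nat pr hk); have [_ _ k0'] := zpuE (zpu_nat pr hk').
apply/(eqmP pr); exists ((p - k)%:R^-1 * k%:R^-1 ^+ 2); first by zp_solve.
have e : (p - k)%:R = P - k%:R by rewrite natrB // ltnW //; case/andP: hk.
by rewrite e in k0' *; field; rewrite k0 k0'.
Qed.

Lemma recip_sub2 k : (0 < k < p)%N -> eqm p 1 ((p - k)%:R ^- 2) (k%:R ^- 2).
Proof.
move=> hk; have hk' : (0 < p - k < p)%N by lia.
have kz := natV_zp hk; have kz' := natV_zp hk'.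
have [_ _ k0] := zpuE (zpu_nat pr hk); have [_ _ k0'] := zpuE (zpu_nat pr hk').
have e : (p - k)%:R = P - k%:R by rewrite natrB // ltnW //; case/andP: hk.
apply/(eqmP pr); exists ((2 * k%:R - P) * (p - k)%:R^-1 ^+ 2 * k%:R^-1 ^+ 2).
  by zp_solve.
by rewrite e in k0' *; field; rewrite k0 k0'.
Qed.

Let h2 := zp_half pr p_gt3.

Lemma harm1_parity N : (N < p)%N ->
  eqm p 2 (harm 1 N) (2^-1 * harm 1 N./2 - 2^-1 * (harm 1 h - harm 1 (h - uphalf N))
    - P * 2^-1 * 2^-1 * (harm 2 h - harm 2 (h - uphalf N))).
Proof.
move=> Np; rewrite [harm 1 N]/harm (@sum_parity _ h); last by have := p_half; lia.
rewrite -!harm_sub ?leq_subr // !mulr_sumr -addrA -!sumrN -big_split /=; apply: eqmD.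
  rewrite -[X in eqm _ _ X _]/(\sum_(1 <= l < N./2.+1) ((2 * l)%:R ^- 1 : rat)).
  rewrite (_ : \sum_(1 <= l < N./2.+1) _ = \sum_(1 <= l < N./2.+1) 2^-1 * l%:R^-1) ?eqm_refl //.
  by apply: eq_bigr => l _; rewrite natrM invfM.
apply: eqm_sum_nat => j hj; rewrite -p_half.
have h1 : (0 < 2 * j < p)%N by have := p_half; lia.
apply: eqm_trans (recip_sub h1) _; rewrite natrM.
have [_ _ j0] := zpuE (zpu_nat pr h1); rewrite natrM mulf_eq0 negb_or in j0.
case/andP: j0 => _ j0.
rewrite (_ : - (2 * j%:R) ^- 1 - P * (2 * j%:R) ^- 2 =
   - (2^-1 * j%:R ^- 1) - P * 2^-1 * 2^-1 * j%:R ^- 2) ?eqm_refl //.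
by field; rewrite j0.
Qed.

Lemma harm2_parity N : (N < p)%N ->
  eqm p 1 (harm 2 N) (2^-1 * 2^-1 * (harm 2 N./2 + (harm 2 h - harm 2 (h - uphalf N)))).
Proof.
move=> Np; rewrite [harm 2 N]/harm (@sum_parity _ h); last by have := p_half; lia.
rewrite -!harm_sub ?leq_subr // mulrDr !mulr_sumr; apply: eqmD.
  rewrite (_ : \sum_(1 <= l < N./2.+1) _ = \sum_(1 <= l < N./2.+1) 2^-1 * 2^-1 * l%:R^-2) ?eqm_refl //.
  by apply: eq_bigr => l _; rewrite natrM exprMn expr2 !invfM.
apply: eqm_sum_nat => j hj; rewrite -p_half.
have h1 : (0 < 2 * j < p)%N by have := p_half; lia.
apply: eqm_trans (recip_sub2 h1) _; rewrite natrM exprMn expr2 !invfM.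
exact: eqm_refl.
Qed.

Lemma harm1_reflect k : (k < p)%N ->
  eqm p 2 (harm 1 (p - k).-1 - harm 1 k - P * harm 2 k) (harm 1 p.-1).
Proof.
move=> kp; rewrite /harm !prednK ?subn_gt0 ?prime_gt0 //.
rewrite -(sum_reflect _ kp) -addrA; apply: eqmD; first exact: eqm_refl.
rewrite mulr_sumr -sumrN -sumrB; apply: eqm_sum_nat => j hj.
by apply: eqm_sym; apply: recip_sub; lia.
Qed.

Lemma harm2_reflect k : (k < p)%N ->
  eqm p 1 (harm 2 (p - k).-1 + harm 2 k) (harm 2 p.-1).
Proof.
move=> kp; rewrite /harm !prednK ?subn_gt0 ?prime_gt0 //.
rewrite -(sum_reflect _ kp); apply: eqmD; first exact: eqm_refl.
apply: eqm_sum_nat => j hj.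
by apply: eqm_sym; apply: recip_sub2; lia.
Qed.

(** Reflection makes [harm 2 p.-1] twice [harm 2 h], and splitting by parity makes it half of
    [harm 2 h]; so 3/2 of [harm 2 h] vanishes mod p. *)
Lemma harm2_half : eqm p 1 (harm 2 h) 0.
Proof.
have h3 := zp_third pr p_gt3.
have ph := p_half.
have hp : (h < p)%N by lia.
have := harm2_reflect hp; rewrite (_ : (p - h).-1 = h); last by lia.
move=> /(eqmP pr) [r rz e1].
have pp : (p.-1 < p)%N by lia.
have := harm2_parity pp.
rewrite (_ : (p.-1)./2 = h); last by rewrite [in LHS]ph /= mul2n doubleK.
rewrite (_ : (h - uphalf p.-1)%N = 0%N); last first.
  by rewrite [in X in uphalf X]ph /= mul2n uphalf_double subnn.
rewrite harm0 => /(eqmP pr) [r' rz' e2].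
apply/(eqmP pr); exists ((r + r') * (2 * 3^-1)); first by zp_solve.
rewrite e2 in e1; move: e1; set x := harm 2 h => e1.
have : x * (3 / 2) = P ^+ 1 * (r + r') by rewrite mulrDr [_ * r]mulrC; lra.
move=> e3; have -> : x = x * (3 / 2) * (2 * 3^-1) by field.
by rewrite e3; ring.
Qed.

Lemma harm2_full : eqm p 1 (harm 2 p.-1) 0.
Proof.
have hp : (h < p)%N by have := p_half; lia.
apply: eqm_trans (eqm_sym (harm2_reflect hp)) _.
rewrite (_ : (p - h).-1 = h); last by have := p_half; lia.
by rewrite -[X in eqm _ _ _ X]addr0; apply: eqmD; apply: harm2_half.
Qed.

(** Wolstenholme's congruence: reflection gives 2 [harm 1 p.-1] = -p [harm 2 p.-1] mod p^2. *)
Lemma harm1_full : eqm p 2 (harm 1 p.-1) 0.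
Proof.
have pp : (p.-1 < p)%N by have := p_half; lia.
have /(eqmP pr) [r rz] := harm1_reflect pp.
rewrite (_ : (p - p.-1).-1 = 0)%N; last by lia.
have /(eqmP pr) [r' rz' ->] := harm2_full.
rewrite harm0 => e.
apply/(eqmP pr); exists (- (r + r') * 2^-1); first by zp_solve.
by lra.
Qed.

(* Combines the even terms with the odd ones, each odd k being replaced by p - k. *)
Lemma harm_relations N : (N < p)%N -> (h - uphalf N = N)%N ->
  eqm p 2 (harm 1 N./2) (harm 1 N + harm 1 h - P * 2^-1 * harm 2 N) /\
  eqm p 1 (harm 2 N./2) (5 * harm 2 N).
Proof.
move=> Np hN.
have /(eqmP pr) [r1 rz1] := harm1_parity Np; have /(eqmP pr) [r2 rz2] := harm2_parity Np.
have /(eqmP pr) [r3 rz3 ->] := harm2_half.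
rewrite hN => e2 e1; split; apply/(eqmP pr).
  exists (2^-1 * r3 - 2 * r1); first by zp_solve.
  by lra.
exists (- 4 * r2 - r3); first by zp_solve.
by lra.
Qed.

Lemma prod_mulmod N : coprime p N ->
  \prod_(1 <= k < p) ((N * k) %% p)%:R = \prod_(1 <= k < p) (k%:R : rat).
Proof.
move=> cN; rewrite -(big_map (fun k => (N * k) %% p)%N xpredT (fun k => k%:R : rat)).
apply: perm_big; set s1 := map _ _; set s2 := index_iota 1 p.
have u2 : uniq s2 by apply: iota_uniq.
have u1 : uniq s1.
  rewrite map_inj_in_uniq // => i j; rewrite !mem_index_iota => hi hj /eqP.
  wlog ij : i j hi hj / (i <= j)%N.
    move=> H e; case/orP: (leq_total i j) => ij; first exact: H.
    by apply/esym; apply: H => //; rewrite eq_sym.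
  rewrite eq_sym eqn_mod_dvd ?leq_mul2l ?ij ?orbT // -mulnBr Gauss_dvdr // => d.
  have [|d0] := posnP (j - i); first by lia.
  by have := dvdn_leq d0 d; lia.
have s12 : {subset s1 <= s2}.
  move=> x /mapP [k]; rewrite !mem_index_iota => /andP [k1 kp] ->.
  apply/andP; split; last by rewrite ltn_pmod ?prime_gt0.
  rewrite lt0n -/(dvdn p _) Gauss_dvdr //.
  by apply/negP => /(dvdn_leq k1); lia.
have [_ m12] := uniq_min_size u1 s12 (eq_leq (esym (size_map _ _))).
exact: uniq_perm.
Qed.

(** As in the proof of Fermat's theorem, multiplication by N permutes the nonzero residues; here
    each residue is kept exactly, as N k - p floor(N k / p), so that N^(p-1) is known beyond its
    class mod p. *)
Lemma mult_prod N : coprime p N ->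
  N%:R ^+ p.-1 * \prod_(1 <= k < p) (1 + P * (- ((N * k) %/ p)%:R / (N * k)%:R)) = 1.
Proof.
move=> cN; have N0 : N%:R != 0 :> rat by have [] := zpuE (zpu_natC pr cN).
set A := \prod_(1 <= k < p) (k%:R : rat).
have /zpuE [_ _ A0] : zpu p A.
  by rewrite /A big_nat; apply: zpu_prod => k; apply: zpu_nat.
apply: (mulfI A0); rewrite mulr1 /A -[in RHS](prod_mulmod cN).
rewrite -[(p.-1)]subn1 -[N%:R ^+ _]prodr_const_nat -!big_split /=.
rewrite big_nat [RHS]big_nat; apply: eq_bigr => k /andP [k1 kp].
have k0 : k%:R != 0 :> rat by rewrite pnatr_eq0; lia.
have := divn_eq (N * k) p => /(congr1 (fun n : nat => n%:R : rat)).
rewrite natrD !natrM => e.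
have -> : ((N * k) %% p)%:R = N%:R * k%:R - ((N * k) %/ p)%:R * P :> rat by rewrite e; ring.
by field; rewrite k0.
Qed.

Lemma fermat_quotientE N : coprime p N -> N%:R ^+ p.-1 = 1 + P * fermat_quotient p N.
Proof.
move=> cN; rewrite /fermat_quotient /= -!pmulrn.
by have P0 := P_neq0 pr; field.
Qed.

(** Both sides are log(N^(p-1)) / p mod p^2, one read off from [mult_prod], the other from
    [1 + P q]. The integrality of q falls out of the same identity. *)
Lemma fermat_quotient_log N : coprime p N ->
  let s e := \sum_(1 <= k < p) (((N * k) %/ p)%:R / (N * k)%:R : rat) ^+ e in
  fermat_quotient p N \is a zp p /\
  eqm p 2 (s 1%N + P * s 2 * 2^-1)
    (fermat_quotient p N - P * fermat_quotient p N ^+ 2 * 2^-1).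
Proof.
move=> cN s; set q := fermat_quotient p N.
have Fz k : (1 <= k < p)%N -> - ((N * k) %/ p)%:R / (N * k)%:R \is a zp p.
  move=> hk; apply: rpredM; first by zp_solve.
  rewrite natrM invfM; apply: rpredM; last exact: natV_zp.
  by have [] := zpuE (zpu_natC pr cN).
have sz e : s e \is a zp p.
  rewrite /s big_nat; apply: rpred_sum => k hk; rewrite rpredX //.
  by have := Fz k hk; rewrite mulNr rpredN.
have h1 := mult_prod cN; rewrite fermat_quotientE // -/q in h1.
have := texp_prod pr p_gt3 (index_iota 1 p) Fz; rewrite -!big_nat /=.
set A := \prod_(_ <= _ < _) _ in h1 *; set l := _ - _ => hA.
have el : l = - (s 1%N + P * s 2 * 2^-1).
  rewrite /l opprD /s; congr (_ - _ * _ * _).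
    by rewrite -sumrN; apply: eq_bigr => k _; rewrite mulNr.
  by apply: eq_bigr => k _; rewrite mulNr sqrrN.
set L := s 1%N + _ in el *.
have Lz : L \is a zp p by have s1 := sz 1%N; have s2 := sz 2; rewrite /L; zp_solve.
have A0 : A != 0 by apply/eqP => A0; move: h1; rewrite A0 mulr0 => /eqP; rewrite eq_sym oner_eq0.
have qA : 1 + P * q = A^-1 by apply: (mulIf A0); rewrite h1 mulVf.
have hq : eqm p 3 (1 + P * q) (texp p L).
  rewrite qA; have lz : l \is a zp p by rewrite el rpredN.
  have tu := texp_unit pr p_gt3 lz.
  have Au : zpu p A by apply: eqm_zpu hA tu.
  apply: eqm_trans (eqmV _ Au tu hA) _ => //.
  by have := texpN pr p_gt3 lz; rewrite el opprK.
have qz : q \is a zp p.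
  have /(eqmP pr) [r rz e] := hq.
  have -> : q = L + P * L ^+ 2 * 2^-1 + P ^+ 2 * r; last by zp_solve.
  have P0 := P_neq0 pr; apply: (mulfI P0).
  by move: e; rewrite /texp => e; apply: (addrI 1); rewrite e; ring.
split=> //; apply: (texp_inj pr p_gt3) => //; first by zp_solve.
by apply: eqm_trans (eqm_sym hq) _; apply: texp1.
Qed.

(** The case N = 2: floor(2 k / p) is 0 for k <= h and 1 beyond, so the sums are tails of harmonic
    sums. *)
Lemma harm1_half_quotient :
  eqm p 2 (- 2^-1 * harm 1 h)
    (fermat_quotient p 2 - P * fermat_quotient p 2 ^+ 2 * 2^-1).
Proof.
have c2 : coprime p 2 by rewrite prime_coprime // gtnNdvd // ltnW.
have [_ hq] := fermat_quotient_log c2; apply: eqm_trans _ hq; apply: eqm_sym.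
have ph := p_half.
have e (i : nat) : (0 < i)%N ->
    \sum_(1 <= k < p) (((2 * k) %/ p)%:R / (2 * k)%:R : rat) ^+ i =
    2^-1 ^+ i * (harm i p.-1 - harm i h).
  move=> i0; rewrite -harm_sub; last by lia.
  rewrite (big_cat_nat (n := h.+1)) //=; last by lia.
  rewrite big_nat big1 ?add0r; last first.
    move=> k /andP [k1 k2]; rewrite divn_small; last by lia.
    by rewrite mul0r expr0n; case: (i) i0.
  rewrite prednK ?prime_gt0 // mulr_sumr big_nat [RHS]big_nat; apply: eq_bigr => k hk.
  have -> : ((2 * k) %/ p = 1)%N by apply: (@divn_range _ 1); lia.
  by rewrite mul1r natrM invfM exprMn !exprVn.
rewrite (e 1%N) // (e 2) //.
have /(eqmP pr) [r1 rz1 ->] := harm2_full; have /(eqmP pr) [r2 rz2 ->] := harm2_half.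
have /(eqmP pr) [r3 rz3 ->] := harm1_full.
apply/(eqmP pr).
exists (2^-1 * r3 + 2^-1 * 2^-1 * 2^-1 * (r1 - r2)); first by zp_solve.
by field.
Qed.

End Wolstenholme.

(** * Rising factorials and terminating hypergeometric sums *)

Definition rf (a : rat) (k : nat) : rat := \prod_(0 <= i < k) (a + i%:R).

Lemma rf0 a : rf a 0 = 1. Proof. by rewrite /rf big_geq. Qed.

Lemma rfS a k : rf a k.+1 = rf a k * (a + k%:R).
Proof. by rewrite /rf big_nat_recr. Qed.

Lemma rf_shift a k : a * rf (a + 1) k = rf a k * (a + k%:R).
Proof.
elim: k => [|k IH]; first by rewrite !rf0; ring.
by rewrite !rfS mulrA IH -natr1; ring.
Qed.

Lemma rf_shift2 a k :
  a * (a + 1) * rf (a + 2) k = rf a k * (a + k%:R) * (a + 1 + k%:R).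
Proof.
have -> : a + 2 = a + 1 + 1 by ring.
by rewrite -mulrA rf_shift mulrA rf_shift.
Qed.

Lemma rf1 k : rf 1 k = k`!%:R.
Proof. by elim: k => [|k IH]; rewrite ?rf0 // rfS IH factS natrM -natr1; ring. Qed.

Lemma rf2 k : rf 2 k = k.+1`!%:R.
Proof. by elim: k => [|k IH]; rewrite ?rf0 // rfS IH (factS k.+1) natrM -!natr1; ring. Qed.

Lemma rf_vanish n k : (n < k)%N -> rf (- n%:R) k = 0.
Proof.
move=> nk; rewrite /rf big_mkord (bigD1 (Ordinal nk)) //=.
by rewrite addNr mul0r.
Qed.

Lemma fact_neq0 k : k`!%:R != 0 :> rat.
Proof. by rewrite pnatr_eq0 -lt0n fact_gt0. Qed.

Lemma rf_gt0 e k : 0 < e -> 0 < rf e k.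
Proof.
move=> e0; elim: k => [|k IH]; first by rewrite rf0.
by rewrite rfS mulr_gt0 // ltr_wpDr.
Qed.

(** Summand of the 3F2 series at 1 with upper parameters a, 1 - a, c and lower parameters e, e. *)
Definition hyp (a c e : rat) (k : nat) : rat :=
  rf a k * rf (1 - a) k * rf c k / (k`!%:R * rf e k ^+ 2).

Section TerminatingWhipple.
Variables (a e : rat) (e_gt0 : 0 < e).

(** Summand of 3F2(-m, a, 1 - a; e, 1 - 2 m - e; 1). The pair a, 1 - a has sum 1 and the lower pair
    has sum 2 (-m) + 1, as Whipple's theorem requires. *)
Let tm (m k : nat) : rat :=
  rf (- m%:R) k * rf a k * rf (1 - a) k /
  (k`!%:R * rf e k * rf (1 - 2 * m%:R - e) k).

Let rf_lt0 m k : (k <= m)%N -> rf (1 - 2 * m%:R - e) k != 0.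
Proof.
elim: k => [|k IH] km; first by rewrite rf0 oner_neq0.
rewrite rfS mulf_neq0 ?IH 1?ltnW // lt_eqF //.
have h : (k.+1%:R <= m%:R :> rat) by rewrite ler_nat.
rewrite -natr1 in h; have := e_gt0; have : 0 <= m%:R :> rat by []; lra.
Qed.

(** Zeilberger's method: a combination of two consecutive values of m is a difference in k, with the
    right-hand side as certificate. *)
Let tm_step m K : (K <= m.+1)%N ->
  let x := - 1 - 2 * m%:R - e in
  \sum_(0 <= k < K) (x * (x + 1) * tm m.+1 k
      - (x * (x + 1) + a * (1 - a)) * tm m k) =
  x * (x + 1) * tm m.+1 K * (K%:R * (e + K%:R - 1)) / (m.+1%:R * (x + K%:R)).
Proof.
move=> Km x; elim: K Km => [|K IH] Km; first by rewrite big_geq //; ring.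
rewrite big_nat_recr //= IH 1?ltnW // /tm.
have m0 : m%:R >= 0 :> rat by [].
have hK : (K.+1%:R <= m.+1%:R :> rat) by rewrite ler_nat.
have K0 : K%:R >= 0 :> rat by [].
rewrite -!natr1 in hK *.
have x_eq : 1 - 2 * (m%:R + 1) - e = x by rewrite /x; ring.
have e1 : rf (- m%:R) K = rf (- (m%:R + 1)) K * (m%:R + 1 - K%:R) / (m%:R + 1).
  have := rf_shift (- (m%:R + 1)) K.
  have -> : - (m%:R + 1) + 1 = - m%:R :> rat by ring.
  move=> h; apply: (@mulfI _ (- (m%:R + 1))); first by rewrite oppr_eq0; lra.
  rewrite h; field; lra.
have xx : x * (x + 1) != 0 by rewrite mulf_neq0 // /x; have := e_gt0; lra.
have n1 : x + K%:R != 0 by rewrite /x; have := e_gt0; lra.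
have n2 : x + 1 + K%:R != 0 by rewrite /x; have := e_gt0; lra.
have r0 : rf x K != 0.
  rewrite -x_eq natr1; apply: rf_lt0; lia.
have e2 : rf (1 - 2 * m%:R - e) K = rf x K * (x + K%:R) * (x + 1 + K%:R) / (x * (x + 1)).
  have -> : 1 - 2 * m%:R - e = x + 2 by rewrite /x; ring.
  by rewrite -rf_shift2 [RHS]mulrC mulKf.
rewrite e2 e1 x_eq !rfS factS natrM -natr1.
have f0 := fact_neq0 K; have re0 : rf e K != 0 by rewrite gt_eqF // rf_gt0.
have e0 : e + K%:R != 0 by have := e_gt0; lra.
have [x0 x1] : x != 0 /\ x + 1 != 0 by apply/andP; rewrite -negb_or -mulf_eq0.
have m1 : m%:R + 1 != 0 :> rat by lra.
have k1 : K%:R + 1 != 0 :> rat by lra.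
move: (rf x K) (rf e K) r0 re0 => R1 R2 r0 re0; clear x_eq e2 xx; rewrite /x in n1 n2 x0 x1 *.
field.
rewrite ?m1 ?k1 ?n1 ?n2 ?r0 ?f0 ?re0 ?e0 ?x0 ?x1 //=.
by rewrite andbT addrA addrAC n2.
Qed.
Lemma whipple_terminating (m : nat) :
  (\sum_(0 <= k < m.+1) tm m k) * rf e (2 * m) =
  \prod_(0 <= j < m) ((e + 2 * j%:R + a) * (e + 2 * j%:R + 1 - a)).
Proof.
elim: m => [|m IH].
  by rewrite big_nat1 big_geq // muln0 /tm !rf0 fact0; field.
rewrite [RHS]big_nat_recr //= -IH.
set x := - 1 - 2 * m%:R - e.
have m0 : m%:R >= 0 :> rat by [].
have xx : x * (x + 1) = (e + (2 * m)%:R) * (e + (2 * m).+1%:R).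
  by rewrite /x -[(2 * m).+1%:R]natr1 natrM; ring.
have step : x * (x + 1) * \sum_(0 <= k < m.+2) tm m.+1 k =
    (x * (x + 1) + a * (1 - a)) * \sum_(0 <= k < m.+1) tm m k.
  (* At K = m + 1 the certificate is minus the last term of the longer sum, because x + m + 1 = -(e
     + m). *)
  have /= h := tm_step (leqnn m.+1); rewrite -/x in h.
  rewrite sumrB -!mulr_sumr in h.
  rewrite big_nat_recr //= mulrDr; move/eqP: h; rewrite subr_eq => /eqP ->.
  rewrite addrAC -[X in _ = X]add0r; congr (_ + _).
  have n0 : x + m.+1%:R != 0 by rewrite /x -natr1; have := e_gt0; lra.
  have n1 : m%:R + 1 != 0 :> rat by lra.
  move: n0; rewrite -natr1 /x => n0; field; rewrite n1 n0 //.
rewrite (_ : 2 * m.+1 = (2 * m).+2)%N; last by rewrite mulnS.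
rewrite !rfS; set r := rf e (2 * m).
transitivity (x * (x + 1) * (\sum_(0 <= k < m.+2) tm m.+1 k) * r); first by rewrite xx; ring.
by rewrite step xx -[(2 * m).+1%:R]natr1 natrM; ring.
Qed.
End TerminatingWhipple.

Lemma hyp_vanish n c e k : (n < k)%N -> hyp (- n%:R) c e k = 0.
Proof. by move=> nk; rewrite /hyp rf_vanish // !mul0r. Qed.

Lemma hyp_sum_ext n c e K : (n < K)%N ->
  \sum_(0 <= k < K) hyp (- n%:R) c e k = \sum_(0 <= k < n.+1) hyp (- n%:R) c e k.
Proof.
move=> nK; rewrite (big_cat_nat (n := n.+1)) //=.
rewrite [X in _ + X]big_nat [X in _ + X]big1 ?addr0 // => i /andP [ni _].
exact: hyp_vanish.
Qed.

(** By Clausen's formula this is P_n(0)^2 for the Legendre polynomial P_n, whence the vanishing for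
    odd n and the two-step recurrence. *)
Definition wsum (n : nat) := \sum_(0 <= k < n.+1) hyp (- n%:R) 2^-1 1 k.

(* The right-hand side is the Zeilberger certificate of the recurrence [wsum_rec]. *)
Lemma wsum_step (a : rat) K : a != 1 -> a != 2 ->
  \sum_(0 <= k < K) ((2 - a) ^+ 2 * hyp (a - 2) 2^-1 1 k
      - (1 - a) ^+ 2 * hyp a 2^-1 1 k) =
  (4 * a - 6) * K%:R ^+ 3 * rf (a - 2) K * rf (1 - a) K * rf 2^-1 K
    / (K`!%:R ^+ 3 * ((a - 1) * (a - 2))).
Proof.
move=> a1 a2.
have a1' : a - 1 != 0 by rewrite subr_eq0.
have a2' : a - 2 != 0 by rewrite subr_eq0.
elim: K => [|K IH]; first by rewrite big_geq //; ring.
rewrite big_nat_recr //= IH /hyp !rf1.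
have -> : rf a K = rf (a - 2) K * (a - 2 + K%:R) * (a - 1 + K%:R) / ((a - 2) * (a - 1)).
  have := rf_shift2 (a - 2) K.
  have -> : a - 2 + 2 = a by ring.
  have -> : a - 2 + 1 = a - 1 by ring.
  by move=> <-; rewrite [RHS]mulrC mulKf // mulf_neq0.
have -> : rf (1 - (a - 2)) K = rf (1 - a) K * (1 - a + K%:R) * (2 - a + K%:R) / ((1 - a) * (2 - a)).
  have := rf_shift2 (1 - a) K.
  have -> : 1 - a + 2 = 1 - (a - 2) by ring.
  have -> : 1 - a + 1 = 2 - a by ring.
  move=> <-; rewrite [RHS]mulrC mulKf // mulf_neq0 //; first by rewrite subr_eq0 eq_sym.
  by rewrite subr_eq0 eq_sym.
rewrite !rfS factS natrM -[K.+1%:R]natr1.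
have f0 := fact_neq0 K.
have k1 : K%:R + 1 != 0 :> rat by rewrite natr1 pnatr_eq0.
have b1 : 1 - a != 0 by rewrite subr_eq0 eq_sym.
have b2 : 2 - a != 0 by rewrite subr_eq0 eq_sym.
by field; rewrite ?f0 ?[1 + K%:R]addrC ?k1 ?b1 ?b2 ?a1' ?a2'.
Qed.

Lemma wsum_rec n : (n%:R + 2) ^+ 2 * wsum n.+2 = (n%:R + 1) ^+ 2 * wsum n.
Proof.
have n0 : n%:R >= 0 :> rat by [].
(* The length n + 3 makes the certificate vanish, through its factor (-n - 2)_(n + 3). *)
have := @wsum_step (- n%:R) n.+3; have -> : - n%:R - 2 = - n.+2%:R :> rat by rewrite -!natr1; ring.
rewrite rf_vanish // mulr0 !mul0r; have h1 : - n%:R != 1 :> rat by lra.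
have h2 : - n%:R != 2 :> rat by lra.
move=> /(_ h1 h2).
have h3 : (n < n.+3)%N by lia.
rewrite sumrB -!mulr_sumr (hyp_sum_ext _ _ h3) hyp_sum_ext // => h.
apply/eqP; rewrite -subr_eq0 -[X in _ == X]h /wsum; apply/eqP.
by set A := \sum_(0 <= k < n.+3) _; set B := \sum_(0 <= k < n.+1) _; ring.
Qed.

Lemma wsum_odd s : wsum (2 * s).+1 = 0.
Proof.
elim: s => [|s IH].
  rewrite /wsum muln0 !big_nat_recr // big_geq // /hyp !rfS !rf0 /=.
  by rewrite !factS fact0; field.
have := wsum_rec (2 * s).+1; rewrite IH mulr0 mulnS => /eqP.
by rewrite mulf_eq0 expf_eq0 /= -natrD pnatr_eq0 addn2 => /eqP.
Qed.

Lemma bin_ratE n k : (k <= n)%N ->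
  'C(n, k)%:R = n`!%:R / (k`!%:R * (n - k)`!%:R) :> rat.
Proof.
move=> kn; rewrite -(bin_fact kn) !natrM mulfK //.
by rewrite mulf_neq0 ?fact_neq0.
Qed.

Lemma central_bin_ratE k : 'C(2 * k, k)%:R = (2 * k)`!%:R / k`!%:R ^+ 2 :> rat.
Proof.
rewrite bin_ratE; last by lia.
by rewrite (_ : 2 * k - k = k)%N ?expr2 //; lia.
Qed.

Lemma bin2_rec s :
  (s%:R + 1) * 'C(2 * s.+1, s.+1)%:R = 2 * (2 * s%:R + 1) * 'C(2 * s, s)%:R :> rat.
Proof.
rewrite !central_bin_ratE (_ : 2 * s.+1 = (2 * s).+2)%N; last by lia.
rewrite !factS !natrM -!natr1 natrM.
have f0 := fact_neq0 s; have k1 : s%:R + 1 != 0 :> rat by rewrite natr1 pnatr_eq0.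
by field; rewrite ?f0 ?k1 ?[1 + s%:R]addrC ?k1.
Qed.

Lemma wsum_even s : wsum (2 * s) = ('C(2 * s, s)%:R / 4 ^+ s) ^+ 2.
Proof.
elim: s => [|s IH].
  by rewrite /wsum muln0 big_nat1 /hyp !rf0 bin0 fact0; field.
have h := wsum_rec (2 * s); rewrite IH in h.
have n0 : s%:R >= 0 :> rat by [].
have n1 : s%:R + 1 != 0 :> rat by lra.
have n2 : (2 * s)%:R + 2 != 0 :> rat by rewrite natrM; lra.
have -> : 'C(2 * s.+1, s.+1)%:R = 2 * (2 * s%:R + 1) * 'C(2 * s, s)%:R / (s%:R + 1) :> rat.
  by rewrite -bin2_rec mulrC mulKf.
rewrite [X in wsum X](_ : _ = (2 * s).+2)%N; last by lia.
rewrite -[wsum _](mulKf (expf_neq0 2 n2)) h natrM [4 ^+ s.+1]exprS.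
rewrite natrM in n2; have q0 : 4 ^+ s != 0 :> rat by rewrite expf_neq0.
by field; rewrite ?q0 ?n1 ?n2 ?[1 + s%:R]addrC ?n1.
Qed.

(** A telescoping certificate tying the V-summand at [a] to the T-summand at [a - 1]; V thus needs
    no recurrence of its own. *)
Lemma vsum_step (a : rat) K : a != 1 ->
  \sum_(0 <= k < K) (a ^+ 2 * hyp a (3 / 2) 2 k - hyp (a - 1) 2^-1 1 k) =
  - 2 * K%:R * (K%:R + a) * rf (a - 1) K * rf (1 - a) K * rf 2^-1 K
    / (K`!%:R ^+ 3 * (a - 1)).
Proof.
move=> a1.
have a1' : a - 1 != 0 by rewrite subr_eq0.
have b1 : 1 - a != 0 by rewrite subr_eq0 eq_sym.
elim: K => [|K IH]; first by rewrite big_geq //; ring.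
rewrite big_nat_recr //= IH /hyp !rf1 rf2.
have -> : rf a K = rf (a - 1) K * (a - 1 + K%:R) / (a - 1).
  have := rf_shift (a - 1) K.
  have -> : a - 1 + 1 = a by ring.
  by move=> <-; rewrite [RHS]mulrC mulKf.
have -> : rf (1 - (a - 1)) K = rf (1 - a) K * (1 - a + K%:R) / (1 - a).
  have := rf_shift (1 - a) K.
  have -> : 1 - a + 1 = 1 - (a - 1) by ring.
  by move=> <-; rewrite [RHS]mulrC mulKf.
have -> : rf (3 / 2) K = rf 2^-1 K * (2^-1 + K%:R) * 2.
  by rewrite -rf_shift; rewrite (_ : 2^-1 + 1 = 3 / 2); field.
rewrite !rfS factS natrM -[K.+1%:R]natr1.
have f0 := fact_neq0 K.
have k1 : K%:R + 1 != 0 :> rat by rewrite natr1 pnatr_eq0.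
by field; rewrite ?f0 ?[1 + K%:R]addrC ?k1 ?b1 ?a1'.
Qed.

Lemma vsum_eval n K : (n < K)%N ->
  n%:R ^+ 2 * \sum_(0 <= k < K) hyp (- n%:R) (3 / 2) 2 k = wsum n.+1.
Proof.
move=> nK; rewrite /wsum hyp_sum_ext // -(@hyp_sum_ext _ _ _ n.+2) //.
have n0 : n%:R >= 0 :> rat by [].
have := @vsum_step (- n%:R) n.+2; have -> : - n%:R - 1 = - n.+1%:R :> rat by rewrite -!natr1; ring.
rewrite rf_vanish // mulr0 !mul0r sumrB -!mulr_sumr sqrrN => h.
by apply/eqP; rewrite -subr_eq0 h //; lra.
Qed.

(** * The summand and its reduction to T and V *)

Definition term (k : nat) : rat := ('C(2 * k, k) ^ 2 * 'C(3 * k, k))%N%:R / 108 ^+ k.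

Lemma term_fact k : term k = (2 * k)`!%:R * (3 * k)`!%:R / (k`!%:R ^+ 5 * 108 ^+ k).
Proof.
have e3 : 'C(3 * k, k)%:R = (3 * k)`!%:R / (k`!%:R * (2 * k)`!%:R) :> rat.
  rewrite bin_ratE; last by lia.
  by rewrite (_ : 3 * k - k = 2 * k)%N //; lia.
rewrite /term natrM natrX central_bin_ratE e3; have f0 := fact_neq0 k; have f1 := fact_neq0 (2 * k).
have q0 : 108 ^+ k != 0 :> rat by rewrite expf_neq0.
by field; rewrite f0 f1 q0.
Qed.

Lemma termE k : term k = hyp 3^-1 2^-1 1 k.
Proof.
rewrite /hyp rf1; elim: k => [|k IH].
  by rewrite term_fact !rf0 !muln0 fact0 expr0; field.
have -> : term k.+1 = term k * ((k%:R + 2^-1) * (k%:R + 3^-1) * (k%:R + 2 / 3) / (k%:R + 1) ^+ 3).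
  rewrite !term_fact (_ : 2 * k.+1 = (2 * k).+2)%N; last by lia.
  rewrite (_ : 3 * k.+1 = (3 * k).+3)%N; last by lia.
  rewrite !factS !natrM -[(3 * k).+3%:R]natr1 -[(3 * k).+2%:R]natr1 -[(3 * k).+1%:R]natr1
    -[(2 * k).+2%:R]natr1 -[(2 * k).+1%:R]natr1 -[k.+1%:R]natr1 !natrM [108 ^+ k.+1]exprS.
  have f0 := fact_neq0 k; have k1 : k%:R + 1 != 0 :> rat by rewrite natr1 pnatr_eq0.
  have q0 : 108 ^+ k != 0 :> rat by rewrite expf_neq0.
  by field; rewrite ?f0 ?[1 + k%:R]addrC ?k1 ?q0.
rewrite IH !rfS factS natrM -[k.+1%:R]natr1.
have f0 := fact_neq0 k; have k1 : k%:R + 1 != 0 :> rat by rewrite natr1 pnatr_eq0.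
by field; rewrite ?f0 ?[1 + k%:R]addrC ?k1.
Qed.

(** With the coefficients 8/25 and 5/126, what is left of the summand is the difference of the last
    expression, a rational multiple of [term K]; induction on K only verifies this. *)
Lemma sum_reduction K :
  \sum_(0 <= k < K) term k / (k + 3)%:R =
  8 / 25 * (\sum_(0 <= k < K) hyp 3^-1 2^-1 1 k)
  - 5 / 126 * (\sum_(0 <= k < K) hyp 3^-1 (3 / 2) 2 k)
  + term K * K%:R * (- (9 / 140) * K%:R ^+ 2 / (K%:R + 2)
     - 27 / 175 * K%:R ^+ 2 / (K%:R + 1) + 153 / 700 * K%:R + 5 / 14).
Proof.
elim: K => [|K IH]; first by rewrite !big_geq //; ring.
have eT : term K.+1 = term K * ((K%:R + 2^-1) * (K%:R + 3^-1) * (K%:R + 2 / 3) / (K%:R + 1) ^+ 3).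
  rewrite !termE /hyp !rf1 !rfS factS natrM -[K.+1%:R]natr1.
  have f0 := fact_neq0 K; have k1 : K%:R + 1 != 0 :> rat by rewrite natr1 pnatr_eq0.
  by field; rewrite ?f0 ?[1 + K%:R]addrC ?k1.
have e1 : hyp 3^-1 2^-1 1 K = term K by rewrite termE.
have e2 : hyp 3^-1 (3 / 2) 2 K = term K * (2 * K%:R + 1) / (K%:R + 1) ^+ 2.
  rewrite termE /hyp rf1 rf2 factS natrM -[K.+1%:R]natr1.
  have -> : rf (3 / 2) K = rf 2^-1 K * (2^-1 + K%:R) * 2.
    by rewrite -rf_shift; rewrite (_ : 2^-1 + 1 = 3 / 2); field.
  have f0 := fact_neq0 K; have k1 : K%:R + 1 != 0 :> rat by rewrite natr1 pnatr_eq0.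
  by field; rewrite ?f0 ?[1 + K%:R]addrC ?k1.
rewrite !big_nat_recr //= IH eT e1 e2 natrD -[K.+1%:R]natr1.
have n0 : K%:R >= 0 :> rat by [].
have k1 : K%:R + 1 != 0 :> rat by lra.
have k2 : K%:R + 2 != 0 :> rat by lra.
have k3 : K%:R + 3 != 0 :> rat by lra.
have k4 : K%:R + 1 + 2 != 0 :> rat by lra.
have k5 : K%:R + 1 + 1 != 0 :> rat by lra.
by field; rewrite ?k1 ?k2 ?k3 ?k4 ?k5.
Qed.

(** * Interpolation in the parameter 1/3 + p x *)

Section Interpolation.
Variables (p : nat) (pr : prime p) (p_gt7 : (7 < p)%N).
Local Notation P := (p%:R : rat).
Let p_gt3 : (3 < p)%N. Proof. exact: leq_trans p_gt7. Qed.

Lemma rf_zp a k : a \is a zp p -> rf a k \is a zp p.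
Proof. by move=> az; apply: rpred_prod => i _; zp_solve. Qed.

Lemma rf_eqm n a b k : a \is a zp p -> b \is a zp p -> eqm p n a b ->
  eqm p n (rf a k) (rf b k).
Proof.
move=> az bz h; apply: eqm_prod => i _; split; [by zp_solve | by zp_solve |].
by apply: eqmD => //; apply: eqm_refl.
Qed.

Lemma rf_unit n k : (0 < n)%N -> (n + k <= p)%N -> zpu p (rf n%:R k).
Proof.
move=> n0 nk; rewrite /rf big_nat; apply: zpu_prod => i /andP [_ ik].
by rewrite -natrD zpu_nat // addn_gt0 n0 /=; apply: leq_trans nk; rewrite ltn_add2l.
Qed.

Lemma fact_unit k : (k < p)%N -> zpu p k`!%:R.
Proof. by move=> kp; have := @rf_unit 1 k isT kp; rewrite rf1. Qed.

Lemma eqm_subP n a b : b \is a zp p -> a = P ^+ n * b -> eqm p n a 0.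
Proof. by move=> bz ->; apply/(eqmP pr); exists b; rewrite // add0r. Qed.

Definition wtop (x : rat) (k : nat) : rat :=
  rf (3^-1 + P * x) k * rf (1 - (3^-1 + P * x)) k.

Lemma wtop_linear k : wtop 0 k \is a zp p /\ exists2 A1, A1 \is a zp p &
  forall x, x \is a zp p -> eqm p 2 (wtop x k) (wtop 0 k + P * A1 * x).
Proof.
have h3 := zp_third pr p_gt3.
elim: k => [|k [IH0 [A1 A1z IH]]].
  rewrite /wtop !rf0 mulr1; split; rewrite ?rpred1 //; exists 0; rewrite ?rpred0 //.
  by move=> x _; rewrite mulr0 mul0r addr0 !rf0 mulr1 eqm_refl.
have wS x : wtop x k.+1 = wtop x k * ((3^-1 + P * x + k%:R) * (1 - (3^-1 + P * x) + k%:R)).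
  by rewrite /wtop !rfS; ring.
split; first by rewrite wS; zp_solve.
exists (A1 * ((3^-1 + k%:R) * (1 - 3^-1 + k%:R)) + wtop 0 k * (1 - 2 * 3^-1)).
  by zp_solve.
move=> x xz; rewrite !wS.
have /(eqmP pr) [r rz ->] := IH x xz.
apply/(eqmP pr).
set w := wtop 0 k in IH0 *.
pose q := (3^-1 + k%:R) * (1 - 3^-1 + k%:R).
exists (r * (3^-1 + P * x + k%:R) * (1 - (3^-1 + P * x) + k%:R)
  + A1 * x * (x * (1 - 2 * 3^-1) - P * x ^+ 2) - w * x ^+ 2); first by zp_solve.
by field.
Qed.

(** The nodes -s, -s, 2 s have mean 0, so this combination annihilates affine functions of x. *)
Lemma wtop_second_diff s k : s \is a zp p ->
  eqm p 2 (2 * wtop (- s) k + wtop (2 * s) k - 3 * wtop 0 k) 0.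
Proof.
move=> sz; have [w0 [A1 A1z h]] := wtop_linear k.
have sN : - s \is a zp p by zp_solve.
have s2 : 2 * s \is a zp p by zp_solve.
have /(eqmP pr) [r1 r1z ->] := h _ sN; have /(eqmP pr) [r2 r2z ->] := h _ s2.
apply: (@eqm_subP _ _ (2 * r1 + r2)); first by zp_solve.
by ring.
Qed.

Variables (e : nat) (he : (0 < e <= 2)%N).
Local Notation E := (e%:R : rat).

Definition pcoef (k : nat) : rat := rf (E - 2^-1) k / (k`!%:R * rf E k ^+ 2).
(** With m = (p + 1) / 2 - e, the moved parameters are -m above and e, 1 - 2 m - e below: the shape
    of Whipple's theorem. *)
Definition qcoef (k : nat) : rat :=
  rf (E - 2^-1 - P / 2) k / (k`!%:R * rf E k * rf (E - P) k).

Lemma pqcoef_eqm k : (k < p - 3)%N -> eqm p 1 (pcoef k) (qcoef k).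
Proof.
move=> kp; have h2 := zp_half pr p_gt3.
have fu : zpu p k`!%:R by apply: fact_unit; lia.
have ru : zpu p (rf E k) by apply: rf_unit; lia.
have e1 : eqm p 1 (E - P) E.
  by apply/(eqmP pr); exists (-1); [zp_solve | ring].
have h1 : eqm p 1 (rf (E - P) k) (rf E k) by apply: rf_eqm => //; zp_solve.
have ru' : zpu p (rf (E - P) k) by apply: (eqm_zpu pr _ h1 ru).
rewrite /pcoef /qcoef; apply: eqmM.
- by apply: rf_zp; zp_solve.
- by have [] := zpuE (zpuV (zpuM fu (zpuX 2 ru))).
- apply: rf_eqm; [by zp_solve | by zp_solve |].
  by apply/(eqmP pr); exists 2^-1; [zp_solve | ring].
- apply: eqmV => //; [exact: zpuM (zpuX 2 ru) | exact: zpuM (zpuM _ _) _ |].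
  rewrite expr2 mulrA; apply: eqmMl; last exact: eqm_sym.
  by have [] := zpuE (zpuM fu ru).
Qed.

Definition psum (x : rat) : rat := \sum_(0 <= k < p - 3) wtop x k * pcoef k.
Definition qsum (x : rat) : rat := \sum_(0 <= k < p - 3) wtop x k * qcoef k.

Lemma psum_hyp x : psum x = \sum_(0 <= k < p - 3) hyp (3^-1 + P * x) (E - 2^-1) E k.
Proof. by apply: eq_bigr => k _; rewrite /wtop /pcoef /hyp !mulrA. Qed.

(* The coefficients [pcoef] and [qcoef] agree mod p, and a second difference of
   the parameter-dependent factor is 0 mod p ^ 2; so the second differences of
   [psum] and [qsum] agree mod p ^ 3. *)
Lemma psum_interp s : s \is a zp p ->
  eqm p 3 (3 * psum 0) (2 * psum (- s) + psum (2 * s)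
     - (2 * qsum (- s) + qsum (2 * s) - 3 * qsum 0)).
Proof.
move=> sz.
have h : eqm p 3 (\sum_(0 <= k < p - 3) (2 * wtop (- s) k + wtop (2 * s) k - 3 * wtop 0 k)
     * (pcoef k - qcoef k)) 0.
  have z : \sum_(0 <= k < p - 3) (0 : rat) = 0 by rewrite big1.
  rewrite -[X in eqm p 3 _ X]z.
  apply: eqm_sum_nat => k /andP [_ kp].
  have /(eqmP pr) [r rz ->] := wtop_second_diff k sz.
  have /(eqmP pr) [r' rz' ->] := pqcoef_eqm kp.
  by apply: (@eqm_subP _ _ (r * r')); [zp_solve | ring].
have eS : \sum_(0 <= k < p - 3) (2 * wtop (- s) k + wtop (2 * s) k - 3 * wtop 0 k)
     * (pcoef k - qcoef k) = 2 * psum (- s) + psum (2 * s) - 3 * psum 0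
       - (2 * qsum (- s) + qsum (2 * s) - 3 * qsum 0).
  rewrite /psum /qsum !mulr_sumr -!big_split /= -!sumrB; apply: eq_bigr => k _; ring.
rewrite eS in h; move/eqm_sym: h; rewrite /eqm => h.
set A := _ - _; rewrite (_ : A = 0 - (2 * psum (- s) + psum (2 * s) - 3 * psum 0
       - (2 * qsum (- s) + qsum (2 * s) - 3 * qsum 0))) //.
by rewrite /A; ring.
Qed.

(** Whipple's sum with m = (p + 1) / 2 - e. The terms with k > m vanish, and m < p - 3, so the range
    of [qsum] contains the whole series. *)
Lemma qsum_eval x :
  qsum x * rf E (p.+1 - 2 * e) = \prod_(0 <= j < uphalf p - e)
    ((E + 2 * j%:R + (3^-1 + P * x)) * (E + 2 * j%:R + 1 - (3^-1 + P * x))).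
Proof.
have [h ph] : exists h, p = (2 * h).+1.
  have [p2|op] := even_prime pr; first by move: p_gt7; rewrite p2.
  by exists p./2; rewrite -[LHS]odd_double_half op mul2n.
have -> : (uphalf p - e = h.+1 - e)%N by rewrite ph uphalfE mul2n -doubleS doubleK.
have -> : (p.+1 - 2 * e = 2 * (h.+1 - e))%N by lia.
have e0 : 0 < E by rewrite ltr0n; case/andP: he.
rewrite -(whipple_terminating _ e0); congr (_ * _).
have hm : (h.+1 - e)%:R = P / 2 + 2^-1 - E.
  by rewrite natrB ?ph -?natr1 ?natrM; [field | lia].
have r1 : 1 - 2 * (h.+1 - e)%:R - E = E - P by rewrite hm; field.
have r2 : - (h.+1 - e)%:R = E - 2^-1 - P / 2 by rewrite hm; field.
rewrite /qsum (big_cat_nat (n := (h.+1 - e).+1)) //=; last by lia.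
rewrite [X in _ + X]big_nat [X in _ + X]big1 ?addr0; last first.
  move=> k /andP [hk _]; rewrite /qcoef -r2 rf_vanish //; ring.
apply: eq_bigr => k _; rewrite /wtop /qcoef -r1 -r2; ring.
Qed.

End Interpolation.

(** * The numbers U mod p and the Fermat quotient of 3 *)

(* The exponential generating function of [U] is 1 / (2 cosh t - 1); [eps] is the
   6-periodic solution of eps (a + 1) + eps (a - 1) = eps a matching it. *)
Definition eps (a : nat) : rat := nth 0 [:: 1; 0; -1; -1; 0; 1] (a %% 6).

Lemma eps_rec a : eps a.+2 = eps a.+1 - eps a.
Proof.
rewrite /eps -[a.+2]addn2 -[a.+1]addn1 -(modnDml a 2) -(modnDml a 1).
have : (a %% 6 < 6)%N := @ltn_pmod a 6 isT.
by case: (a %% 6)%N => [|[|[|[|[|[|]]]]]] //= _; ring.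
Qed.

(** Summation by parts moves the operator f(a+1) + f(a-1) - f(a) onto [eps], which it annihilates;
    only boundary terms remain. *)
Lemma eps_telescope (m N : nat) :
  \sum_(0 <= a < N) eps a * ((a%:R + 1) ^+ (2 * m) + (a%:R - 1) ^+ (2 * m) - a%:R ^+ (2 * m))
  = (eps N - eps N.+1) * N%:R ^+ (2 * m) - eps N * (N%:R - 1) ^+ (2 * m) + 1 - 0 ^+ (2 * m).
Proof.
elim: N => [|N IH].
  by rewrite big_geq // !mulr0n sub0r [(-1) ^+ _]exprM sqrrN !expr1n /eps /=; ring.
rewrite big_nat_recr //= IH eps_rec -[N.+1%:R]natr1.
by rewrite (_ : N%:R + 1 - 1 = N%:R); ring.
Qed.

Lemma sum_even (G : nat -> rat) m :
  \sum_(0 <= j < (2 * m).+1) (1 + (-1) ^+ j) * G j = 2 * \sum_(0 <= k < m.+1) G (2 * k)%N.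
Proof.
elim: m => [|m IH]; first by rewrite muln0 !big_nat1 muln0 expr0; ring.
rewrite [in RHS]big_nat_recr //= (_ : 2 * m.+1 = (2 * m).+2)%N; last by lia.
rewrite big_nat_recr //= big_nat_recr //= IH !exprS exprM sqrrN !expr1n; ring.
Qed.

Lemma even_binomial (x : rat) m :
  (x + 1) ^+ (2 * m) + (x - 1) ^+ (2 * m) =
  2 * \sum_(0 <= k < m.+1) 'C(2 * m, 2 * k)%:R * x ^+ (2 * m - 2 * k).
Proof.
rewrite -(sum_even (fun j => 'C(2 * m, j)%:R * x ^+ (2 * m - j))).
rewrite !exprDn -big_split /= big_mkord; apply: eq_bigr => j _.
by rewrite expr1n !mulr1 -[_ *+ _]mulr_natr -[X in _ + X]mulr_natr; ring.
Qed.

Lemma sum_multiples (F : nat -> rat) d n : (0 < d)%N ->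
  \sum_(1 <= a < n.+1) (d %| a)%N%:R * F a = \sum_(1 <= b < (n %/ d).+1) F (d * b)%N.
Proof.
move=> d0; elim: n => [|n IH]; first by rewrite div0n !big_geq.
rewrite big_nat_recr //= IH divnS //; case: (boolP (d %| n.+1)%N) => /= h.
  rewrite add1n [in RHS]big_nat_recr //= mul1r; congr (_ + F _).
  have := divnS n d0; rewrite h /= add1n => <-; by rewrite mulnC divnK.
by rewrite mul0r addr0 add0n.
Qed.

Section ThirdQuotient.
Variables (p t : nat) (pr : prime p) (p_gt7 : (7 < p)%N) (pt : p = (6 * t - 1)%N).
Local Notation P := (p%:R : rat).
Local Notation x := (harm 1 (2 * t - 1)).
Local Notation X := (harm 2 (2 * t - 1)).
Let p_gt3 : (3 < p)%N. Proof. exact: leq_trans p_gt7. Qed.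
Let h2 := zp_half pr p_gt3.
Let h3 := zp_third pr p_gt3.

Let half_eq : p./2 = (3 * t - 1)%N.
Proof. by have := p_half pr p_gt3; lia. Qed.

Let rel : eqm p 2 (harm 1 (t - 1)) (x + harm 1 (3 * t - 1) - P * 2^-1 * X) /\
          eqm p 1 (harm 2 (t - 1)) (5 * X).
Proof.
have e1 : (2 * t - 1)./2 = (t - 1)%N by lia.
have := @harm_relations p pr p_gt3 (2 * t - 1); rewrite half_eq e1; apply; first by lia.
by rewrite uphalfE; lia.
Qed.

(** The case N = 3: floor(3 k / p) steps up at k = 2 t and k = 4 t, and reflection brings the sums
    up to 4 t - 1 back to 2 t - 1. *)
Lemma harm1_third_quotient :
  eqm p 2 (- (2 / 3) * x - 2 / 9 * P * X)
    (fermat_quotient p 3 - P * fermat_quotient p 3 ^+ 2 * 2^-1).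
Proof.
have c3 : coprime p 3 by rewrite prime_coprime // gtnNdvd.
have [_ hq] := fermat_quotient_log pr p_gt3 c3; apply: eqm_trans _ hq; apply: eqm_sym.
have e (i : nat) : (0 < i)%N ->
    \sum_(1 <= k < p) (((3 * k) %/ p)%:R / (3 * k)%:R : rat) ^+ i =
    3^-1 ^+ i * (harm i (4 * t - 1) - harm i (2 * t - 1)
                 + 2 ^+ i * (harm i p.-1 - harm i (4 * t - 1))).
  move=> i0; rewrite -!harm_sub; [|by lia..].
  rewrite (big_cat_nat (n := (4 * t - 1).+1)) //=; [|by lia..].
  rewrite (big_cat_nat (n := (2 * t - 1).+1)) //=; [|by lia..].
  rewrite big_nat big1 ?add0r; last first.
    move=> k /andP [k1 k2]; rewrite divn_small; last by lia.
    by rewrite mul0r expr0n; case: (i) i0.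
  rewrite prednK ?prime_gt0 // mulrDr !mulr_sumr; congr (_ + _).
    rewrite big_nat [RHS]big_nat; apply: eq_bigr => k hk.
    have -> : ((3 * k) %/ p = 1)%N by apply: (@divn_range _ 1); lia.
    by rewrite mul1r natrM invfM exprMn !exprVn.
  rewrite big_nat [RHS]big_nat; apply: eq_bigr => k hk.
  have -> : ((3 * k) %/ p = 2)%N by apply: (@divn_range _ 2); lia.
  by rewrite natrM invfM !exprMn !exprVn mulrCA.
rewrite (e 1%N) // (e 2) //.
have tp : (2 * t - 1 < p)%N by lia.
have e4 : (p - (2 * t - 1)).-1 = (4 * t - 1)%N by lia.
have /(eqmP pr) [r1 rz1] := harm1_reflect pr p_gt3 tp.
have /(eqmP pr) [r2 rz2] := harm2_reflect pr p_gt3 tp; rewrite e4.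
have /(eqmP pr) [r3 rz3 ->] := harm2_full pr p_gt3.
have /(eqmP pr) [r4 rz4 ->] := harm1_full pr p_gt3.
move=> e5 e6.
have -> : harm 2 (4 * t - 1) = - X + P * (r2 + r3) by lra.
have -> : harm 1 (4 * t - 1) = x + P * X + P ^+ 2 * (r1 + r4) by lra.
apply/(eqmP pr).
exists (3^-1 * (2 * r4 - (r1 + r4)) + 2^-1 * 3^-1 * 3^-1 * (4 * r3 - 3 * (r2 + r3))).
  by zp_solve.
by field.
Qed.

(** As p is 5 mod 6, the classes 5 and 2 of a are the classes 0 and 3 of p - a; multiples of 3,
    counted from both ends, cover the support of [eps]. *)
Lemma eps_split a : (0 < a < p)%N ->
  eps a = (2 * (6 %| a)%N%:R - (3 %| a)%N%:R) + (2 * (6 %| p - a)%N%:R - (3 %| p - a)%N%:R).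
Proof.
move=> ha; rewrite /eps.
have r6 := @ltn_pmod a 6 isT; have ea := divn_eq a 6.
move: (a %/ 6)%N (a %% 6)%N r6 ea => q r r6 ea.
have epa : (p - a = (t - q.+1) * 6 + (5 - r))%N.
  by clear -pt ha r6 ea; lia.
have d3 m : (3 %| m * 6)%N by rewrite dvdn_mull.
rewrite epa ea !(dvdn_addr _ (dvdn_mull _ (dvdnn 6))) !(dvdn_addr _ (d3 _)).
clear -r6; by case: r r6 => [|[|[|[|[|[|]]]]]] //= _; ring.
Qed.

Lemma eps_int a : eps a \is a zp p.
Proof.
rewrite /eps; have : (a %% 6 < 6)%N := @ltn_pmod a 6 isT.
by case: (a %% 6)%N => [|[|[|[|[|[|]]]]]] //= _; zp_solve.
Qed.

(** Power sums twisted by [eps]: mod p they satisfy the recurrence of -U. *)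
Let u (n : nat) : rat := \sum_(0 <= a < p) eps a * a%:R ^+ n.


(** Both [eps p] and [eps p.+1] are 1 because p is 5 mod 6, so mod p the boundary terms of
    [eps_telescope] cancel except for the initial one. *)
Let u_rec m : eqm p 1 (2 * (\sum_(0 <= k < m.+1) 'C(2 * m, 2 * k)%:R * u (2 * m - 2 * k)) - u (2 * m))
   (- 0 ^+ (2 * m)).
Proof.
have -> : 2 * (\sum_(0 <= k < m.+1) 'C(2 * m, 2 * k)%:R * u (2 * m - 2 * k)) - u (2 * m)
  = \sum_(0 <= a < p) eps a * ((a%:R + 1) ^+ (2 * m) + (a%:R - 1) ^+ (2 * m) - a%:R ^+ (2 * m)).
  under [RHS]eq_bigr => a _ do rewrite even_binomial mulrBr mulrCA mulr_sumr.
  rewrite sumrB -mulr_sumr exchange_big /=; congr (_ * _ - _).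
  by apply: eq_bigr => k _; rewrite /u mulr_sumr; apply: eq_bigr => a _; rewrite mulrCA.
rewrite eps_telescope.
have [-> ->] : eps p = 1 /\ eps p.+1 = 1.
  have t0 : (0 < t)%N by clear -pt p_gt7; lia.
  have e1 : p = ((t - 1) * 6 + 5)%N by clear -pt t0; lia.
  by rewrite /eps e1 modnMDl -addnS modnMDl.
have hX : eqm p 1 ((P - 1) ^+ (2 * m)) 1.
  rewrite exprM -[X in eqm _ _ _ X](expr1n _ m); apply: eqmX; [by zp_solve | by zp_solve |].
  by apply/(eqmP pr); exists (P - 2); [zp_solve | ring].
have /(eqmP pr) [r rz ->] := hX.
by apply/(eqmP pr); exists (- r); [zp_solve | ring].
Qed.

Let u_U m : eqm p 1 (u (2 * m)) (- (U (2 * m))%:~R).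
Proof.
elim/ltn_ind: m => m IH.
have /(eqmP pr) [r rz] := u_rec m.
rewrite big_nat_recl //= muln0 subn0 bin0.
case: m IH r rz => [|m] IH r rz.
  rewrite big_geq // muln0 expr0 U_zero => e; apply/(eqmP pr); exists r => //.
  by rewrite -e; ring.
rewrite [0 ^+ _]expr0n muln_eq0 /= U_even // big_add1 /= => e.
have h : eqm p 1 (\sum_(0 <= i < m.+1) 'C(2 * m.+1, 2 * i.+1)%:R * u (2 * m.+1 - 2 * i.+1))
   (\sum_(0 <= i < m.+1) 'C(2 * m.+1, 2 * i.+1)%:R * - (U (2 * m.+1 - 2 * i.+1))%:~R).
  apply: eqm_sum_nat => i hi; apply: eqmMl; first by zp_solve.
  by rewrite -mulnBr subSS; apply: IH; lia.
have /(eqmP pr) [r' rz' e'] := h; rewrite e' in e.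
apply/(eqmP pr); exists (r - 2 * r'); first by zp_solve.
rewrite rmorphM rmorph_sum /=.
under eq_bigr => i _ do rewrite rmorphM /= -pmulrn -[_ * _]opprK -mulrN.
rewrite sumrN; move: e; set s := \sum_(_ <= _ < _) _ => e.
by rewrite rmorphN /=; lra.
Qed.

(** By Fermat a^(p-3) is 1 / a^2, so -U_(p-3) is the sum of eps(a) / a^2. By [eps_split] this is 2
    (2/36 [harm 2 (t - 1)] - X / 9), and [harm 2 (t - 1)] is 5 X. *)
Lemma U_harm2 : eqm p 1 X (- 3 * (U (p - 3))%:~R).
Proof.
have [p1 pm] : (p - 3 = 2 * (3 * t - 2))%N /\ p.-1 = (6 * t - 2)%N by lia.
have uU := u_U (3 * t - 2); rewrite -p1 in uU.
have hF k : (0 < k < p)%N -> eqm p 1 (k%:R ^+ (p - 3)) (k%:R ^- 2).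
  move=> hk; have kz := natV_zp pr hk; have [_ _ k0] := zpuE (zpu_nat pr hk).
  have ck : coprime p k by rewrite prime_coprime // gtnNdvd //; lia.
  have [qz _] := fermat_quotient_log pr p_gt3 ck.
  have := fermat_quotientE pr ck; rewrite (_ : p.-1 = (p - 3) + 2)%N; last by lia.
  rewrite exprD => e; apply/(eqmP pr); exists (fermat_quotient p k * k%:R^-1 ^+ 2).
    by zp_solve.
  have -> : k%:R ^+ (p - 3) = k%:R ^+ (p - 3) * k%:R ^+ 2 / k%:R ^+ 2 :> rat.
    by rewrite mulfK // expf_neq0.
  by rewrite e; field.
pose F (a : nat) : rat := a%:R ^- 2.
pose G (a : nat) : rat := 2 * (6 %| a)%N%:R - (3 %| a)%N%:R.
have GF : \sum_(1 <= a < p) G a * F a = 2^-1 * 3^-1 * 3^-1 * harm 2 (t - 1) - 3^-1 * 3^-1 * X.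
  have -> : \sum_(1 <= a < p) G a * F a =
      2 * (\sum_(1 <= a < p.-1.+1) (6 %| a)%N%:R * F a) - \sum_(1 <= a < p.-1.+1) (3 %| a)%N%:R * F a.
    rewrite prednK ?prime_gt0 // mulr_sumr -sumrB; apply: eq_bigr => a _.
    by rewrite /G mulrBl mulrA.
  rewrite !sum_multiples // /harm (_ : p.-1 %/ 6 = t - 1)%N; last by lia.
  rewrite (_ : p.-1 %/ 3 = 2 * t - 1)%N; last by lia.
  rewrite !mulr_sumr; congr (_ - _); apply: eq_bigr => b _; rewrite /F natrM exprMn invfM.
    by rewrite mulrA; congr (_ * _).
  by congr (_ * _).
have uE : eqm p 1 (u (p - 3)) (\sum_(1 <= a < p) eps a * F a).
  rewrite /u big_ltn ?prime_gt0 // mulr0n expr0n (_ : (p - 3 == 0)%N = false); last by lia.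
  rewrite mulr0 add0r; apply: eqm_sum_nat => a ha; apply: eqmMl; first exact: eps_int.
  exact: hF.
have eE : eqm p 1 (\sum_(1 <= a < p) eps a * F a) (2 * \sum_(1 <= a < p) G a * F a).
  have -> : 2 * (\sum_(1 <= a < p) G a * F a) =
     \sum_(1 <= a < p) (G a * F a + G (p - a)%N * F (p - a)%N).
    rewrite big_split /= [X in _ + X]big_nat_rev /= add1n.
    rewrite [X in _ + X]big_nat [X in _ + X](eq_bigr (fun a => G a * F a)); last first.
      by move=> a ha; rewrite (_ : p - (p.+1 - a.+1) = a)%N //; lia.
    by rewrite -big_nat; ring.
  apply: eqm_sum_nat => a ha; rewrite eps_split // mulrDl; apply: eqmD; first exact: eqm_refl.
  apply: eqmMl; first by zp_solve.
  by apply: eqm_sym; apply: recip_sub2.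
have [_ /(eqmP pr) [r1 rz1 hY]] := rel.
have := eqm_trans uE eE; rewrite GF hY => /(eqmP pr) [r2 rz2 e2].
have /(eqmP pr) [r3 rz3 e3] := uU.
apply/(eqmP pr); exists (3 * (r3 - r2) - 3^-1 * r1); first by zp_solve.
by lra.
Qed.

End ThirdQuotient.

(** * Second differences and central binomial products *)

Lemma odd_harm e N : \sum_(0 <= i < uphalf N) (2 * i + 1)%:R ^- e = harm e N - 2^-1 ^+ e * harm e N./2.
Proof.
elim: N => [|N IH]; first by rewrite !harm0 big_geq //; ring.
rewrite harmS; have := odd_double_half N; rewrite uphalf_half in IH.
rewrite /= uphalf_half; case: (odd N) IH => /= IH eN.
  rewrite add1n in IH *; rewrite IH (harmS e N./2).
  have -> : N.+1%:R = 2 * N./2.+1%:R :> rat by rewrite -natrM; congr _%:R; lia.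
  by rewrite exprMn invfM exprVn; ring.
rewrite add0n in IH *; rewrite big_nat_recr //= IH.
have -> : (2 * N./2 + 1 = N.+1)%N by lia.
by ring.
Qed.

Section SecondDifference.
Variables (p : nat) (pr : prime p) (p_gt3 : (3 < p)%N).
Local Notation P := (p%:R : rat).
Let h2 := zp_half pr p_gt3.
Let h3 := zp_third pr p_gt3.

Lemma texp_prod_scaled (m n : nat) (a : rat) (F : nat -> rat) : a \is a zp p ->
  (forall i, (m <= i < n)%N -> F i \is a zp p) ->
  eqm p 3 (\prod_(m <= i < n) (1 + P * (a * F i)))
    (texp p (a * \sum_(m <= i < n) F i - P * 2^-1 * a ^+ 2 * \sum_(m <= i < n) F i ^+ 2)).
Proof.
move=> az Fz; rewrite big_nat.
have hz i : (m <= i < n)%N -> a * F i \is a zp p by move=> hi; rewrite rpredM // Fz.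
have := texp_prod pr p_gt3 (index_iota m n) hz; congr (eqm p 3 _ (texp p _)).
rewrite -!big_nat /= -mulr_sumr; congr (_ - _).
under eq_bigr => i _ do rewrite exprMn.
by rewrite -mulr_sumr; ring.
Qed.

Lemma texp_invsq (a l : rat) : zpu p a -> l \is a zp p -> eqm p 3 a (texp p l) ->
  eqm p 3 (a ^- 2) (texp p (- 2 * l)).
Proof.
move=> au lz hl; have [az aVz a0] := zpuE au.
have tu := texp_unit pr p_gt3 lz; have hV := @eqmV p 3 _ _ isT au tu hl.
have nlz : - l \is a zp p by zp_solve.
have hV2 := eqm_trans hV (texpN pr p_gt3 lz).
have -> : - 2 * l = - l + - l by ring.
apply: eqm_trans (texpD pr p_gt3 nlz nlz); rewrite -exprVn expr2.
by apply: eqmM => //; apply: texp_zp.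
Qed.

Variables (m n : nat) (u v : nat -> rat) (c : rat).
Hypothesis uz : forall i, (m <= i < n)%N -> u i \is a zp p.
Hypothesis vz : forall i, (m <= i < n)%N -> v i \is a zp p.
Hypothesis cz : c \is a zp p.
Let A1 := \sum_(m <= i < n) u i.
Let A2 := \sum_(m <= i < n) u i ^+ 2.
Let B1 := \sum_(m <= i < n) v i.
Let B2 := \sum_(m <= i < n) v i ^+ 2.

(** Whipple's product once every factor is written as an integer plus a multiple of p. At x = 2/3
    and at x = -1/3 one of the two families of factors becomes 1. *)
Definition linprod (x : rat) : rat :=
  c * \prod_(m <= i < n) ((1 + P * ((x - 2 / 3) * u i)) * (1 + P * ((- x - 3^-1) * v i))).

Let A1z : A1 \is a zp p. Proof. by rewrite /A1 big_nat; apply: rpred_sum. Qed.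
Let B1z : B1 \is a zp p. Proof. by rewrite /B1 big_nat; apply: rpred_sum. Qed.
Let A2z : A2 \is a zp p.
Proof. by rewrite /A2 big_nat; apply: rpred_sum => i hi; rewrite rpredX // uz. Qed.
Let B2z : B2 \is a zp p.
Proof. by rewrite /B2 big_nat; apply: rpred_sum => i hi; rewrite rpredX // vz. Qed.

Lemma linprod_texp x : x \is a zp p ->
  eqm p 3 (linprod x) (c * texp p ((x - 2 / 3) * A1 + (- x - 3^-1) * B1
     - P * 2^-1 * ((x - 2 / 3) ^+ 2 * A2 + (- x - 3^-1) ^+ 2 * B2))).
Proof.
move=> xz; apply: eqmMl => //; rewrite big_split /=.
have az : x - 2 / 3 \is a zp p by zp_solve.
have bz : - x - 3^-1 \is a zp p by zp_solve.
have ha := texp_prod_scaled az uz; have hb := texp_prod_scaled bz vz.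
rewrite -/A1 -/A2 in ha; rewrite -/B1 -/B2 in hb.
have la : (x - 2 / 3) * A1 - P * 2^-1 * (x - 2 / 3) ^+ 2 * A2 \is a zp p by zp_solve.
have lb : (- x - 3^-1) * B1 - P * 2^-1 * (- x - 3^-1) ^+ 2 * B2 \is a zp p by zp_solve.
set L := (X in texp p X).
have -> : L = ((x - 2 / 3) * A1 - P * 2^-1 * (x - 2 / 3) ^+ 2 * A2)
   + ((- x - 3^-1) * B1 - P * 2^-1 * (- x - 3^-1) ^+ 2 * B2) by rewrite /L; ring.
apply: eqm_trans (texpD pr p_gt3 la lb); apply: eqmM => //.
  exact: texp_zp.
by apply: eqm_zpl hb _ => //; apply: texp_zp.
Qed.

(** Mod p^3 only the coefficient of x^2 matters, with weight 2 (1/3)^2 + (2/3)^2 = 2/3. It is half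
    of (A1 - B1)^2, from squaring the linear exponent, minus half of A2 + B2, from the exponent
    itself. *)
Lemma linprod_second_diff :
  eqm p 3 (2 * linprod (- 3^-1) + linprod (2 / 3) - 3 * linprod 0)
    (c * P ^+ 2 * (3^-1 * ((A1 - B1) ^+ 2 - (A2 + B2)))).
Proof.
have s1 : - 3^-1 \is a zp p by zp_solve.
have s2 : 2 / 3 \is a zp p by zp_solve.
have s0 : 0 \is a zp p by zp_solve.
have /(eqmP pr) [r1 rz1 ->] := linprod_texp s1.
have /(eqmP pr) [r2 rz2 ->] := linprod_texp s2.
have /(eqmP pr) [r3 rz3 ->] := linprod_texp s0.
apply/(eqmP pr).
exists (2 * r1 + r2 - 3 * r3 + c * (A1 * A2 + 2^-1 * B1 * B2
   - 3^-1 * 3^-1 * 2^-1 * (2 * A1 + B1) * (4 * A2 + B2)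
   + P * (2^-1 * 2^-1 * A2 ^+ 2 + 2^-1 * 2^-1 * 2^-1 * B2 ^+ 2
     - 2^-1 * 2^-1 * 2^-1 * 3^-1 * 3^-1 * 3^-1 * (4 * A2 + B2) ^+ 2))).
  by zp_solve.
by rewrite /texp; field.
Qed.

End SecondDifference.

Section CentralProducts.
Variables (p : nat) (pr : prime p) (p_gt3 : (3 < p)%N).
Local Notation P := (p%:R : rat).
Local Notation h := (p./2).
Let h2 := zp_half pr p_gt3.
Let h3 := zp_third pr p_gt3.

Definition oddprod (s : nat) : rat := \prod_(0 <= i < s) (1 + P * (- 1 * (2 * i + 1)%:R ^-1)).

Lemma oddprod_texp M : (M < p)%N ->
  eqm p 3 (oddprod (uphalf M)) (texp p (- (harm 1 M - 2^-1 * harm 1 M./2)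
    - P * 2^-1 * (harm 2 M - 2^-1 * 2^-1 * harm 2 M./2))).
Proof.
move=> Mp; have m1 : -1 \is a zp p by zp_solve.
have hz i : (0 <= i < uphalf M)%N -> ((2 * i + 1)%:R^-1 : rat) \is a zp p.
  by move=> hi; apply: natV_zp => //; move: hi; rewrite uphalfE; lia.
have := texp_prod_scaled pr p_gt3 m1 hz; congr (eqm p 3 _ (texp p _)).
have e1 := odd_harm 1 M; have e2 := odd_harm 2 M.
rewrite (eq_bigr (fun i => (2 * i + 1)%:R ^-1 ^+ 2)) in e2; last by move=> i _; rewrite exprVn.
by rewrite e1 e2; ring.
Qed.

(** As h - i = (p - (2 i + 1)) / 2, the binomial C(h, s) is C(-1/2, s) with each factor corrected by
    1 - p / (2 i + 1), and C(-1/2, s)^2 is [wsum (2 * s)]. *)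
Lemma bin_half_central s : (s <= h)%N ->
  'C(h, s)%:R ^+ 2 = wsum (2 * s) * oddprod s ^+ 2.
Proof.
move=> sh; rewrite wsum_even -exprMn.
suff -> : 'C(h, s)%:R = (-1) ^+ s * ('C(2 * s, s)%:R / 4 ^+ s * oddprod s) :> rat.
  by rewrite [LHS]exprMn sqrr_sign mul1r.
elim: s sh => [|s IH] sh.
  by rewrite muln0 !bin0 /oddprod big_geq // !expr0; field.
have hP : P = 2 * h%:R + 1 by rewrite -natrM natr1 -(p_half pr p_gt3).
have s0 : s%:R + 1 != 0 :> rat by rewrite natr1 pnatr_eq0.
have e1 : (s%:R + 1) * 'C(h, s.+1)%:R = (h%:R - s%:R) * 'C(h, s)%:R :> rat.
  by rewrite -natrB 1?ltnW // natr1 -!natrM mul_bin_left.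
apply: (mulfI s0); rewrite e1 IH 1?ltnW //.
rewrite [oddprod s.+1]/oddprod big_nat_recr //= -/(oddprod s) !exprS.
have -> : 'C(2 * s.+1, s.+1)%:R = 2 * (2 * s%:R + 1) * 'C(2 * s, s)%:R / (s%:R + 1) :> rat.
  by rewrite -bin2_rec mulrC mulKf.
have q0 : 4 ^+ s != 0 :> rat by rewrite expf_neq0.
have s1 : 2 * s%:R + 1 != 0 :> rat by rewrite -natrM natr1 pnatr_eq0.
by rewrite natrD natrM hP; field; rewrite ?q0 ?s1 ?[1 + s%:R]addrC ?s0.
Qed.

Lemma oddprod_unit s : (2 * s <= p)%N -> zpu p (oddprod s).
Proof.
move=> sp; rewrite /oddprod big_nat; apply: zpu_prod => i /andP [_ hi].
apply: (@eqm_zpu p pr 1 _ 1) => //; last exact: (zpu1 p).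
apply/(eqmP pr); exists (- 1 * (2 * i + 1)%:R^-1) => //.
have := @natV_zp p pr (2 * i + 1); move=> /(_ ltac:(clear -sp hi; lia)) ?; zp_solve.
Qed.

(** This covers both classes: N = 2 t for p = 6 t + 1 and N = 2 t - 1 for p = 6 t - 1, with
    [uphalf N] = t. *)
Variables (N : nat) (hN : (uphalf N + N = h)%N).
Local Notation x := (harm 1 N).
Local Notation z := (harm 1 h).
Local Notation X := (harm 2 N).
Let Np : (N < p)%N. Proof. by have := p_half pr p_gt3; lia. Qed.
Let hp : (h < p)%N. Proof. by have := p_half pr p_gt3; lia. Qed.
Let xz : x \is a zp p. Proof. exact: harm_zp. Qed.
Let zz : z \is a zp p. Proof. exact: harm_zp. Qed.
Let Xz : X \is a zp p. Proof. exact: harm_zp. Qed.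

Let rel : eqm p 2 (harm 1 N./2) (x + z - P * 2^-1 * X) /\ eqm p 1 (harm 2 N./2) (5 * X).
Proof. by apply: harm_relations => //; lia. Qed.

Lemma oddprod_small : eqm p 3 (oddprod (uphalf N) ^- 2) (texp p (x - z + P / 4 * X)).
Proof.
have ph := p_half pr p_gt3.
have ou : zpu p (oddprod (uphalf N)) by apply: oddprod_unit; clear -ph hN; lia.
have := oddprod_texp Np; have [/(eqmP pr) [r1 rz1 ->] /(eqmP pr) [r2 rz2 ->]] := rel.
move=> hl; apply: eqm_trans (texp_invsq pr p_gt3 ou _ hl) _; first by zp_solve.
apply: texp_eqm => //; [by zp_solve | by rewrite (_ : 4^-1 = 2^-1 * 2^-1) //; zp_solve|].
apply/(eqmP pr); exists (- r1 - 2^-1 * 2^-1 * r2); first by zp_solve.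
by field.
Qed.

(** The odd denominators now run up to p - N - 1, and reflection returns the harmonic numbers to
    N. *)
Lemma oddprod_large : eqm p 3 (oddprod (2 * uphalf N) ^- 2) (texp p (x + 3 / 4 * P * X)).
Proof.
have ph := p_half pr p_gt3.
have ou : zpu p (oddprod (2 * uphalf N)) by apply: oddprod_unit; clear -ph hN; lia.
have Mp : ((p - N).-1 < p)%N by clear -ph; lia.
have uM : uphalf (p - N).-1 = (2 * uphalf N)%N by clear -ph hN; move: hN; rewrite !uphalfE; lia.
have hM : ((p - N).-1)./2 = N by clear -ph hN; move: hN; rewrite !uphalfE; lia.
have := oddprod_texp Mp; rewrite uM hM.
have /(eqmP pr) [r1 rz1] := harm1_reflect pr p_gt3 Np.
have /(eqmP pr) [r2 rz2] := harm2_reflect pr p_gt3 Np.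
have /(eqmP pr) [r3 rz3 ->] := harm2_full pr p_gt3.
have /(eqmP pr) [r4 rz4 ->] := harm1_full pr p_gt3.
move=> e5 e6.
have -> : harm 2 (p - N).-1 = - X + P * (r2 + r3) by lra.
have -> : harm 1 (p - N).-1 = x + P * X + P ^+ 2 * (r1 + r4) by lra.
move=> hl; apply: eqm_trans (texp_invsq pr p_gt3 ou _ hl) _; first by zp_solve.
apply: texp_eqm => //; [by zp_solve | by rewrite (_ : 4^-1 = 2^-1 * 2^-1) //; zp_solve|].
apply/(eqmP pr); exists (2 * (r1 + r4) + (r2 + r3)); first by zp_solve.
by field.
Qed.

End CentralProducts.

(** * Evaluation of T(0) for p = 6 t + 1 *)

Lemma hyp_sym a c e k : hyp (1 - a) c e k = hyp a c e k.
Proof. by rewrite /hyp subKr; congr (_ * _ / _); ring. Qed.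

Lemma sum_shift_harm (e m n : nat) :
  \sum_(0 <= j < n) (2 * (j + 1 + m)%:R : rat)^-1 ^+ e = 2^-1 ^+ e * (harm e (m + n) - harm e m).
Proof.
elim: n => [|n IH]; first by rewrite big_geq // addn0 subrr mulr0.
rewrite big_nat_recr //= IH (addnS m n) harmS invfM exprMn.
by rewrite (_ : n + 1 + m = (m + n).+1)%N; [rewrite -[_ ^- e]exprVn; ring | lia].
Qed.

Section Evaluations.
Variables (p : nat) (pr : prime p) (p_gt7 : (7 < p)%N).
Local Notation P := (p%:R : rat).
Let p_gt3 : (3 < p)%N. Proof. exact: leq_trans p_gt7. Qed.
Let h2 := zp_half pr p_gt3.
Let h3 := zp_third pr p_gt3.

(** The weighted mean of two exponentials exceeds the exponential of the mean by half the variance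
    of the exponents; with weights 2/3 and 1/3 this is (a - a')^2 / 9. The Whipple correction
    subtracts D' / 9. *)
Lemma interp_texp (T b c a a' D D' : rat) :
  b \is a zp p -> a \is a zp p -> a' \is a zp p -> D' \is a zp p -> eqm p 1 c b -> eqm p 1 D D' ->
  eqm p 3 (3 * T) (2 * (b * texp p a) + b * texp p a' - c * P ^+ 2 * (3^-1 * D)) ->
  eqm p 3 T (b * texp p ((2 * a + a') / 3 + P * (((a - a') ^+ 2 - D') / 9))).
Proof.
move=> bz az az' Dz' /(eqmP pr) [r rz ->] /(eqmP pr) [r' rz' ->] /(eqmP pr) [r3 rz3 hT].
have h9 : 9^-1 \is a zp p by rewrite (_ : 9^-1 = 3^-1 * 3^-1) //; zp_solve.
apply/(eqmP pr); pose k := ((a - a') ^+ 2 - D') / 9.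
exists (3^-1 * r3 - (b * r' + D' * r + P * r * r') * 3^-1 * 3^-1
  - b * (2 * a + a') / 3 * k - P * b * k ^+ 2 * 2^-1); first by rewrite /k; zp_solve.
have -> : T = 3 * T / 3 by field.
by rewrite hT /texp /k; field.
Qed.

Lemma psum_qsum_eqm e x : (0 < e <= 2)%N -> x \is a zp p -> eqm p 1 (psum p e x) (qsum p e x).
Proof.
move=> he xz; apply: eqm_sum_nat => k /andP [_ kp]; apply: eqmMl.
  by apply: rpredM; apply: rf_zp; zp_solve.
exact: pqcoef_eqm.
Qed.

Lemma psum_neg e x n : 3^-1 + P * x = - n%:R \/ 1 - (3^-1 + P * x) = - n%:R ->
  psum p e x = \sum_(0 <= k < p - 3) hyp (- n%:R) (e%:R - 2^-1) e%:R k.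
Proof.
move=> h; rewrite psum_hyp; case: h => [->//|h].
by apply: eq_bigr => k _; rewrite -hyp_sym h.
Qed.

Lemma psum1_neg x n : (n < p - 3)%N -> 3^-1 + P * x = - n%:R \/ 1 - (3^-1 + P * x) = - n%:R ->
  psum p 1 x = wsum n.
Proof.
move=> np h; rewrite (psum_neg 1 h) (_ : 1%:R - 2^-1 = 2^-1); last by field.
exact: hyp_sum_ext.
Qed.

Lemma psum2_neg x n : (n < p - 3)%N -> 3^-1 + P * x = - n%:R \/ 1 - (3^-1 + P * x) = - n%:R ->
  n%:R ^+ 2 * psum p 2 x = wsum n.+1.
Proof.
move=> np h; rewrite (psum_neg 2 h) (_ : 2%:R - 2^-1 = 3 / 2); last by field.
exact: vsum_eval.
Qed.

Lemma linprod_eqm1 (m n : nat) (u v : nat -> rat) (c x : rat) :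
  (forall i, (m <= i < n)%N -> u i \is a zp p) ->
  (forall i, (m <= i < n)%N -> v i \is a zp p) -> c \is a zp p -> x \is a zp p ->
  eqm p 1 (linprod p m n u v c x) c.
Proof.
move=> uz vz cz xz; rewrite /linprod -[X in eqm _ _ _ X]mulr1; apply: eqmMl => //.
have z1 : \prod_(m <= i < n) (1 : rat) = 1 by rewrite big1.
rewrite -[X in eqm _ _ _ X]z1 big_nat [X in eqm _ _ _ X]big_nat; apply: eqm_prod => i hi.
have ui := uz i hi; have vi := vz i hi.
split; [by zp_solve | by zp_solve |].
apply/(eqmP pr); exists ((x - 2 / 3) * u i + (- x - 3^-1) * v i
   + P * ((x - 2 / 3) * u i) * ((- x - 3^-1) * v i)); first by zp_solve.
by ring.
Qed.

Section CaseOne.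
Variables (t : nat) (pt : p = (6 * t).+1).
Local Notation x := (harm 1 (2 * t)).
Local Notation z := (harm 1 (3 * t)).
Local Notation X := (harm 2 (2 * t)).
Local Notation b := ('C(3 * t, t)%:R : rat).

Ltac plia := clear -pt p_gt7; lia.

Let h_eq : p./2 = (3 * t)%N. Proof. by have := p_half pr p_gt3; plia. Qed.
Let u_eq : uphalf (2 * t) = t. Proof. by rewrite uphalfE mul2n -addn1 halfD odd_double doubleK addn0. Qed.
Let N_half : (2 * t)./2 = t. Proof. by rewrite mul2n doubleK. Qed.
Let hN : (uphalf (2 * t) + 2 * t = p./2)%N. Proof. by rewrite u_eq h_eq; plia. Qed.
Let PE : P = 6 * t%:R + 1. Proof. by rewrite pt -natr1 natrM. Qed.
Let b_alt : 'C(3 * t, 2 * t) = 'C(3 * t, t).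
Proof. by rewrite -bin_sub; [congr 'C(_, _); plia | plia]. Qed.

Lemma caseone_bin_unit : zpu p b.
Proof.
rewrite bin_ratE; last by plia.
have f n : (n < p)%N -> zpu p (n`!%:R : rat) by apply: fact_unit.
by apply: zpuM; [apply: f; plia | apply: zpuV; apply: zpuM; apply: f; plia].
Qed.

Let u (j : nat) : rat := (2 * (j + 1 + 2 * t)%:R)^-1.
Let v (j : nat) : rat := (2 * (j + 1 + t)%:R)^-1.
Let c : rat := \prod_(0 <= j < 3 * t) ((2 * (j + 1 + 2 * t)%:R) * (2 * (j + 1 + t)%:R))
    / (p.-1)`!%:R.

Let inv_zp k : (0 < k < p)%N -> ((2 * k%:R : rat)^-1) \is a zp p.
Proof. by move=> hk; rewrite invfM rpredM // natV_zp. Qed.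
Let uz i : (0 <= i < 3 * t)%N -> u i \is a zp p.
Proof. by move=> hi; apply: inv_zp; move: hi; plia. Qed.
Let vz i : (0 <= i < 3 * t)%N -> v i \is a zp p.
Proof. by move=> hi; apply: inv_zp; move: hi; plia. Qed.
Let cz : c \is a zp p.
Proof.
have pp : (p.-1 < p)%N by plia.
rewrite /c; apply: rpredM; first by apply: rpred_prod => i _; zp_solve.
by have [] := zpuE (fact_unit pr pp).
Qed.

(** Each Whipple factor is recentred at an even integer, as in 2 j + 4/3 + p y = 2 (j + 1 + 2 t) + p
    (y - 2/3); this is the origin of the constants in [linprod]. *)
Let qsum_lin y : qsum p 1 y = linprod p 0 (3 * t) u v c y.
Proof.
have := qsum_eval pr p_gt7 (e := 1) isT y.
have -> : (uphalf p - 1 = 3 * t)%N by rewrite uphalfE; plia.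
have -> : (p.+1 - 2 * 1 = p.-1)%N by plia.
rewrite rf1 => e; apply: (mulIf (fact_neq0 p.-1)); rewrite e /linprod /c.
rewrite [RHS]mulrAC divfK ?fact_neq0 // -big_split.
apply: eq_bigr => j _; rewrite /= /u /v.
have -> : (j + 1 + 2 * t)%:R = j%:R + 1 + 2 * t%:R :> rat by rewrite natrD natrM natrD.
have -> : (j + 1 + t)%:R = j%:R + 1 + t%:R :> rat by rewrite natrD natrD.
rewrite PE.
have n1 : j%:R + 1 + 2 * t%:R != 0 :> rat by rewrite -natrM natr1 -natrD pnatr_eq0.
have n2 : j%:R + 1 + t%:R != 0 :> rat by rewrite natr1 -natrD pnatr_eq0.
by field; rewrite n1 n2.
Qed.

Lemma caseone_psum1 : eqm p 3 (psum p 1 0) (b ^+ 2 * texp p (x - 2 / 3 * z + P / 12 * X)).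
Proof.
have h4 : 4^-1 \is a zp p by rewrite (_ : 4^-1 = 2^-1 * 2^-1) //; zp_solve.
have xz : x \is a zp p by apply: harm_zp => //; plia.
have zz : z \is a zp p by apply: harm_zp => //; plia.
have Xz : X \is a zp p by apply: harm_zp => //; plia.
have bz : b \is a zp p by exact: rpred_nat.
have s3 : 3^-1 \is a zp p by [].
(* The nodes give 1/3 - p/3 = -2 t and 1 - (1/3 + 2 p/3) = -4 t. *)
have p1 : psum p 1 (- 3^-1) = wsum (2 * t).
  by apply: psum1_neg; [plia | left; rewrite natrM PE; field].
have p2 : psum p 1 (2 * 3^-1) = wsum (2 * (2 * t)).
  by apply: psum1_neg; [plia | right; rewrite !natrM PE; field].
have ht : (t <= p./2)%N by rewrite h_eq; plia.
have h2t : (2 * t <= p./2)%N by rewrite h_eq; plia.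
have o1 := bin_half_central pr p_gt3 ht; have o2 := bin_half_central pr p_gt3 h2t.
rewrite h_eq in o1 o2; rewrite b_alt in o2.
have ou1 : zpu p (oddprod p t) by apply: oddprod_unit => //; plia.
have ou2 : zpu p (oddprod p (2 * t)) by apply: oddprod_unit => //; plia.
have w1 : eqm p 3 (wsum (2 * t)) (b ^+ 2 * texp p (x - z + P / 4 * X)).
  have [_ _ n0] := zpuE ou1.
  rewrite -[wsum _](@mulfK _ (oddprod p t ^+ 2)) ?expf_neq0 // -o1; apply: eqmMl; first by zp_solve.
  by have := oddprod_small pr p_gt3 hN; rewrite u_eq h_eq.
have w2 : eqm p 3 (wsum (2 * (2 * t))) (b ^+ 2 * texp p (x + 3 / 4 * P * X)).
  have [_ _ n0] := zpuE ou2.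
  rewrite -[wsum _](@mulfK _ (oddprod p (2 * t) ^+ 2)) ?expf_neq0 // -o2; apply: eqmMl; first by zp_solve.
  by have := oddprod_large pr p_gt3 hN; rewrite u_eq.
have := psum_interp pr p_gt7 (e := 1) isT s3; rewrite !qsum_lin p1 p2.
have L := linprod_second_diff pr p_gt3 uz vz cz.
(* No factorials are evaluated for [c]: mod p it is [qsum] at -1/3, which agrees with [psum] there,
   that is with [wsum (2 * t)]. *)
have cb : eqm p 1 c (b ^+ 2).
  have s1 : - 3^-1 \is a zp p by zp_solve.
  have e1 := linprod_eqm1 uz vz cz s1; rewrite -qsum_lin in e1.
  apply: eqm_trans (eqm_sym e1) _.
  apply: eqm_trans (eqm_sym (psum_qsum_eqm (e := 1) isT s1)) _; rewrite p1.
  have az : x - z + P / 4 * X \is a zp p by zp_solve.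
  apply: eqm_trans (eqmW pr _ w1) _ => //.
  rewrite -[X in eqm _ _ _ X]mulr1; apply: eqmMl; first by zp_solve.
  by apply/(eqmP pr); exists ((x - z + P / 4 * X) + P * (x - z + P / 4 * X) ^+ 2 * 2^-1);
    [zp_solve | rewrite /texp; ring].
move=> hT.
have hT2 : eqm p 3 (3 * psum p 1 0) (2 * (b ^+ 2 * texp p (x - z + P / 4 * X))
    + b ^+ 2 * texp p (x + 3 / 4 * P * X)
    - c * P ^+ 2 * (3^-1 * ((\sum_(0 <= i < 3 * t) u i - \sum_(0 <= i < 3 * t) v i) ^+ 2 -
      (\sum_(0 <= i < 3 * t) u i ^+ 2 + \sum_(0 <= i < 3 * t) v i ^+ 2)))).
  apply: eqm_trans hT _; apply: eqmB => //; apply: eqmD => //.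
  by apply: eqmMl => //; zp_solve.
have a1z : x - z + P / 4 * X \is a zp p by zp_solve.
have a2z : x + 3 / 4 * P * X \is a zp p by zp_solve.
have Dz : z ^+ 2 + 3 * X \is a zp p by zp_solve.
have b2z : b ^+ 2 \is a zp p by zp_solve.
have hD : eqm p 1 ((\sum_(0 <= i < 3 * t) u i - \sum_(0 <= i < 3 * t) v i) ^+ 2 -
      (\sum_(0 <= i < 3 * t) u i ^+ 2 + \sum_(0 <= i < 3 * t) v i ^+ 2)) (z ^+ 2 + 3 * X).
  (* Reflection replaces 5 t and 4 t by t and 2 t, so mod p the difference of the two sums is
     [harm 1 t - x], which is z. *)
  have su : \sum_(0 <= i < 3 * t) u i = 2^-1 * (harm 1 (2 * t + 3 * t) - x).
    by rewrite -(sum_shift_harm 1).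
  have sv : \sum_(0 <= i < 3 * t) v i = 2^-1 * (harm 1 (t + 3 * t) - harm 1 t).
    by rewrite -(sum_shift_harm 1).
  rewrite su sv !sum_shift_harm.
  have tp : (t < p)%N by plia.
  have t2p : (2 * t < p)%N by plia.
  have e1 : (p - t).-1 = (2 * t + 3 * t)%N by plia.
  have e2 : (p - 2 * t).-1 = (t + 3 * t)%N by plia.
  have := harm1_reflect pr p_gt3 tp; have := harm1_reflect pr p_gt3 t2p.
  have := harm2_reflect pr p_gt3 tp; have := harm2_reflect pr p_gt3 t2p.
  rewrite e1 e2.
  have f1 := eqmW pr (leqnSn 1) (harm1_full pr p_gt3); have f2 := harm2_full pr p_gt3.
  move=> /eqm_trans -/(_ _ f2) /(eqmP pr) [q1 qz1 g1] /eqm_trans -/(_ _ f2) /(eqmP pr) [q2 qz2 g2].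
  move=> /(eqmW pr (leqnSn 1)) /eqm_trans -/(_ _ f1) /(eqmP pr) [q3 qz3 g3].
  move=> /(eqmW pr (leqnSn 1)) /eqm_trans -/(_ _ f1) /(eqmP pr) [q4 qz4 g4].
  have [] := harm_relations pr p_gt3 (N := 2 * t) t2p; first by rewrite u_eq h_eq; plia.
  rewrite N_half h_eq => /(eqmP pr) [q5 qz5 g5] /(eqmP pr) [q6 qz6 g6].
  have tz : harm 2 t \is a zp p by apply: harm_zp => //; plia.
  have Yz : harm 2 t \is a zp p by apply: harm_zp => //; plia.
  have d1 : 2^-1 * (harm 1 (2 * t + 3 * t) - x) - 2^-1 * (harm 1 (t + 3 * t) - harm 1 t) =
     z + P * (P * q5 - 2^-1 * X + 2^-1 * (harm 2 t + q4 - X - q3)) by lra.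
  have d2 : 2^-1 ^+ 2 * (harm 2 (2 * t + 3 * t) - X) + 2^-1 ^+ 2 * (harm 2 (t + 3 * t) - harm 2 t) =
     - 3 * X + P * (2^-1 * 2^-1 * (q1 + q2 - 2 * q6)) by lra.
  rewrite d1 d2; apply/(eqmP pr).
  set r := (P * q5 - _ + _); set r' := _ * (q1 + _ - _).
  have rz : r \is a zp p by rewrite /r; zp_solve.
  have rz' : r' \is a zp p by rewrite /r'; zp_solve.
  by exists (2 * z * r + P * r ^+ 2 - r'); [zp_solve | ring].
apply: eqm_trans (interp_texp b2z a1z a2z Dz cb hD hT2) _; apply: eqmMl => //.
have h9 : 9^-1 \is a zp p by rewrite (_ : 9^-1 = 3^-1 * 3^-1) //; zp_solve.
have h12 : 12^-1 \is a zp p by rewrite (_ : 12^-1 = 3^-1 * 2^-1 * 2^-1) //; zp_solve.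
apply: texp_eqm => //; [by zp_solve | by zp_solve |].
apply/(eqmP pr); exists ((z * X + P * X ^+ 2 / 4) / 9); first by zp_solve.
by field.
Qed.

(** At the nodes n is 2 t and 4 t, and n^2 V is [wsum] at the odd index n + 1. *)
Lemma caseone_psum2_points :
  [/\ psum p 2 (- 3^-1) = 0 & psum p 2 (2 * 3^-1) = 0].
Proof.
have sol n w : (0 < n)%N -> n%:R ^+ 2 * w = 0 :> rat -> w = 0.
  by move=> n0 /eqP; rewrite mulf_eq0 expf_eq0 /= pnatr_eq0 gtn_eqF // => /eqP.
split.
  apply: (sol (2 * t)%N); first by plia.
  rewrite psum2_neg ?wsum_odd //; first by plia.
  by left; rewrite natrM PE; field.
apply: (sol (2 * (2 * t))%N); first by plia.
rewrite psum2_neg ?wsum_odd //; first by plia.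
by right; rewrite !natrM PE; field.
Qed.

End CaseOne.
End Evaluations.

(** * Products with a factor divisible by p, and V(0) for p = 6 t + 1 *)

Lemma prod_below (k : nat) : \prod_(0 <= i < k) (2 * (i%:R - k%:R)) = (-2) ^+ k * k`!%:R :> rat.
Proof.
elim: k => [|k IH]; first by rewrite big_geq // expr0 mul1r.
rewrite big_nat_recl // (eq_bigr (fun i => 2 * (i%:R - k%:R))); last first.
  by move=> i _; rewrite -!natr1; ring.
by rewrite IH factS natrM exprS mulr0n; ring.
Qed.

Lemma prod_above (k : nat) : \prod_(0 <= i < k) (2 * (i.+1%:R)) = 2 ^+ k * k`!%:R :> rat.
Proof.
elim: k => [|k IH]; first by rewrite big_geq // expr0 mul1r.
by rewrite big_nat_recr //= IH factS natrM exprS; ring.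
Qed.

Lemma fact_predE n : (0 < n)%N -> n`! = (n * (n - 1)`!)%N.
Proof. by case: n => // n _; rewrite subn1. Qed.

Section ZeroProducts.
Variables (p : nat) (pr : prime p) (p_gt7 : (7 < p)%N).
Local Notation P := (p%:R : rat).
Let p_gt3 : (3 < p)%N. Proof. exact: leq_trans p_gt7. Qed.
Let h2 := zp_half pr p_gt3.
Let h3 := zp_third pr p_gt3.

(** Even integers from -2 a to 2 b, all shifted by p c; the factor i = a is p c itself. *)
Definition zprod (a b : nat) (c : rat) : rat :=
  \prod_(0 <= i < a + b.+1) (2 * (i%:R - a%:R) + P * c).

Lemma zprod0 a b : zprod a b 0 = 0.
Proof.
rewrite /zprod (big_cat_nat (n := a)) ?leq_addr //= [X in _ * X]big_ltn; last by rewrite addnS ltnS leq_addr.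
by rewrite subrr !mulr0 addr0 mul0r mulr0.
Qed.

(** One factor is exactly p c, so the others are needed only mod p. *)
Lemma zprod_eqm a b c : c \is a zp p ->
  eqm p 2 (zprod a b c) (P * (c * (2 ^+ (a + b) * (-1) ^+ a * a`!%:R * b`!%:R))).
Proof.
move=> cz; rewrite /zprod (big_cat_nat (n := a)) ?leq_addr //=.
rewrite [X in _ * X]big_ltn; last by rewrite addnS ltnS leq_addr.
rewrite subrr mulr0 add0r [X in _ * (_ * X)](_ : _ = \prod_(0 <= i < b) (2 * i.+1%:R + P * c)); last first.
  rewrite (_ : (a + b.+1 = b + a.+1)%N); last by rewrite addnS addnC addnS.
  rewrite -{1}[a.+1]add0n big_addn addnK; apply: eq_bigr => i _.
  by rewrite addnS -addSn natrD addrK.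
have e1 : eqm p 1 (\prod_(0 <= i < a) (2 * (i%:R - a%:R) + P * c)) ((-2) ^+ a * a`!%:R).
  rewrite -prod_below; apply: eqm_prod => i _; split; [by zp_solve | by zp_solve |].
  by apply/(eqmP pr); exists c; [|rewrite expr1].
have e2 : eqm p 1 (\prod_(0 <= i < b) (2 * i.+1%:R + P * c)) (2 ^+ b * b`!%:R).
  rewrite -prod_above; apply: eqm_prod => i _; split; [by zp_solve | by zp_solve |].
  by apply/(eqmP pr); exists c; [|rewrite expr1].
have /(eqmP pr) [r1 rz1 ->] := e1; have /(eqmP pr) [r2 rz2 ->] := e2.
rewrite exprD -[-2]mulN1r exprMn.
apply/(eqmP pr).
exists (c * (r1 * (2 ^+ b * b`!%:R) + (-1) ^+ a * 2 ^+ a * a`!%:R * r2 + P * r1 * r2)).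
  by zp_solve.
by ring.
Qed.

Lemma zprod_mul_eqm a b c d : c \is a zp p -> d \is a zp p ->
  eqm p 3 (zprod a b c * zprod b a d)
    (P ^+ 2 * (c * d * 2 ^+ (2 * (a + b)) * (-1) ^+ (a + b) * (a`!%:R * b`!%:R) ^+ 2)).
Proof.
move=> cz dz.
have /(eqmP pr) [r1 rz1 ->] := zprod_eqm a b cz; have /(eqmP pr) [r2 rz2 ->] := zprod_eqm b a dz.
apply/(eqmP pr).
exists (r1 * (d * (2 ^+ (b + a) * (-1) ^+ b * b`!%:R * a`!%:R)) +
  r2 * (c * (2 ^+ (a + b) * (-1) ^+ a * a`!%:R * b`!%:R)) + P * r1 * r2).
  by zp_solve.
by rewrite (addnC b a) !exprM -!(exprM 2 2) mulnC exprM [(-1) ^+ (a + b)]exprD; ring.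
Qed.

Lemma fact_reflect k : (k < p)%N ->
  eqm p 1 (p.-1)`!%:R ((-1) ^+ k * k`!%:R * (p.-1 - k)`!%:R).
Proof.
elim: k => [|k IH] kp; first by rewrite subn0 !mul1r; exact: eqm_refl.
apply: eqm_trans (IH (ltnW kp)) _.
rewrite (_ : p.-1 - k = (p.-1 - k.+1).+1)%N; last by lia.
rewrite !factS !natrM; apply/(eqmP pr).
exists ((-1) ^+ k * k`!%:R * (p.-1 - k.+1)`!%:R); first by zp_solve.
have -> : (p.-1 - k.+1).+1%:R = P - k.+1%:R :> rat by rewrite -natrB; [congr _%:R; lia | lia].
by rewrite exprS; ring.
Qed.

Lemma Wilson_eqm : eqm p 1 (p.-1)`!%:R (-1).
Proof.
have := Wilson (prime_gt1 pr); rewrite pr => /esym /dvdnP [q e].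
apply/(eqmP pr); exists q%:R; first by zp_solve.
by rewrite expr1 mulrC -natrM -e -natr1; ring.
Qed.

Lemma fact_half_sq : eqm p 1 ((-1) ^+ p./2 * (p./2)`!%:R ^+ 2) (-1).
Proof.
have ph := p_half pr p_gt3; have hp : (p./2 < p)%N by clear -ph; lia.
have := fact_reflect hp; rewrite (_ : p.-1 - p./2 = p./2)%N; last by clear -ph; lia.
move=> h; apply: eqm_trans _ Wilson_eqm; rewrite expr2 mulrA; exact: eqm_sym.
Qed.

Lemma pow2_eqm : eqm p 1 (2 ^+ p.-1) 1.
Proof.
have c2 : coprime p 2 by rewrite prime_coprime // gtnNdvd // ltnW.
have [qz _] := fermat_quotient_log pr p_gt3 c2.
by rewrite (fermat_quotientE pr c2); apply/(eqmP pr); exists (fermat_quotient p 2).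
Qed.

(** When the node values vanish on both sides, the interpolation identity compares only the values
    at 0. *)
Lemma psum_of_zero_points e s : (0 < e <= 2)%N -> s \is a zp p ->
  psum p e (- s) = 0 -> psum p e (2 * s) = 0 -> qsum p e (- s) = 0 -> qsum p e (2 * s) = 0 ->
  eqm p 3 (psum p e 0) (qsum p e 0).
Proof.
move=> he sz p1 p2 q1 q2; have := psum_interp pr p_gt7 he sz; rewrite p1 p2 q1 q2.
move=> h; have := eqmMl h3 h; rewrite mulKf //.
by rewrite (_ : 3^-1 * _ = qsum p e 0) //; field.
Qed.

Section CaseOne.
Variables (t : nat) (pt : p = (6 * t).+1).
Local Notation b := ('C(3 * t, t)%:R : rat).
Ltac plia := clear -pt p_gt7; lia.
Let PE : P = 6 * t%:R + 1. Proof. by rewrite pt -natr1 natrM. Qed.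
Let h_eq : p./2 = (3 * t)%N. Proof. by have := p_half pr p_gt3; plia. Qed.

(** For p = 6 t + 1, 2 j + 7/3 + p y is 2 (j - (t - 1)) + p (1/3 + y), and its companion is centred
    at j = 2 t - 1: each family meets a multiple of p once. *)
Lemma caseone_qsum2 y : qsum p 2 y * (p.-2)`!%:R =
  zprod (t - 1) (2 * t - 1) (3^-1 + y) * zprod (2 * t - 1) (t - 1) (2 / 3 - y).
Proof.
have := qsum_eval pr p_gt7 (e := 2) isT y.
have -> : (uphalf p - 2 = t - 1 + (2 * t - 1).+1)%N by rewrite uphalfE; plia.
have -> : (p.+1 - 2 * 2 = p - 3)%N by plia.
rewrite rf2 (_ : (p - 3).+1 = p.-2)%N; last by plia.
move=> ->; rewrite /zprod (_ : (2 * t - 1 + (t - 1).+1 = t - 1 + (2 * t - 1).+1)%N); last by plia.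
rewrite -big_split; apply: eq_bigr => j _ /=.
rewrite !natrB; [|by plia..].
by rewrite natrM PE; field.
Qed.

(** Each of the two products contributes a factor p, so the rest is needed only mod p, where
    Wilson's theorem, 2^(p-1) = 1 and the square of ((p-1)/2)! suffice. *)
Lemma caseone_psum2 : eqm p 3 (psum p 2 0) (- (9 / 2) * P ^+ 2 * b ^- 2).
Proof.
have [p1 p2] := caseone_psum2_points p_gt7 pt.
have qz y : zprod (t - 1) (2 * t - 1) (3^-1 + y) * zprod (2 * t - 1) (t - 1) (2 / 3 - y) = 0 ->
    qsum p 2 y = 0.
  by move=> e; apply: (mulIf (fact_neq0 p.-2)); rewrite caseone_qsum2 e mul0r.
have q1 : qsum p 2 (- 3^-1) = 0 by apply: qz; rewrite subrr zprod0 mul0r.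
have q2 : qsum p 2 (2 * 3^-1) = 0 by apply: qz; rewrite subrr zprod0 mulr0.
apply: eqm_trans (psum_of_zero_points (e := 2) isT h3 p1 p2 q1 q2) _.
have bu := caseone_bin_unit pr p_gt7 pt; have [bz bVz b0] := zpuE bu.
suff h : eqm p 3 (qsum p 2 0 * b ^+ 2) (- (9 / 2) * P ^+ 2).
  have bV2 : b ^- 2 \is a zp p by rewrite -exprVn; zp_solve.
  by have := eqmMr bV2 h; rewrite mulfK ?expf_neq0.
have fu : zpu p ((p.-2)`!%:R : rat) by apply: (fact_unit pr); plia.
have [fz fVz f0] := zpuE fu.
have tu : zpu p ((6 * t)%:R : rat) by apply: (zpu_nat pr); plia.
have [tz tVz t0] := zpuE tu.
have z3 : 2 / 3 \is a zp p by zp_solve.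
have := zprod_mul_eqm (t - 1) (2 * t - 1) h3 z3.
have := caseone_qsum2 0; rewrite addr0 subr0 => <- hq.
set A := ((t - 1)`!%:R : rat); set C := ((2 * t - 1)`!%:R : rat).
have bE : b = (3 * t)`!%:R / ((t%:R * A) * (2 * t%:R * C)).
  rewrite bin_ratE; last by plia.
  rewrite (_ : 3 * t - t = 2 * t)%N; last by plia.
  have e1 : (t`! = t * (t - 1)`!)%N by apply: fact_predE; plia.
  have e2 : ((2 * t)`! = 2 * t * (2 * t - 1)`!)%N by apply: fact_predE; plia.
  by rewrite e1 e2 !natrM.
have A0 : A != 0 by apply: fact_neq0. have C0 : C != 0 by apply: fact_neq0.
have t1 : t%:R != 0 :> rat by move: t0; rewrite natrM mulf_eq0 negb_or => /andP [].
have e6 : (2 * (t - 1 + (2 * t - 1)) = 6 * t - 4)%N by plia.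
have e7 : 2 ^+ (6 * t - 4) = 2 ^+ p.-1 / 16 :> rat.
  rewrite (_ : p.-1 = (6 * t - 4) + 4)%N; last by plia.
  by rewrite exprD; field.
have e8 : (-1) ^+ (t - 1 + (2 * t - 1)) = (-1) ^+ p./2 :> rat.
  rewrite h_eq (_ : 3 * t = (t - 1 + (2 * t - 1)) + 2)%N; last by plia.
  by rewrite [RHS]exprD sqrrN expr1n mulr1.
rewrite e6 e7 e8 in hq.
have fV : eqm p 1 (p.-2)`!%:R^-1 1.
  rewrite -[X in eqm _ _ _ X]invr1; apply: eqmV => //; first exact: zpu1.
  have p1' : (1 < p)%N by exact: prime_gt1.
  have := eqm_trans (eqm_sym Wilson_eqm) (fact_reflect p1').
  rewrite (_ : p.-1 - 1 = p.-2)%N; last by plia.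
  by rewrite expr1 mulr1 mulN1r => /eqmN; rewrite !opprK => /eqm_sym.
have tV : eqm p 1 ((6 * t)%:R^-1 ^+ 4) 1.
  have m1 : eqm p 1 ((6 * t)%:R^-1) (-1).
    rewrite -[X in eqm _ _ _ X]invrN1; apply: eqmV => //; first exact: zpuN (zpu1 p).
    by apply/(eqmP pr); exists 1; [zp_solve | rewrite natrM PE; ring].
  rewrite (_ : 1 = (-1) ^+ 4); last by ring.
  by apply: eqmX => //; zp_solve.
have hh := fact_half_sq; rewrite h_eq in hh.
have b2z : b ^+ 2 * (p.-2)`!%:R^-1 \is a zp p by zp_solve.
have := eqmMr b2z hq.
rewrite [X in eqm p 3 X _](_ : _ = qsum p 2 0 * b ^+ 2); last by field.
move=> hq2; apply: eqm_trans hq2 _.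
have /(eqmP pr) [r1 rz1 h1] := pow2_eqm.
have /(eqmP pr) [r2 rz2 h2'] := hh.
have /(eqmP pr) [r3 rz3 h3'] := fV.
have /(eqmP pr) [r4 rz4 h4'] := tV.
rewrite h_eq.
rewrite [X in eqm p 3 X _](_ : _ = P ^+ 2 * (9 / 2 * 2 ^+ p.-1 * ((-1) ^+ (3 * t) * (3 * t)`!%:R ^+ 2)
  * (p.-2)`!%:R^-1 * ((6 * t)%:R^-1 ^+ 4))); last first.
  by rewrite bE natrM; field; rewrite ?A0 ?C0 ?t1 ?f0.
apply: (@eqm_trans _ _ (P ^+ 2 * (9 / 2 * 1 * (-1) * 1 * 1))); last first.
  by rewrite (_ : P ^+ 2 * _ = - (9 / 2) * P ^+ 2); [exact: eqm_refl | ring].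
apply: (@eqm_mulP _ pr 2 1).
have p2z : 2 ^+ p.-1 \is a zp p by zp_solve.
have wz : (-1) ^+ (3 * t) * (3 * t)`!%:R ^+ 2 \is a zp p by zp_solve.
have fz' : (p.-2)`!%:R^-1 \is a zp p by [].
have n92 : 9 / 2 \is a zp p by zp_solve.
apply: eqmM tV; [by zp_solve | by zp_solve |].
apply: eqmM fV; [by zp_solve | by zp_solve |].
apply: eqmM hh; [by zp_solve | by zp_solve |].
by apply: eqmMl => //; exact: pow2_eqm.
Qed.

End CaseOne.
End ZeroProducts.

(** * Evaluation of T(0) and V(0) for p = 6 t - 1 *)

Section CaseTwo.
Variables (p : nat) (pr : prime p) (p_gt7 : (7 < p)%N).
Variables (t : nat) (pt : p = (6 * t - 1)%N).
Local Notation P := (p%:R : rat).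
Ltac plia := clear -pt p_gt7; lia.
Let p_gt3 : (3 < p)%N. Proof. exact: leq_trans p_gt7. Qed.
Let h2 := zp_half pr p_gt3.
Let h3 := zp_third pr p_gt3.

Local Notation x := (harm 1 (2 * t - 1)).
Local Notation z := (harm 1 (3 * t - 1)).
Local Notation X := (harm 2 (2 * t - 1)).
Local Notation B := ('C(3 * t - 1, t - 1)%:R : rat).

Let h_eq : p./2 = (3 * t - 1)%N. Proof. by have := p_half pr p_gt3; plia. Qed.
Let u_eq : uphalf (2 * t - 1) = t. Proof. by rewrite uphalfE; plia. Qed.
Let N_half : (2 * t - 1)./2 = (t - 1)%N. Proof. by plia. Qed.
Let hN : (uphalf (2 * t - 1) + (2 * t - 1) = p./2)%N. Proof. by rewrite u_eq h_eq; plia. Qed.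
Let PE : P = 6 * t%:R - 1. Proof. by rewrite pt natrB ?natrM //; plia. Qed.
Let tE : t%:R = (P + 1) / 6. Proof. by rewrite PE; field. Qed.
Let t_neq0 : t%:R != 0 :> rat. Proof. by rewrite pnatr_eq0; plia. Qed.

Lemma casetwo_bin_unit : zpu p B.
Proof.
rewrite bin_ratE; last by plia.
have f n : (n < p)%N -> zpu p (n`!%:R : rat) by apply: fact_unit.
by apply: zpuM; [apply: f; plia | apply: zpuV; apply: zpuM; apply: f; plia].
Qed.

Let binE : B = (3 * t - 1)`!%:R / ((t - 1)`!%:R * (2 * t%:R * (2 * t - 1)`!%:R)).
Proof.
rewrite bin_ratE; last by plia.
rewrite (_ : 3 * t - 1 - (t - 1) = 2 * t)%N; last by plia.
have e2 : ((2 * t)`! = 2 * t * (2 * t - 1)`!)%N by apply: fact_predE; plia.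
by rewrite e2 !natrM.
Qed.

Let bin_t : 'C(3 * t - 1, t)%:R = 2 * B.
Proof.
rewrite binE bin_ratE; last by plia.
rewrite (_ : 3 * t - 1 - t = 2 * t - 1)%N; last by plia.
have e1 : (t`! = t * (t - 1)`!)%N by apply: fact_predE; plia.
have f1 := fact_neq0 (t - 1); have f2 := fact_neq0 (2 * t - 1).
by rewrite e1 natrM; field; rewrite f1 f2 t_neq0.
Qed.

Let bin_2t : 'C(3 * t - 1, 2 * t)%:R = B.
Proof. by rewrite -bin_sub; [congr 'C(_, _)%:R; plia | plia]. Qed.

(** The roles are exchanged with respect to p = 6 t + 1: now the product for T, not for V, contains
    multiples of p. *)
Let qsum1 y : qsum p 1 y * (p.-1)`!%:R =
  zprod p (2 * t - 1) (t - 1) (2 / 3 + y) * zprod p (t - 1) (2 * t - 1) (3^-1 - y).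
Proof.
have := qsum_eval pr p_gt7 (e := 1) isT y.
have -> : (uphalf p - 1 = t - 1 + (2 * t - 1).+1)%N by rewrite uphalfE; plia.
have -> : (p.+1 - 2 * 1 = p.-1)%N by plia.
rewrite rf1 => ->; rewrite /zprod.
rewrite (_ : (2 * t - 1 + (t - 1).+1 = t - 1 + (2 * t - 1).+1)%N); last by plia.
rewrite -big_split; apply: eq_bigr => j _ /=.
rewrite !natrB; [|by plia..].
by rewrite natrM PE; field.
Qed.

Lemma casetwo_psum1 : eqm p 3 (psum p 1 0) (- 2^-1 * P ^+ 2 * B ^- 2).
Proof.
(* With s = -1/3 the nodes are 1/3 and -2/3, where n is 2 t - 1 and 4 t - 1. *)
have s3 : - 3^-1 \is a zp p by zp_solve.
have p1 : psum p 1 (- - 3^-1) = 0.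
  rewrite (psum1_neg (n := (2 * (t - 1)).+1)) ?wsum_odd //; first by plia.
  right; rewrite (_ : (2 * (t - 1)).+1 = 2 * t - 1)%N; last by plia.
  by rewrite natrB ?natrM ?PE; [field | plia].
have p2 : psum p 1 (2 * - 3^-1) = 0.
  rewrite (psum1_neg (n := (2 * (2 * t - 1)).+1)) ?wsum_odd //; first by plia.
  left; rewrite (_ : (2 * (2 * t - 1)).+1 = 4 * t - 1)%N; last by plia.
  by rewrite natrB ?natrM ?PE; [field | plia].
have qz y : zprod p (2 * t - 1) (t - 1) (2 / 3 + y) * zprod p (t - 1) (2 * t - 1) (3^-1 - y) = 0 ->
    qsum p 1 y = 0.
  by move=> e; apply: (mulIf (fact_neq0 p.-1)); rewrite qsum1 e mul0r.
have q1 : qsum p 1 (- - 3^-1) = 0 by apply: qz; rewrite opprK subrr zprod0 mulr0.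
have q2 : qsum p 1 (2 * - 3^-1) = 0 by apply: qz; rewrite mulrN subrr zprod0 mul0r.
apply: eqm_trans (psum_of_zero_points pr p_gt7 (e := 1) isT s3 p1 p2 q1 q2) _.
have bu := casetwo_bin_unit; have [bz bVz b0] := zpuE bu.
suff h : eqm p 3 (qsum p 1 0 * B ^+ 2) (- 2^-1 * P ^+ 2).
  have bV2 : B ^- 2 \is a zp p by rewrite -exprVn; zp_solve.
  by have := eqmMr bV2 h; rewrite mulfK ?expf_neq0.
have fu : zpu p ((p.-1)`!%:R : rat) by apply: (fact_unit pr); plia.
have [fz fVz f0] := zpuE fu.
have tu : zpu p ((2 * t)%:R : rat) by apply: (zpu_nat pr); plia.
have [tz tVz t0] := zpuE tu.
have z3 : 2 / 3 \is a zp p by zp_solve.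
have := zprod_mul_eqm pr (2 * t - 1) (t - 1) z3 h3.
have := qsum1 0; rewrite addr0 subr0 => <- hq.
have e6 : (2 * (2 * t - 1 + (t - 1)) = 6 * t - 4)%N by plia.
have e7 : 2 ^+ (6 * t - 4) = 2 ^+ p.-1 / 4 :> rat.
  rewrite (_ : p.-1 = (6 * t - 4) + 2)%N; last by plia.
  by rewrite exprD; field.
have e8 : (-1) ^+ (2 * t - 1 + (t - 1)) = - ((-1) ^+ p./2) :> rat.
  rewrite h_eq (_ : 3 * t - 1 = (2 * t - 1 + (t - 1)).+1)%N; last by plia.
  by rewrite [in RHS]exprS mulN1r opprK.
rewrite e6 e7 e8 in hq.
have fV : eqm p 1 (p.-1)`!%:R^-1 (-1).
  rewrite -[X in eqm _ _ _ X]invrN1; apply: eqmV => //; first exact: zpuN (zpu1 p).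
  exact: Wilson_eqm.
have tV : eqm p 1 ((2 * t)%:R^-1 ^+ 2) 9.
  have m1 : eqm p 1 ((2 * t)%:R^-1) 3.
    rewrite -[X in eqm _ _ _ X]invrK; apply: eqmV => //.
      by apply: zpuV; apply: (zpu_nat pr (n := 3)); plia.
    by apply/(eqmP pr); exists 3^-1; [zp_solve | rewrite natrM PE; field].
  rewrite (_ : 9 = 3 ^+ 2); last by ring.
  by apply: eqmX => //; zp_solve.
have hh := fact_half_sq pr p_gt7.
have b2z : B ^+ 2 * (p.-1)`!%:R^-1 \is a zp p by zp_solve.
have := eqmMr b2z hq.
rewrite [X in eqm p 3 X _](_ : _ = qsum p 1 0 * B ^+ 2); last by field.
move=> hq2; apply: eqm_trans hq2 _.
rewrite [X in eqm p 3 X _](_ : _ = P ^+ 2 * (- (2 / 9 / 4) * 2 ^+ p.-1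
  * ((-1) ^+ p./2 * (p./2)`!%:R ^+ 2) * (p.-1)`!%:R^-1 * ((2 * t)%:R^-1 ^+ 2))); last first.
  have f1 := fact_neq0 (t - 1); have f2 := fact_neq0 (2 * t - 1).
  by rewrite binE h_eq natrM; field; rewrite ?f1 ?f2 ?t_neq0 ?f0.
apply: (@eqm_trans _ _ (P ^+ 2 * (- (2 / 9 / 4) * 1 * (-1) * (-1) * 9))); last first.
  by rewrite (_ : P ^+ 2 * _ = - 2^-1 * P ^+ 2); [exact: eqm_refl | field].
apply: (@eqm_mulP _ pr 2 1).
have p2z : 2 ^+ p.-1 \is a zp p by zp_solve.
have wz : (-1) ^+ p./2 * (p./2)`!%:R ^+ 2 \is a zp p by zp_solve.
have n92 : - (2 / 9 / 4) \is a zp p.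
  by rewrite (_ : - (2 / 9 / 4) = - (3^-1 * 3^-1 * 2^-1)) //; zp_solve.
apply: eqmM tV; [by zp_solve | by zp_solve |].
apply: eqmM fV; [by zp_solve | by zp_solve |].
apply: eqmM hh; [by zp_solve | by zp_solve |].
by apply: eqmMl => //; exact: pow2_eqm.
Qed.

Let u (j : nat) : rat := (2 * (j + 1 + 2 * t)%:R)^-1.
Let v (j : nat) : rat := (2 * (j + 1 + t)%:R)^-1.
Let c : rat := \prod_(0 <= j < 3 * t - 2) ((2 * (j + 1 + 2 * t)%:R) * (2 * (j + 1 + t)%:R))
    / (p.-2)`!%:R.

Let inv_zp k : (0 < k < p)%N -> ((2 * k%:R : rat)^-1) \is a zp p.
Proof. by move=> hk; rewrite invfM rpredM // natV_zp. Qed.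
Let uz i : (0 <= i < 3 * t - 2)%N -> u i \is a zp p.
Proof. by move=> hi; apply: inv_zp; move: hi; plia. Qed.
Let vz i : (0 <= i < 3 * t - 2)%N -> v i \is a zp p.
Proof. by move=> hi; apply: inv_zp; move: hi; plia. Qed.
Let cz : c \is a zp p.
Proof.
have pp : (p.-2 < p)%N by plia.
rewrite /c; apply: rpredM; first by apply: rpred_prod => i _; zp_solve.
by have [] := zpuE (fact_unit pr pp).
Qed.

(** The sign of y is reversed because the nodes are 1/3 and -2/3; [linprod] is then again taken at
    -1/3 and 2/3. *)
Let qsum_lin y : qsum p 2 (- y) = linprod p 0 (3 * t - 2) u v c y.
Proof.
have := qsum_eval pr p_gt7 (e := 2) isT (- y).
have -> : (uphalf p - 2 = 3 * t - 2)%N by rewrite uphalfE; plia.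
have -> : (p.+1 - 2 * 2 = p - 3)%N by plia.
rewrite rf2 (_ : (p - 3).+1 = p.-2)%N; last by plia.
move=> e; apply: (mulIf (fact_neq0 p.-2)); rewrite e /linprod /c.
rewrite [RHS]mulrAC divfK ?fact_neq0 // -big_split.
apply: eq_bigr => j _; rewrite /= /u /v.
have -> : (j + 1 + 2 * t)%:R = j%:R + 1 + 2 * t%:R :> rat by rewrite natrD natrM natrD.
have -> : (j + 1 + t)%:R = j%:R + 1 + t%:R :> rat by rewrite natrD natrD.
rewrite PE.
have n1 : j%:R + 1 + 2 * t%:R != 0 :> rat by rewrite -natrM natr1 -natrD pnatr_eq0.
have n2 : j%:R + 1 + t%:R != 0 :> rat by rewrite natr1 -natrD pnatr_eq0.
by field; rewrite n1 n2.
Qed.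

Let inv_sq (d l : rat) : d \is a zp p -> l \is a zp p -> eqm p 2 (d - P * d ^+ 2 * 2^-1) l ->
  eqm p 3 ((1 + P * d) ^- 2) (texp p (- 2 * l)).
Proof.
move=> dz lz h.
have u1 : zpu p (1 + P * d).
  apply: (@eqm_zpu p pr 1 _ 1) => //; last exact: (zpu1 p).
  by apply/(eqmP pr); exists d; rewrite // expr1.
apply: texp_invsq => //; apply: eqm_trans (texp1 pr p_gt3 dz) _.
by apply: texp_eqm => //; zp_solve.
Qed.

(** The scheme of [caseone_psum1]. The factor 9 and the rational constants in the exponent come from
    dividing by n^2, with 2 t - 1 = (p - 2) / 3 and 4 t - 1 = (2 p - 1) / 3, and from boundary terms
    1 / t. *)
Lemma casetwo_psum2 :
  eqm p 3 (psum p 2 0) (9 * B ^+ 2 * texp p (x - 2 / 3 * z + 2 + P * (X / 12 - 1))).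
Proof.
have h4 : 4^-1 \is a zp p by rewrite (_ : 4^-1 = 2^-1 * 2^-1) //; zp_solve.
have xz : x \is a zp p by apply: harm_zp => //; plia.
have zz : z \is a zp p by apply: harm_zp => //; plia.
have Xz : X \is a zp p by apply: harm_zp => //; plia.
have bz : B \is a zp p by exact: rpred_nat.
have s3 : - 3^-1 \is a zp p by zp_solve.
have n1 : (2 * t - 1)%:R != 0 :> rat by rewrite pnatr_eq0; plia.
have n2 : (4 * t - 1)%:R != 0 :> rat by rewrite pnatr_eq0; plia.
have p1 : psum p 2 (- - 3^-1) = wsum (2 * t) / (2 * t - 1)%:R ^+ 2.
  have e : (2 * t - 1).+1 = (2 * t)%N by plia.
  rewrite -[X in wsum X]e -(psum2_neg (p := p) (x := - - 3^-1));
    [by rewrite [RHS]mulrC mulKf ?expf_neq0 | by plia |].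
  by right; rewrite natrB ?natrM ?PE; [field | plia].
have p2 : psum p 2 (2 * - 3^-1) = wsum (2 * (2 * t)) / (4 * t - 1)%:R ^+ 2.
  have e : (4 * t - 1).+1 = (2 * (2 * t))%N by plia.
  rewrite -[X in wsum X]e -(psum2_neg (p := p) (x := 2 * - 3^-1));
    [by rewrite [RHS]mulrC mulKf ?expf_neq0 | by plia |].
  by left; rewrite natrB ?natrM ?PE; [field | plia].
have ht : (t <= p./2)%N by rewrite h_eq; plia.
have h2t : (2 * t <= p./2)%N by rewrite h_eq; plia.
have o1 := bin_half_central pr p_gt3 ht; have o2 := bin_half_central pr p_gt3 h2t.
rewrite h_eq bin_t in o1; rewrite h_eq bin_2t in o2.
have ou1 : zpu p (oddprod p t) by apply: oddprod_unit => //; plia.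
have ou2 : zpu p (oddprod p (2 * t)) by apply: oddprod_unit => //; plia.
have Hz : (- 2^-1 - P / 8) \is a zp p.
  by rewrite (_ : 8^-1 = 2^-1 * 2^-1 * 2^-1) //; zp_solve.
have i1 : eqm p 3 (4 / (2 * t - 1)%:R ^+ 2) (9 * texp p (1 + P / 4)).
  have d1 : - 2^-1 \is a zp p by zp_solve.
  have := inv_sq d1 Hz; rewrite (_ : - 2^-1 - _ = - 2^-1 - P / 8); last by field.
  move=> /(_ (eqm_refl _ _ _)).
  rewrite (_ : -2 * (- 2^-1 - P / 8) = 1 + P / 4); last by field.
  have z9 : 9 \is a zp p by zp_solve.
  move=> /(eqmMl z9); rewrite (_ : 9 * (1 + P * - 2^-1) ^- 2 = 4 / (2 * t - 1)%:R ^+ 2) //.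
  have nn : 2 * t%:R - 1 != 0 :> rat by move: n1; rewrite natrB ?natrM //; plia.
  rewrite natrB ?natrM; last by plia.
  rewrite PE; field; rewrite nn /=.
  move: nn; apply: contra => /eqP ?; apply/eqP; lra.
have i2 : eqm p 3 (((4 * t - 1)%:R ^+ 2)^-1) (9 * texp p (4 + 4 * P)).
  have d1 : - 2 \is a zp p by zp_solve.
  have l1 : - 2 - 2 * P \is a zp p by zp_solve.
  have := inv_sq d1 l1; rewrite (_ : - 2 - _ = - 2 - 2 * P); last by field.
  move=> /(_ (eqm_refl _ _ _)).
  rewrite (_ : -2 * (- 2 - 2 * P) = 4 + 4 * P); last by field.
  have z9 : 9 \is a zp p by zp_solve.
  move=> /(eqmMl z9); rewrite (_ : 9 * (1 + P * - 2) ^- 2 = ((4 * t - 1)%:R ^+ 2)^-1) //.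
  have nn : 4 * t%:R - 1 != 0 :> rat by move: n2; rewrite natrB ?natrM //; plia.
  rewrite natrB ?natrM; last by plia.
  rewrite PE; field; rewrite nn /=.
  move: nn; apply: contra => /eqP ?; apply/eqP; lra.
have a1z : x - z + P / 4 * X \is a zp p by zp_solve.
have a2z : x + 3 / 4 * P * X \is a zp p by zp_solve.
have j1z : 1 + P / 4 \is a zp p by zp_solve.
have j2z : 4 + 4 * P \is a zp p by zp_solve.
pose a1 := (x - z + P / 4 * X) + (1 + P / 4).
pose a2 := (x + 3 / 4 * P * X) + (4 + 4 * P).
have B2z : B ^+ 2 \is a zp p by zp_solve.
have b9z : 9 * B ^+ 2 \is a zp p by zp_solve.
have comb (w o n : rat) (k l l' : rat) : o != 0 -> zpu p o -> k = w * o ^+ 2 -> n \is a zp p ->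
    k \is a zp p -> l \is a zp p -> l' \is a zp p ->
    eqm p 3 (o ^- 2) (texp p l) -> eqm p 3 n (9 * texp p l') ->
    eqm p 3 (w * n) (k * (9 * texp p (l + l'))).
  move=> o0 ou -> nz kz lz lz' e1 e2.
  have -> : w * n = w * o ^+ 2 * (o ^- 2 * n) by field.
  apply: eqmMl => //.
  have tz' : 9 * texp p l' \is a zp p by apply: rpredM; [zp_solve | exact: texp_zp].
  apply: eqm_trans (eqmM (texp_zp pr p_gt3 lz) nz e1 e2) _.
  rewrite mulrCA; apply: eqmMl; first by zp_solve.
  exact: texpD.
have w1 : eqm p 3 (wsum (2 * t) / (2 * t - 1)%:R ^+ 2) (9 * B ^+ 2 * texp p a1).
  have [_ _ n0] := zpuE ou1.
  have k1 : B ^+ 2 = (wsum (2 * t) / 4) * oddprod p t ^+ 2.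
    by rewrite mulrAC -o1; field.
  have nz : 4 / (2 * t - 1)%:R ^+ 2 \is a zp p.
    by apply: (eqm_zpl pr i1); apply: rpredM; [zp_solve | exact: texp_zp].
  have o := oddprod_small pr p_gt3 hN; rewrite u_eq h_eq in o.
  have -> : wsum (2 * t) / (2 * t - 1)%:R ^+ 2 = wsum (2 * t) / 4 * (4 / (2 * t - 1)%:R ^+ 2).
    by field.
  have -> : 9 * B ^+ 2 * texp p a1 = B ^+ 2 * (9 * texp p a1) by ring.
  exact: comb _ _ _ _ _ _ n0 ou1 k1 nz B2z a1z j1z o i1.
have w2 : eqm p 3 (wsum (2 * (2 * t)) / (4 * t - 1)%:R ^+ 2) (9 * B ^+ 2 * texp p a2).
  have [_ _ n0] := zpuE ou2.
  have nz : ((4 * t - 1)%:R ^+ 2)^-1 \is a zp p.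
    by apply: (eqm_zpl pr i2); apply: rpredM; [zp_solve | exact: texp_zp].
  have o := oddprod_large pr p_gt3 hN; rewrite u_eq in o.
  have -> : 9 * B ^+ 2 * texp p a2 = B ^+ 2 * (9 * texp p a2) by ring.
  exact: comb _ _ _ _ _ _ n0 ou2 o2 nz B2z a2z j2z o i2.
have A1z : a1 \is a zp p by rewrite /a1; zp_solve.
have A2z : a2 \is a zp p by rewrite /a2; zp_solve.
have := psum_interp pr p_gt7 (e := 2) isT s3; rewrite p1 p2.
have -> : qsum p 2 (- - 3^-1) = linprod p 0 (3 * t - 2) u v c (- 3^-1) by rewrite qsum_lin.
have -> : qsum p 2 (2 * - 3^-1) = linprod p 0 (3 * t - 2) u v c (2 / 3) by rewrite -qsum_lin mulrN.
have -> : qsum p 2 0 = linprod p 0 (3 * t - 2) u v c 0 by rewrite -qsum_lin oppr0.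
have L := linprod_second_diff pr p_gt3 uz vz cz.
have cb : eqm p 1 c (9 * B ^+ 2).
  have s1 : - - 3^-1 \is a zp p by zp_solve.
  have e1 := linprod_eqm1 pr p_gt7 uz vz cz s3; rewrite -qsum_lin in e1.
  apply: eqm_trans (eqm_sym e1) _.
  apply: eqm_trans (eqm_sym (psum_qsum_eqm pr p_gt7 (e := 2) isT s1)) _; rewrite p1.
  apply: eqm_trans (eqmW pr _ w1) _ => //.
  rewrite -[X in eqm _ _ _ X]mulr1; apply: eqmMl => //.
  by apply/(eqmP pr); exists (a1 + P * a1 ^+ 2 * 2^-1); [zp_solve | rewrite /texp; ring].
move=> hT.
have hT2 : eqm p 3 (3 * psum p 2 0) (2 * (9 * B ^+ 2 * texp p a1) + 9 * B ^+ 2 * texp p a2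
    - c * P ^+ 2 * (3^-1 * ((\sum_(0 <= i < 3 * t - 2) u i - \sum_(0 <= i < 3 * t - 2) v i) ^+ 2 -
      (\sum_(0 <= i < 3 * t - 2) u i ^+ 2 + \sum_(0 <= i < 3 * t - 2) v i ^+ 2)))).
  apply: eqm_trans hT _; apply: eqmB => //; apply: eqmD => //.
  by apply: eqmMl => //; zp_solve.
have Dz : (z + 3) ^+ 2 + 3 * X + 45 / 2 \is a zp p by zp_solve.
have hD : eqm p 1 ((\sum_(0 <= i < 3 * t - 2) u i - \sum_(0 <= i < 3 * t - 2) v i) ^+ 2 -
      (\sum_(0 <= i < 3 * t - 2) u i ^+ 2 + \sum_(0 <= i < 3 * t - 2) v i ^+ 2))
      ((z + 3) ^+ 2 + 3 * X + 45 / 2).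
  have su : \sum_(0 <= i < 3 * t - 2) u i = 2^-1 * (harm 1 (2 * t + (3 * t - 2)) - harm 1 (2 * t)).
    by rewrite -(sum_shift_harm 1).
  have sv : \sum_(0 <= i < 3 * t - 2) v i = 2^-1 * (harm 1 (t + (3 * t - 2)) - harm 1 t).
    by rewrite -(sum_shift_harm 1).
  rewrite su sv !sum_shift_harm.
  have tp : (t < p)%N by plia.
  have t2p : (2 * t < p)%N by plia.
  have t2p' : (2 * t - 1 < p)%N by plia.
  have e1 : (p - t).-1 = (2 * t + (3 * t - 2))%N by plia.
  have e2 : (p - 2 * t).-1 = (t + (3 * t - 2))%N by plia.
  have := harm1_reflect pr p_gt3 tp; have := harm1_reflect pr p_gt3 t2p.
  have := harm2_reflect pr p_gt3 tp; have := harm2_reflect pr p_gt3 t2p.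
  rewrite e1 e2.
  have f1 := eqmW pr (leqnSn 1) (harm1_full pr p_gt3); have f2 := harm2_full pr p_gt3.
  move=> /eqm_trans -/(_ _ f2) /(eqmP pr) [q1 qz1 g1] /eqm_trans -/(_ _ f2) /(eqmP pr) [q2 qz2 g2].
  move=> /(eqmW pr (leqnSn 1)) /eqm_trans -/(_ _ f1) /(eqmP pr) [q3 qz3 g3].
  move=> /(eqmW pr (leqnSn 1)) /eqm_trans -/(_ _ f1) /(eqmP pr) [q4 qz4 g4].
  have [] := harm_relations pr p_gt3 (N := 2 * t - 1) t2p'; first by rewrite u_eq h_eq; plia.
  rewrite N_half h_eq => /(eqmP pr) [q5 qz5 g5] /(eqmP pr) [q6 qz6 g6].
  (* The sums start after t and 2 t, while the harmonic relations stop at t - 1 and 2 t - 1; the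
     extra terms are constants, since 1 / t is 6 mod p. *)
  have it : eqm p 1 ((t%:R : rat)^-1) 6.
    rewrite -[X in eqm _ _ _ X]invrK; apply: eqmV => //.
    - by apply: (zpu_nat pr); plia.
    - by apply: zpuV; apply: (zpu_nat pr (n := 6)); plia.
    - apply/(eqmP pr); exists 6^-1; last by rewrite tE; field.
      by rewrite (_ : 6^-1 = 2^-1 * 3^-1) //; zp_solve.
  have /(eqmP pr) [q7 qz7 g7] := it.
  have hS i k : (0 < k)%N -> harm i k = harm i (k - 1) + k%:R ^- i.
    by case: k => // k _; rewrite harmS subn1.
  have t1 : (0 < t)%N by plia.
  have t2 : (0 < 2 * t)%N by plia.
  have Y1z : harm 2 t \is a zp p by apply: harm_zp => //; plia.
  have Y2z : harm 2 (2 * t) \is a zp p by apply: harm_zp => //; plia.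
  have m1 := hS 1%N _ t1; have m2 := hS 1%N _ t2; have k1 := hS 2 _ t1; have k2 := hS 2 _ t2.
  rewrite expr1 g7 in m1; rewrite natrM expr1 invfM g7 in m2.
  rewrite -exprVn g7 in k1; rewrite natrM -exprVn invfM g7 in k2.
  have d1 : 2^-1 * (harm 1 (2 * t + (3 * t - 2)) - harm 1 (2 * t))
     - 2^-1 * (harm 1 (t + (3 * t - 2)) - harm 1 t) =
     z + 3 + P * (P * q5 - 2^-1 * X + 2^-1 * q7
        + 2^-1 * (harm 2 t + q4 - harm 2 (2 * t) - q3)) by lra.
  have d2 : 2^-1 ^+ 2 * (harm 2 (2 * t + (3 * t - 2)) - harm 2 (2 * t))
     + 2^-1 ^+ 2 * (harm 2 (t + (3 * t - 2)) - harm 2 t) =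
     - 3 * X - 45 / 2 + P * (2^-1 * 2^-1 * (q1 + q2 - 2 * q6
        - 5 * 2^-1 * (12 * q7 + P * q7 ^+ 2))) by lra.
  rewrite d1 d2; apply/(eqmP pr).
  set r := (P * q5 - _ + _ + _); set r' := 2^-1 * 2^-1 * (q1 + _ - _ - _).
  have rz : r \is a zp p by rewrite /r; zp_solve.
  have rz' : r' \is a zp p by rewrite /r'; zp_solve.
  by exists (2 * (z + 3) * r + P * r ^+ 2 - r'); [zp_solve | ring].
apply: eqm_trans (interp_texp pr p_gt7 b9z A1z A2z Dz cb hD hT2) _; apply: eqmMl => //.
have h9 : 9^-1 \is a zp p by rewrite (_ : 9^-1 = 3^-1 * 3^-1) //; zp_solve.
have h12 : 12^-1 \is a zp p by rewrite (_ : 12^-1 = 3^-1 * 2^-1 * 2^-1) //; zp_solve.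
apply: texp_eqm => //; [by zp_solve | by zp_solve |].
rewrite /a1 /a2; apply/(eqmP pr).
exists (((z + 3) * (X + 15 / 2) + P * (X / 2 + 15 / 4) ^+ 2) / 9); first by zp_solve.
by field.
Qed.

End CaseTwo.

(** * Removal of the boundary term, and the case p = 6 t - 1 *)

Section Reduction.
Variables (p : nat) (pr : prime p) (p_gt7 : (7 < p)%N).
Local Notation P := (p%:R : rat).
Let p_gt3 : (3 < p)%N. Proof. exact: leq_trans p_gt7. Qed.

Definition sumS : rat := \sum_(0 <= k < p - 3) term k / (k + 3)%:R.

Lemma fact_p_dvd n : (p <= n)%N -> (p * (n - p)`! %| n`!)%N.
Proof.
move=> pn; rewrite -(bin_fact pn) dvdn_mull // dvdn_mul //.
by apply: dvdn_fact; rewrite prime_gt0 /=.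
Qed.

Lemma zpV_small n : (0 < n < 8)%N -> (n%:R^-1 : rat) \is a zp p.
Proof. by move=> hn; apply: (natV_zp pr); clear -hn p_gt7; lia. Qed.

(** With K = p - 3, (2 K)! contains one factor p and (3 K)! two, and the denominators are units.
    This removes the boundary term of [sum_reduction]. *)
Lemma term_last : eqm p 3 (term (p - 3)) 0.
Proof.
rewrite term_fact; set K := (p - 3)%N.
have d1 : (p %| (2 * K)`!)%N.
  have h1 : (p <= 2 * K)%N by rewrite /K; clear -p_gt7; lia.
  exact: dvdn_trans (dvdn_mulr _ (dvdnn p)) (fact_p_dvd h1).
have d2 : (p * p %| (3 * K)`!)%N.
  have h1 : (p <= 3 * K)%N by rewrite /K; clear -p_gt7; lia.
  apply: dvdn_trans (fact_p_dvd h1); apply: dvdn_mul => //.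
  have h2 : (p <= 3 * K - p)%N.
    (* 3 (p - 3) >= 2 p needs p >= 9, so 8 is excluded as a non-prime. *)
    have p8 : p != 8%N by apply: contraTneq pr => ->.
    by rewrite /K; clear -p_gt7 p8; lia.
  exact: dvdn_trans (dvdn_mulr _ (dvdnn p)) (fact_p_dvd h2).
have /dvdnP [q1 ->] := d1; have /dvdnP [q2 ->] := d2.
have kp : (K < p)%N by rewrite /K; clear -p_gt7; lia.
have [_ fV _] := zpuE (zpuX 5 (fact_unit pr kp)).
have c108 : coprime p 108.
  rewrite (_ : 108 = 2 ^ 2 * 3 ^ 3)%N // coprimeMr !coprimeXr // prime_coprime // gtnNdvd //.
  by clear -p_gt7; lia.
have [_ qV _] := zpuE (zpuX K (zpu_natC pr c108)).
apply/(eqmP pr); exists (q1%:R * q2%:R * ((K`!%:R ^+ 5)^-1 * (108 ^+ K)^-1)); first by zp_solve.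
by rewrite !natrM invfM; ring.
Qed.

Lemma sumS_reduction : eqm p 3 sumS (8 / 25 * psum p 1 0 - 5 / 126 * psum p 2 0).
Proof.
rewrite /sumS sum_reduction; set G := (X in _ + X).
have -> : psum p 1 0 = \sum_(0 <= k < p - 3) hyp 3^-1 2^-1 1 k.
  rewrite psum_hyp mulr0 addr0; apply: eq_bigr => k _; congr hyp; field.
have -> : psum p 2 0 = \sum_(0 <= k < p - 3) hyp 3^-1 (3 / 2) 2 k.
  rewrite psum_hyp mulr0 addr0; apply: eq_bigr => k _; congr hyp; field.
rewrite -[X in eqm _ _ _ X]addr0; apply: eqmD; first exact: eqm_refl.
have h2 := @zpV_small 2 isT; have h5 := @zpV_small 5 isT; have h7 := @zpV_small 7 isT.
have h14 : 14^-1 \is a zp p by rewrite (_ : 14^-1 = 2^-1 * 7^-1) //; zp_solve.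
have h140 : 140^-1 \is a zp p by rewrite (_ : 140^-1 = 14^-1 * 2^-1 * 5^-1) //; zp_solve.
have h700 : 700^-1 \is a zp p by rewrite (_ : 700^-1 = 140^-1 * 5^-1) //; zp_solve.
have h175 : 175^-1 \is a zp p by rewrite (_ : 175^-1 = 5^-1 * 5^-1 * 7^-1) //; zp_solve.
have k1 : ((p - 3)%:R + 1)^-1 \is a zp p.
  by rewrite natr1; apply: natV_zp => //; clear -p_gt7; lia.
have k2 : ((p - 3)%:R + 2)^-1 \is a zp p.
  by rewrite -natrD; apply: natV_zp => //; clear -p_gt7; lia.
rewrite /G -[X in eqm _ _ _ X](mul0r ((p - 3)%:R * (- (9 / 140) * (p - 3)%:R ^+ 2 / ((p - 3)%:R + 2) -
    27 / 175 * (p - 3)%:R ^+ 2 / ((p - 3)%:R + 1) + 153 / 700 * (p - 3)%:R + 5 / 14))).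
rewrite -[X in eqm _ _ X _]mulrA; apply: eqmMr term_last.
zp_solve.
Qed.

Section CaseTwo.
Variables (t : nat) (pt : p = (6 * t - 1)%N).
Local Notation B := ('C(3 * t - 1, t - 1)%:R : rat).
Ltac plia := clear -pt p_gt7; lia.

Lemma casetwo_sum :
  let q2 := fermat_quotient p 2 in let q3 := fermat_quotient p 3 in
  let R := - (5 / 14) * B ^+ 2 *
          (1 + P * (2 + 4 / 3 * q2 - 3 / 2 * q3)
           + P ^+ 2 * (1 + 8 / 3 * q2 + 2 / 9 * q2 ^+ 2 - 3 * q3
                       - 2 * q2 * q3 + 15 / 8 * q3 ^+ 2
                       + 3 / 4 * (U (p - 3))%:~R))
        - 4 / 25 * P ^+ 2 * B ^- 2 in
  R \is a zp p /\ eqm p 3 sumS R.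
Proof.
move=> q2 q3 R.
have h2 := @zpV_small 2 isT; have h3 := @zpV_small 3 isT.
have h5 := @zpV_small 5 isT; have h7 := @zpV_small 7 isT.
have h4 : 4^-1 \is a zp p by rewrite (_ : 4^-1 = 2^-1 * 2^-1) //; zp_solve.
have h8 : 8^-1 \is a zp p by rewrite (_ : 8^-1 = 2^-1 * 2^-1 * 2^-1) //; zp_solve.
have h9 : 9^-1 \is a zp p by rewrite (_ : 9^-1 = 3^-1 * 3^-1) //; zp_solve.
have h12 : 12^-1 \is a zp p by rewrite (_ : 12^-1 = 3^-1 * 2^-1 * 2^-1) //; zp_solve.
have h14 : 14^-1 \is a zp p by rewrite (_ : 14^-1 = 2^-1 * 7^-1) //; zp_solve.
have h25 : 25^-1 \is a zp p by rewrite (_ : 25^-1 = 5^-1 * 5^-1) //; zp_solve.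
have h126 : 126^-1 \is a zp p by rewrite (_ : 126^-1 = 14^-1 * 9^-1) //; zp_solve.
have [Bz BVz B0] := zpuE (casetwo_bin_unit pr p_gt7 pt).
have BV2 : B ^- 2 \is a zp p by rewrite -exprVn; zp_solve.
have c2 : coprime p 2 by rewrite prime_coprime // gtnNdvd // ltnW.
have c3 : coprime p 3 by rewrite prime_coprime // gtnNdvd.
have [q2z _] := fermat_quotient_log pr p_gt3 c2.
have [q3z _] := fermat_quotient_log pr p_gt3 c3.
rewrite -/q2 in q2z; rewrite -/q3 in q3z.
have Uz : ((U (p - 3))%:~R : rat) \is a zp p by apply: rpred_int.
have Rz : R \is a zp p by rewrite /R; zp_solve.
split=> //; apply: eqm_trans sumS_reduction _.
have xz : harm 1 (2 * t - 1) \is a zp p by apply: harm_zp => //; plia.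
have zz : harm 1 (3 * t - 1) \is a zp p by apply: harm_zp => //; plia.
have Xz : harm 2 (2 * t - 1) \is a zp p by apply: harm_zp => //; plia.
have V := casetwo_psum2 pr p_gt7 pt; have T := casetwo_psum1 pr p_gt7 pt.
have /(eqmP pr) [r1 rz1 e1] := harm1_half_quotient pr p_gt3.
have h_eq : p./2 = (3 * t - 1)%N by have := p_half pr p_gt3; plia.
rewrite h_eq -/q2 in e1.
have /(eqmP pr) [r2 rz2 e2] := harm1_third_quotient pr p_gt7 pt; rewrite -/q3 in e2.
have /(eqmP pr) [r3 rz3 e3] := U_harm2 pr p_gt7 pt.
(* [L0] and [K] are the exponent of [casetwo_psum2] after x, z, X are expressed by q2, q3 and U;
   eliminating x contributes -X / 3, and X / 12 - X / 3 = -X / 4 gives 3/4 U. *)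
pose L0 := 2 + 4 / 3 * q2 - 3 / 2 * q3.
pose K := 3 / 4 * q3 ^+ 2 - 2 / 3 * q2 ^+ 2 + 3 / 4 * (U (p - 3))%:~R - 1.
have L0z : L0 \is a zp p by rewrite /L0; zp_solve.
have Kz : K \is a zp p by rewrite /K; zp_solve.
have V2 : eqm p 3 (psum p 2 0) (9 * B ^+ 2 * texp p (L0 + P * K)).
  apply: eqm_trans V _; apply: eqmMl; first by zp_solve.
  apply: texp_eqm => //; [by zp_solve | by zp_solve |].
  apply/(eqmP pr); exists (4 / 3 * r1 - 3 / 2 * r2 - 4^-1 * r3); first by zp_solve.
  have -> : harm 1 (3 * t - 1) = - 2 * q2 + P * q2 ^+ 2 - 2 * P ^+ 2 * r1 by lra.
  have -> : harm 1 (2 * t - 1) = - 3 / 2 * q3 + 3 / 4 * P * q3 ^+ 2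
      - P * harm 2 (2 * t - 1) / 3 - 3 / 2 * P ^+ 2 * r2 by lra.
  by rewrite e3 /L0 /K; field.
have z1 : 8 / 25 \is a zp p by zp_solve.
have z2 : 5 / 126 \is a zp p by zp_solve.
apply: eqm_trans (eqmB (eqmMl z1 T) (eqmMl z2 V2)) _.
apply/(eqmP pr); exists (- (5 / 14) * B ^+ 2 * (L0 * K + P * K ^+ 2 / 2)); first by zp_solve.
by rewrite /texp /R /L0 /K; field.
Qed.

End CaseTwo.
End Reduction.

(** * The quadratic character of a finite field *)

Section FiniteFieldCharacters.
Variables (F : finFieldType).
Local Notation q := #|F|.

Lemma finField_exp (u : F) : u != 0 -> u ^+ q.-1 = 1.
Proof.
move=> u0; apply: (mulfI u0); rewrite mulr1 -exprS prednK ?expf_card //.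
by apply/card_gt0P; exists 0.
Qed.

Lemma card_nonzero : #|[pred u : F | u != 0]| = q.-1.
Proof. by rewrite -(cardC (pred1 (0 : F))) card1 add1n. Qed.

(** Otherwise all q - 1 units would be roots of X^r - 1 with 0 < r < q - 1, r being n mod q - 1.
    This serves in place of a primitive root. *)
Lemma exists_nonroot (n : nat) : ~~ (q.-1 %| n)%N -> exists2 c : F, c != 0 & c ^+ n != 1.
Proof.
move=> qn; apply/exists_inP; apply: contraR qn => /exists_inPn h.
have q0 : (0 < q.-1)%N.
  by rewrite -card_nonzero; apply/card_gt0P; exists 1; rewrite inE oner_neq0.
have [r0|r0] := posnP (n %% q.-1)%N; first by rewrite /dvdn r0.
have hr (u : F) : u != 0 -> u ^+ (n %% q.-1)%N = 1.
  move=> u0; have := h u u0; rewrite negbK {1}(divn_eq n q.-1) exprD mulnC exprM.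
  by rewrite finField_exp // expr1n mul1r => /eqP.
have := @max_unity_roots F _ (enum [pred u : F | u != 0]) r0.
rewrite enum_uniq -cardE card_nonzero => /(_ _ isT) H.
have := ltn_pmod n q0; rewrite ltnNge H //.
by apply/allP => u; rewrite mem_enum inE => u0; apply/unity_rootP; apply: hr.
Qed.

Variables (h : nat) (h_gt0 : (0 < h)%N) (qh : q.-1 = (2 * h)%N).

(** The quadratic character by Euler's criterion, with integer values so that its sums can be
    counted in Z. *)
Definition psi (u : F) : int := if u == 0 then 0 else if u ^+ h == 1 then 1 else -1.

Lemma psi0 : psi 0 = 0. Proof. by rewrite /psi eqxx. Qed.
Lemma psi1 : psi 1 = 1. Proof. by rewrite /psi oner_eq0 expr1n eqxx. Qed.

Lemma sq_root (u : F) : u != 0 -> u ^+ h = 1 \/ u ^+ h = -1.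
Proof.
move=> u0; have /eqP := finField_exp u0; rewrite qh mulnC exprM sqrf_eq1.
by case/orP => /eqP; [left | right].
Qed.

Lemma one_neqN1 : (1 : F) != -1.
Proof.
have [c c0 ch] := @exists_nonroot h (ltac:(rewrite qh; apply/negP => /dvdn_leq; lia)).
by case: (sq_root c0) => e; [rewrite e eqxx in ch | rewrite -e eq_sym].
Qed.

Lemma psi_root (u : F) : u != 0 -> (psi u)%:~R = u ^+ h.
Proof.
move=> u0; rewrite /psi (negbTE u0); case: eqP => [->//|].
by case: (sq_root u0) => -> //.
Qed.

Lemma psi_sign (u : F) : u != 0 -> psi u = 1 \/ psi u = -1.
Proof. by move=> u0; rewrite /psi (negbTE u0); case: ifP; [left | right]. Qed.

Lemma psiM (u v : F) : psi (u * v) = psi u * psi v.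
Proof.
have [->|u0] := eqVneq u 0; first by rewrite mul0r psi0 mul0r.
have [->|v0] := eqVneq v 0; first by rewrite mulr0 psi0 mulr0.
rewrite /psi mulf_eq0 (negbTE u0) (negbTE v0) /= exprMn.
have n1 : (-1 : F) == 1 = false by rewrite eq_sym (negbTE one_neqN1).
by case: (sq_root u0) => ->; case: (sq_root v0) => ->;
  rewrite ?mul1r ?mulr1 ?mulrNN ?eqxx ?n1 ?mulr1 ?mulrNN ?eqxx.
Qed.

Lemma psi_sq (u : F) : u != 0 -> psi u * psi u = 1.
Proof. by move=> /psi_sign [] ->. Qed.

Lemma psi_inv (u : F) : psi u^-1 = psi u.
Proof.
have [->|u0] := eqVneq u 0; first by rewrite invr0.
by rewrite -[LHS]mul1r -(psi_sq u0) -mulrA -psiM divff // psi1 mulr1.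
Qed.

Lemma exists_nonresidue : exists2 c : F, c != 0 & psi c = -1.
Proof.
have [c c0 ch] := @exists_nonroot h (ltac:(rewrite qh; apply/negP => /dvdn_leq; lia)).
by exists c => //; rewrite /psi (negbTE c0) (negbTE ch).
Qed.

Lemma sum_psi : \sum_(u : F) psi u = 0.
Proof.
have [c c0 pc] := exists_nonresidue.
have : \sum_(u : F) psi u = - \sum_(u : F) psi u.
  rewrite [LHS](reindex_inj (mulfI c0)) -sumrN; apply: eq_bigr => u _.
  by rewrite psiM pc mulN1r.
lia.
Qed.

(** For v != 1, dividing by the square (1 - v)^2 turns the argument into (1 - c v) / (1 - v), a
    Moebius map carrying v != 1 bijectively onto y != c. *)
Lemma sum_psi_pair (c : F) : c != 0 -> c != 1 ->
  \sum_(v : F | v != 0) psi ((1 - c * v) * (1 - v)) = - 1 - psi c.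
Proof.
move=> c0 c1.
have e1 : \sum_(v : F) psi ((1 - c * v) * (1 - v)) = 1 +
    \sum_(v : F | v != 0) psi ((1 - c * v) * (1 - v)).
  by rewrite (bigD1 0) //= mulr0 subr0 mulr1 psi1.
have e2 : \sum_(v : F) psi ((1 - c * v) * (1 - v)) = \sum_(y : F | y != c) psi y.
  rewrite (bigD1 1) //= subrr mulr0 psi0 add0r.
  have s1 (v : F) : v != 1 -> 1 - v != 0 by rewrite subr_eq0 eq_sym.
  have s2 (y : F) : y != c -> y - c != 0 by rewrite subr_eq0.
  rewrite (reindex_onto (fun y => (y - 1) / (y - c)) (fun v => (1 - c * v) / (1 - v))); last first.
    move=> v /s1 v1; have d1 : (1 - c * v) - c * (1 - v) != 0.
      by rewrite (_ : _ - _ = 1 - c); [rewrite subr_eq0 eq_sym | ring].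
    have d2 : (1 - c * v) / (1 - v) - c != 0.
      by rewrite (_ : _ - c = ((1 - c * v) - c * (1 - v)) / (1 - v)); [rewrite mulf_neq0 ?invr_neq0 | field].
    field; rewrite v1 /=; apply: contra d1 => /eqP e; apply/eqP; rewrite -e; ring.
  have cm1 : c - 1 != 0 by rewrite subr_eq0.
  apply: eq_big => [y|y].
    apply/andP/idP => [[y1 /eqP e]|yc].
      apply: contraNneq c1 => yc; move: e; rewrite yc subrr invr0 mulr0 mulr0 subr0.
      by rewrite divr1 => ->.
    have yc' := s2 _ yc; split.
      rewrite -subr_eq0 (_ : _ - 1 = (c - 1) / (y - c)); last by field.
      by rewrite mulf_neq0 ?invr_neq0.
    have d : 1 - (y - 1) / (y - c) = (1 - c) / (y - c) by field.
    have mc1 : 1 - c != 0 by rewrite subr_eq0 eq_sym.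
    rewrite d; apply/eqP; field; rewrite yc' mc1 //.
  case/andP => y1 /eqP e; set v := _ / (y - c) in y1 e *.
  by rewrite psiM -(psi_inv (1 - v)) -psiM e.
have e3 : \sum_(y : F | y != c) psi y = - psi c.
  by have := sum_psi; rewrite (bigD1 c) //= => /eqP; rewrite addrC addr_eq0 => /eqP.
by move: e1; rewrite e2 e3 => e1; lia.
Qed.

Lemma sum_psi_one : \sum_(v : F | v != 0) psi (1 - v) = -1.
Proof.
have : \sum_(v : F) psi (1 - v) = 0.
  rewrite (reindex_inj (inv_inj (f := fun v : F => 1 - v) _)); last by move=> v /=; rewrite subKr.
  by rewrite -[RHS]sum_psi; apply: eq_bigr => v _; rewrite subKr.
by rewrite (bigD1 0) //= subr0 psi1 => /eqP; rewrite addrC addr_eq0 => /eqP ->.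
Qed.

Variables (k : nat).
(** The part of the Jacobi sum on which the power character v^k has the value y. *)
Definition fiber_sum (y : F) : int := \sum_(v : F | (v != 0) && (v ^+ k == y)) psi (1 - v).
Definition kernel : pred F := [pred c : F | (c != 0) && (c ^+ k == 1)].

(** Expanding the square pairs v with d v for d in the kernel, and [sum_psi_pair] handles each d;
    the values psi(d) cancel because psi is nontrivial on the kernel. This count replaces the
    absolute value of a Jacobi sum. *)
Lemma sum_fiber_sq : (exists2 c, c \in kernel & psi c = -1) ->
  \sum_(y : F) fiber_sum y ^+ 2 = (q : int) - (#|kernel| : int).
Proof.
case=> c ck pc.
have ker0 : \sum_(d in kernel) psi d = 0.
  have c0 : c != 0 by case/andP: (ck).
  have : \sum_(d in kernel) psi d = - \sum_(d in kernel) psi d.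
    rewrite [LHS](reindex_inj (mulfI c0)) /= -sumrN; apply: eq_big => d.
      rewrite !inE mulf_eq0 (negbTE c0) /= exprMn.
      by case/andP: ck => _ /eqP ->; rewrite mul1r.
    by move=> _; rewrite psiM pc mulN1r.
  lia.
have -> : \sum_(y : F) fiber_sum y ^+ 2 =
    \sum_(d in kernel) \sum_(v : F | v != 0) psi ((1 - d * v) * (1 - v)).
  rewrite (eq_bigr (fun y => \sum_(v : F | (v != 0) && (v ^+ k == y))
    psi (1 - v) * fiber_sum (v ^+ k))); last first.
    move=> y _; rewrite expr2 {1}/fiber_sum mulr_suml; apply: eq_bigr => v /andP [_ /eqP ->] //.
  rewrite -(partition_big (fun v : F => v ^+ k) xpredT) //= exchange_big /=.
  apply: eq_bigr => v v0; rewrite /fiber_sum mulr_sumr (reindex_inj (mulIf v0)) /=.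
  apply: eq_big => d; first by rewrite inE mulf_eq0 (negbTE v0) orbF exprMn
    -{2}[v ^+ k]mul1r (inj_eq (mulIf (expf_neq0 _ v0))).
  by move=> _; rewrite psiM mulrC.
have k1 : 1 \in kernel by rewrite inE oner_neq0 expr1n eqxx.
rewrite (bigD1 1) //= [X in _ + X](eq_bigr (fun d => - 1 - psi d)); last first.
  by move=> d /andP []; rewrite inE => /andP [d0 _] d1; apply: sum_psi_pair.
have e1 : \sum_(v : F | v != 0) psi ((1 - 1 * v) * (1 - v)) = (q : int) - 2.
  have : \sum_(v : F) (1 : int) = q by rewrite sumr_const natz.
  rewrite (bigD1 0) //= (bigD1 1) ?oner_neq0 //= => e.
  rewrite (bigD1 1) ?oner_neq0 //= mul1r subrr mulr0 psi0 add0r.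
  rewrite (eq_bigr (fun _ => 1)); first by rewrite -e; ring.
  by move=> v /andP [_ v1]; rewrite mul1r psiM psi_sq // subr_eq0 eq_sym.
have e2 : \sum_(d in kernel) (- 1 - psi d) = - (#|kernel| : int).
  by rewrite sumrB ker0 subr0 sumr_const mulNrn natz.
rewrite (bigD1 1) //= psi1 in e2.
rewrite e1 -[X in _ = _ + X]e2; ring.
Qed.

End FiniteFieldCharacters.

(** * The norm of the Jacobi sum *)

Section CubicClasses.
Variables (F : finFieldType) (t : nat) (t_gt0 : (0 < t)%N) (qt : #|F|.-1 = (6 * t)%N).
Local Notation n := (@fiber_sum F (3 * t) (4 * t)).
Local Notation chi := (@psi F (3 * t)).

Let h_gt0 : (0 < 3 * t)%N. Proof. by rewrite muln_gt0. Qed.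
Let qh : #|F|.-1 = (2 * (3 * t))%N. Proof. by rewrite qt mulnA. Qed.

Lemma exists_cubic_root : exists2 c : F, c != 0 & c ^+ (4 * t) != 1.
Proof.
apply: exists_nonroot; rewrite qt; apply/negP => /dvdnP [d e].
by clear -e t_gt0; case: d e => [|d]; lia.
Qed.

Variables (c : F) (c0 : c != 0) (ck : c ^+ (4 * t) != 1).
Local Notation w := (c ^+ (4 * t)).

Lemma cubic_root3 : w ^+ 3 = 1.
Proof.
rewrite -exprM (_ : 4 * t * 3 = (6 * t) * 2)%N; last by clear; lia.
by rewrite exprM -qt finField_exp // expr1n.
Qed.

Lemma cubic_root_sum : 1 + w + w ^+ 2 = 0.
Proof.
have w1 : w - 1 != 0 by rewrite subr_eq0.
apply: (mulfI w1); rewrite mulr0 (_ : _ * _ = w ^+ 3 - 1); last by ring.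
by rewrite cubic_root3 subrr.
Qed.

Lemma cubic_root2_neq1 : w ^+ 2 != 1.
Proof.
apply: contra ck => /eqP w2; rewrite -[X in X == _]mulr1 -[X in _ * X == _]w2 -exprS.
by rewrite cubic_root3.
Qed.

Lemma cubic_root2_neq : w ^+ 2 != w.
Proof.
have w0 : w != 0 by rewrite expf_neq0.
apply: contra ck => /eqP w2; apply/eqP/(mulfI w0).
by rewrite mulr1 -expr2.
Qed.

Lemma cubic_class (v : F) : v != 0 ->
  [|| v ^+ (4 * t) == 1, v ^+ (4 * t) == w | v ^+ (4 * t) == w ^+ 2].
Proof.
move=> v0; set y := v ^+ _.
have y3 : y ^+ 3 = 1.
  rewrite -exprM (_ : 4 * t * 3 = (6 * t) * 2)%N; last by clear; lia.
  by rewrite exprM -qt finField_exp // expr1n.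
rewrite -![y == _]subr_eq0 -!mulf_eq0; apply/eqP.
have w2 : w ^+ 2 = - 1 - w by apply/eqP; rewrite -subr_eq0 -[X in _ == X]cubic_root_sum; apply/eqP; ring.
rewrite w2; have -> : (y - 1) * ((y - w) * (y - (- 1 - w))) = (y ^+ 3 - 1) - (y - 1) * (1 + w + w ^+ 2).
  by ring.
by rewrite y3 cubic_root_sum mulr0 !subrr.
Qed.

Lemma sum_over_classes (G : F -> int) :
  (forall y, ~~ [|| y == 1, y == w | y == w ^+ 2] -> G y = 0) ->
  \sum_(y : F) G y = G 1 + G w + G (w ^+ 2).
Proof.
move=> hG; rewrite (bigD1 1) //= (bigD1 w) //= (bigD1 (w ^+ 2)) /=; last first.
  by rewrite cubic_root2_neq1 cubic_root2_neq.
rewrite big1 ?addr0 ?addrA // => y /andP [/andP [y1 yw] yw2].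
by apply: hG; rewrite !negb_or y1 yw yw2.
Qed.

Lemma fiber_empty y : ~~ [|| y == 1, y == w | y == w ^+ 2] ->
  (fun v : F => (v != 0) && (v ^+ (4 * t) == y)) =1 pred0.
Proof.
move=> hy v; apply/negP => /andP [v0 /eqP e].
by move: hy; rewrite -e cubic_class.
Qed.

Lemma sum_fiber : n 1 + n w + n (w ^+ 2) = -1.
Proof.
rewrite -(sum_psi_one h_gt0 qh) -sum_over_classes; last first.
  by move=> y hy; rewrite /fiber_sum (eq_bigl _ _ (fiber_empty hy)) big_pred0_eq.
by rewrite [RHS](partition_big (fun v : F => v ^+ (4 * t)) xpredT).
Qed.

Lemma card_cubic_kernel : (#|@kernel F (4 * t)| : int) = (2 * t)%N.
Proof.
pose N y : int := \sum_(v : F | (v != 0) && (v ^+ (4 * t) == y)) 1.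
have shift d y : d != 0 -> N (d ^+ (4 * t) * y) = N y.
  move=> d0; rewrite /N (reindex_inj (mulfI d0)); apply: eq_bigl => v /=.
  by rewrite mulf_eq0 (negbTE d0) /= exprMn (inj_eq (mulfI (expf_neq0 _ d0))).
have e : N 1 + N w + N (w ^+ 2) = (6 * t)%N.
  rewrite -sum_over_classes; last first.
    by move=> y hy; rewrite /N (eq_bigl _ _ (fiber_empty hy)) big_pred0_eq.
  rewrite -(partition_big (fun v : F => v ^+ (4 * t)) xpredT (P := fun v => v != 0)) //=.
  by rewrite sumr_const natz -qt -card_nonzero.
have ew : N w = N 1 by rewrite -[RHS](shift c) ?mulr1.
have ew2 : N (w ^+ 2) = N 1 by rewrite expr2 shift.
have eK : N 1 = #|@kernel F (4 * t)| by rewrite /N sumr_const natz.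
by rewrite ew ew2 eK in e; lia.
Qed.

(** The cube of a nonresidue: cubes lie in the kernel of the cubic character, and cubing preserves
    the sign. *)
Lemma kernel_nonresidue : exists2 d, d \in @kernel F (4 * t) & chi d = -1.
Proof.
have [g g0 pg] := exists_nonresidue h_gt0 qh.
exists (g ^+ 3); last by rewrite !exprS expr0 mulr1 !(psiM h_gt0 qh) pg.
rewrite inE expf_neq0 //= -exprM (_ : 3 * (4 * t) = (6 * t) * 2)%N; last by clear; lia.
by rewrite exprM -qt finField_exp // expr1n.
Qed.

Lemma sum_fiber_squares : n 1 ^+ 2 + n w ^+ 2 + n (w ^+ 2) ^+ 2 = (4 * t + 1)%N.
Proof.
rewrite -(sum_over_classes (G := fun y => n y ^+ 2)); last first.
  by move=> y hy; rewrite /fiber_sum (eq_bigl _ _ (fiber_empty hy)) big_pred0_eq expr0n.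
rewrite (sum_fiber_sq h_gt0 qh kernel_nonresidue) card_cubic_kernel.
have : (0 < #|F|)%N by apply/card_gt0P; exists 0.
by move: qt; lia.
Qed.

(** The map v -> 1 / v exchanges the classes of w and w^2. As v != 1 there, the terms compared are
    signs, which differ by an even number. *)
Lemma fiber_parity : exists Y : int, n w = n (w ^+ 2) + 2 * Y.
Proof.
have winv (v : F) : (v^-1 != 0) && (v^-1 ^+ (4 * t) == w) = (v != 0) && (v ^+ (4 * t) == w ^+ 2).
  rewrite invr_eq0; case: (boolP (v == 0)) => //= v0.
  have w0 : w != 0 by rewrite expf_neq0.
  have y0 : v ^+ (4 * t) != 0 by rewrite expf_neq0.
  have w2 : w ^+ 2 = w^-1 by apply: (mulfI w0); rewrite divff // -exprS cubic_root3.
  by rewrite exprVn w2 -(inj_eq invr_inj) invrK.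
exists (\sum_(v : F | (v != 0) && (v ^+ (4 * t) == w ^+ 2))
   (if chi (1 - v^-1) == chi (1 - v) then 0 else chi (1 - v^-1))).
rewrite mulr_sumr /fiber_sum (reindex_inj invr_inj) -big_split /=.
rewrite (eq_bigl _ _ winv); apply: eq_bigr => v /andP [v0 /eqP vw].
have v1 : v != 1 by apply: contra cubic_root2_neq1 => /eqP e; rewrite -vw e expr1n.
have d1 : 1 - v != 0 by rewrite subr_eq0 eq_sym.
have d2 : 1 - v^-1 != 0 by rewrite subr_eq0 eq_sym invr_eq1.
by case: (psi_sign (3 * t) d1) => ->; case: (psi_sign (3 * t) d2) => ->.
Qed.

(** Since 1 + w + w^2 = 0, the sum of the n(y) y is X + Y (2 w + 1), with Y integral by parity. The
    norm follows from 3 times the sum of squares minus the square of the sum, which is 2 (X^2 + 3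
    Y^2). *)
Lemma cubic_norm : exists X Y : int,
  [/\ n 1 = X + n (w ^+ 2) + Y, n w = n (w ^+ 2) + 2 * Y & X ^+ 2 + 3 * Y ^+ 2 = (6 * t + 1)%N].
Proof.
have [Y eY] := fiber_parity.
exists (n 1 - n (w ^+ 2) - Y), Y; split=> //; first by ring.
have e1 := sum_fiber; have e2 := sum_fiber_squares.
move: (n 1) (n w) (n (w ^+ 2)) eY e1 e2 => a b d -> e1 e2.
have e3 : 3 * (a ^+ 2 + (d + 2 * Y) ^+ 2 + d ^+ 2) - (a + (d + 2 * Y) + d) ^+ 2 =
  2 * ((a - d - Y) ^+ 2 + 3 * Y ^+ 2) by ring.
by rewrite e1 e2 in e3; lia.
Qed.

End CubicClasses.

(** * Teichmueller representatives and the Jacobi sum mod p^3 *)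

Section Teichmuller.
Variables (p : nat) (pr : prime p).
Local Notation P := (p%:R : rat).
Local Notation F := ('F_p).
Local Notation nu u := ((nat_of_ord (u%R : F))%:R : rat).

(** In the expansion of (b + p^k r)^p the linear term gains a factor p, and the later ones contain
    p^(2k) with 2 k >= k + 1. *)
Lemma eqm_expp k (a b : rat) : (0 < k)%N -> a \is a zp p -> b \is a zp p ->
  eqm p k a b -> eqm p k.+1 (a ^+ p) (b ^+ p).
Proof.
move=> k0 az bz /(eqmP pr) [r rz ->].
have H d n : d \is a zp p -> exists2 e, e \is a zp p &
    (b + d * r) ^+ n = b ^+ n + n%:R * b ^+ n.-1 * (d * r) + d ^+ 2 * e.
  move=> dz; elim: n => [|n [e ez IH]]; first by exists 0; rewrite ?rpred0 // !expr0; ring.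
  exists (e * (b + d * r) + n%:R * b ^+ n.-1 * r ^+ 2); first by zp_solve.
  rewrite exprSr IH; case: n {IH} => [|n]; first by rewrite /= !expr0 expr1; ring.
  by rewrite -[n.+2%:R]natr1 /= !exprSr; ring.
have [e ez ->] := H _ p (zp_P p k).
apply/(eqmP pr); exists (b ^+ p.-1 * r + P ^+ k.-1 * e).
  by zp_solve.
by case: k k0 {az} => // k _; rewrite !exprS; ring.
Qed.

Lemma nat_eqm (a b : nat) : a%:R = b%:R :> F -> eqm p 1 (a%:R : rat) b%:R.
Proof.
wlog ab : a b / (a <= b)%N.
  move=> H e; case/orP: (leq_total a b) => ab; first exact: H.
  by apply: eqm_sym; apply: H.
move=> e; have : ((b - a)%:R : F) == 0 by rewrite natrB // e subrr.
rewrite -(dvdn_pcharf (pchar_Fp pr)) => /dvdnP [q bq].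
apply/(eqmP pr); exists (- (q%:R)); first by zp_solve.
by rewrite expr1 -(subnK ab) bq natrD natrM; ring.
Qed.

Lemma nu_cast (u : F) : (u : nat)%:R = u :> F.
Proof. exact: natr_Zp. Qed.

Lemma FpX (u : F) : u ^+ (p ^ 2) = u.
Proof.
have h (v : F) : v ^+ p = v by have := expf_card v; rewrite card_Fp.
by rewrite expnS expn1 exprM !h.
Qed.

(* Mod p ^ 3, the Teichmueller representative of [u]. *)
Definition tau (u : F) : rat := nu u ^+ (p ^ 2).

Lemma tau_zp u : tau u \is a zp p.
Proof. by rewrite /tau; zp_solve. Qed.

Lemma tau_eqm1 u : eqm p 1 (tau u) (nu u).
Proof.
rewrite /tau -natrX; apply: nat_eqm; rewrite natrX nu_cast; exact: FpX.
Qed.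

Lemma eqm_expp2 (a b : rat) : a \is a zp p -> b \is a zp p ->
  eqm p 1 a b -> eqm p 3 (a ^+ (p ^ 2)) (b ^+ (p ^ 2)).
Proof.
move=> az bz h; rewrite expnS expn1 !exprM.
by apply: eqm_expp; [|zp_solve|zp_solve|apply: eqm_expp].
Qed.

Lemma tauM u v : eqm p 3 (tau (u * v)) (tau u * tau v).
Proof.
rewrite /tau -exprMn; apply: eqm_expp2; [by zp_solve | by zp_solve |].
by rewrite -natrM; apply: nat_eqm; rewrite natrM !nu_cast.
Qed.

Lemma nu1 : (1 : F) = 1%N :> nat.
Proof. by rewrite -[1]/(1%:R) val_Fp_nat // modn_small // prime_gt1. Qed.

Lemma tau1 : tau 1 = 1. Proof. by rewrite /tau nu1 expr1n. Qed.

Lemma tauX u m : eqm p 3 (tau (u ^+ m)) (tau u ^+ m).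
Proof.
elim: m => [|m IH]; first by rewrite !expr0 tau1 eqm_refl.
rewrite !exprS; apply: eqm_trans (tauM _ _) _; apply: eqmMl => //; exact: tau_zp.
Qed.

Lemma tau_neq1 u : u != 1 -> zpu p (tau u - 1).
Proof.
move=> u1; have tz := tau_zp u; apply: (zp_unit pr); first by zp_solve.
move=> h; case/negP: u1; apply/eqP.
have : eqm p 1 (nu u) 1.
  have := eqmD (eqm_trans (eqmB (eqm_sym (tau_eqm1 u)) (eqm_refl p 1 1)) h) (eqm_refl p 1 1).
  by rewrite subrK add0r.
move=> h1.
have h2 : eqm p 1 ((u : nat)%:Z - 1)%:~R 0.
  by rewrite rmorphB /= -pmulrn -(subrr 1); apply: eqmB => //; apply: eqm_refl.
have := zp_num_dvd pr (rpred_int _ _) h2; rewrite expn1 numq_int.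
rewrite (dvdz_pcharf (pchar_Fp pr)) rmorphB /= -pmulrn nu_cast subr_eq0 => /eqP.
by [].
Qed.

Lemma card_FpB : #|{: F}|.-1 = p.-1.
Proof. by rewrite card_Fp. Qed.

Lemma tau_order u : u != 0 -> eqm p 3 (tau u ^+ p.-1) 1.
Proof.
move=> u0; apply: eqm_trans (eqm_sym (tauX _ _)) _.
by have := finField_exp u0; rewrite card_FpB => ->; rewrite tau1 eqm_refl.
Qed.

(** Multiplying by tau(c)^m permutes the summands mod p^3, so tau(c^m) - 1, a unit when c^m != 1,
    annihilates the sum. *)
Lemma tau_power_sum (m : nat) :
  eqm p 3 (\sum_(u : F | u != 0) tau u ^+ m) ((p.-1 %| m)%N%:R * p.-1%:R).
Proof.
have [/dvdnP [d ->]|h] := boolP (p.-1 %| m)%N.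
  have -> : p.-1%:R = \sum_(u : F | u != 0) (1 : rat) by rewrite sumr_const card_nonzero card_FpB.
  rewrite mul1r.
  apply: eqm_sum => u u0; rewrite mulnC exprM -(expr1n _ d); apply: eqmX.
  - by have := tau_zp u => ?; zp_solve.
  - by zp_solve.
  - exact: tau_order.
rewrite mul0r; have [c c0 cm] := @exists_nonroot F m (ltac:(rewrite card_FpB; exact: h)).
set S := \sum_(u | _) _.
have Sz : S \is a zp p by apply: rpred_sum => u _; rewrite rpredX // tau_zp.
have e1 : eqm p 3 S (tau c ^+ m * S).
  rewrite {1}/S (reindex_inj (mulfI c0)) /S mulr_sumr.
  rewrite (eq_bigl (fun u => u != 0)); last by move=> u /=; rewrite mulf_eq0 (negbTE c0).
  apply: eqm_sum => u u0; rewrite -exprMn; apply: eqmX; [exact: tau_zp | | exact: tauM].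
  by apply: rpredM; exact: tau_zp.
have e2 : eqm p 3 (tau c ^+ m * S) (tau (c ^+ m) * S) by apply: eqmMr => //; apply/eqm_sym/tauX.
have [tz tVz t0] := zpuE (tau_neq1 cm).
have /(eqmP pr) [r rz e3] := eqm_trans e1 e2.
apply/(eqmP pr); exists (- (tau (c ^+ m) - 1)^-1 * r); first by zp_solve.
apply: (mulfI t0); rewrite add0r.
rewrite [RHS](_ : _ = - (P ^+ 3 * r)); last by field.
by rewrite mulrBl mul1r {2}e3; ring.
Qed.

Variables (t : nat) (t_gt0 : (0 < t)%N) (pt : p = (6 * t).+1).
Local Notation chi := (@psi F (3 * t)).
Let q_eq : #|{: F}|.-1 = (6 * t)%N. Proof. by rewrite card_FpB pt. Qed.
Let qh : #|{: F}|.-1 = (2 * (3 * t))%N. Proof. by rewrite q_eq mulnA. Qed.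

Lemma one_sub_tau u : eqm p 1 (1 - tau u) (nu (1 - u)).
Proof.
have e : (nat_of_ord (1 - u)%R + u)%N%:R = 1%:R :> F by rewrite natrD !nu_cast subrK.
have := nat_eqm e; rewrite natrD => h; apply: eqm_sym.
have := eqmB h (eqm_sym (tau_eqm1 u)); by rewrite addrK.
Qed.

(* The polynomial (15 v - 10 v ^ 3 + 3 v ^ 5) / 8 is flat to order 3 at v = 1 and
   v = -1, so it maps a p-adic approximation of a sign to that sign mod p ^ 3. *)
Lemma chi_interp u : eqm p 3 (15 * (1 - tau u) ^+ (3 * t) - 10 * (1 - tau u) ^+ (9 * t)
    + 3 * (1 - tau u) ^+ (15 * t)) (8 * (chi (1 - u))%:~R).
Proof.
have t3 : (0 < 3 * t)%N by rewrite muln_gt0.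
have tz := tau_zp u.
rewrite (_ : 9 * t = (3 * t) * 3)%N; last by clear; lia.
rewrite (_ : 15 * t = (3 * t) * 5)%N; last by clear; lia.
have [->|u1] := eqVneq u 1.
  have -> : 8 * (chi (1 - 1))%:~R = 0 :> rat by rewrite subrr psi0 mulr0.
  rewrite tau1 subrr !expr0n !muln_eq0 !(gtn_eqF t_gt0) /= !mulr0 subr0 addr0.
  exact: eqm_refl.
have d1 : 1 - u != 0 by rewrite subr_eq0 eq_sym.
rewrite !(exprM _ (3 * t)).
have hv : eqm p 1 ((1 - tau u) ^+ (3 * t)) (chi (1 - u))%:~R.
  have h1 : eqm p 1 ((1 - tau u) ^+ (3 * t)) (nu (1 - u) ^+ (3 * t)).
    by apply: eqmX; [zp_solve | zp_solve | exact: one_sub_tau].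
  apply: eqm_trans h1 _; rewrite -natrX.
  have := psi_root qh d1; case: (psi_sign (3 * t) d1) => -> /esym e.
    by apply: (@nat_eqm _ 1); rewrite natrX nu_cast.
  rewrite -[X in eqm _ _ X _](addrK 1) -[X in eqm _ _ _ X]add0r; apply: eqmB; last exact: eqm_refl.
  by rewrite natr1; apply: (@nat_eqm _ 0); rewrite -natr1 natrX nu_cast e addNr.
have /(eqmP pr) [r rz ->] := hv.
apply/(eqmP pr).
case: (psi_sign (3 * t) d1) => ->.
  exists (r ^+ 3 * (3 * (1 + P * r) ^+ 2 + 9 * (1 + P * r) + 8)); first by zp_solve.
  by ring.
exists (r ^+ 3 * (3 * (- 1 + P * r) ^+ 2 - 9 * (- 1 + P * r) + 8)); first by zp_solve.
by ring.
Qed.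

Lemma tau_binomial_sum N : \sum_(u : F | u != 0) tau u ^+ (4 * t) * (1 - tau u) ^+ N =
  \sum_(0 <= i < N.+1) (-1) ^+ i * 'C(N, i)%:R * \sum_(u : F | u != 0) tau u ^+ (4 * t + i).
Proof.
have -> : \sum_(u : F | u != 0) tau u ^+ (4 * t) * (1 - tau u) ^+ N =
    \sum_(u : F | u != 0) \sum_(0 <= i < N.+1) (-1) ^+ i * 'C(N, i)%:R * tau u ^+ (4 * t + i).
  apply: eq_bigr => u _; rewrite exprBn big_mkord mulr_sumr; apply: eq_bigr => i _.
  by rewrite expr1n mulr1 exprD -mulr_natr; ring.
by rewrite exchange_big /=; apply: eq_bigr => i _; rewrite mulr_sumr.
Qed.

Lemma sum_congruence_class N (G : nat -> rat) :
  \sum_(0 <= i < N.+1) (6 * t %| 4 * t + i)%N%:R * G i =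
  \sum_(1 <= b < ((4 * t + N) %/ (6 * t)).+1) G (6 * t * b - 4 * t)%N.
Proof.
have t6 : (0 < 6 * t)%N by rewrite muln_gt0.
rewrite -(sum_multiples (fun a => G (a - 4 * t)%N) _ t6).
have t4 : (0 < 4 * t)%N by rewrite muln_gt0.
rewrite [RHS](big_cat_nat (n := (4 * t)%N)) //=; last by clear; lia.
rewrite [X in _ = X + _]big_nat [X in _ = X + _]big1 ?add0r; last first.
  move=> a /andP [a1 a2]; rewrite (_ : (6 * t %| a)%N = false) ?mul0r //.
  by apply/negP => /(dvdn_leq a1); clear -a2; lia.
rewrite -[X in _ = \sum_(X <= _ < _) _]add0n big_addn (_ : (4 * t + N).+1 - 4 * t = N.+1)%N; last by clear; lia.
by apply: eq_bigr => i _; rewrite addnK [(i + _)%N]addnC.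
Qed.

(** Only indices i with 6 t dividing 4 t + i survive; they are even, so the binomial signs
    disappear. *)
Lemma tau_binomial_eqm N : eqm p 3 (\sum_(u : F | u != 0) tau u ^+ (4 * t) * (1 - tau u) ^+ N)
  ((6 * t)%:R * \sum_(1 <= b < ((4 * t + N) %/ (6 * t)).+1) 'C(N, 6 * t * b - 4 * t)%:R).
Proof.
rewrite tau_binomial_sum.
have h i : (0 <= i < N.+1)%N -> eqm p 3
    ((-1) ^+ i * 'C(N, i)%:R * \sum_(u : F | u != 0) tau u ^+ (4 * t + i))
    ((6 * t %| 4 * t + i)%N%:R * ((6 * t)%:R * 'C(N, i)%:R)).
  move=> _; have hs := tau_power_sum (4 * t + i); rewrite -card_FpB q_eq in hs.
  have cz : (-1) ^+ i * 'C(N, i)%:R \is a zp p by zp_solve.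
  have := eqmMl cz hs.
  have [/dvdnP [d e]|_] := boolP (6 * t %| 4 * t + i)%N; last by rewrite !mul0r mulr0.
  have -> : (-1) ^+ i = 1 :> rat.
    by rewrite -signr_odd (_ : odd i = false) //; clear -e; lia.
  by rewrite !mul1r ['C(N, i)%:R * (6 * t)%:R]mulrC.
apply: eqm_trans (eqm_sum_nat h) _.
by rewrite sum_congruence_class -mulr_sumr eqm_refl.
Qed.

(* The Jacobi sum of a cubic and the quadratic character, in its p-adic form. *)
Definition jsum : rat := \sum_(u : F | u != 0) tau u ^+ (4 * t) * (chi (1 - u))%:~R.

(** The powers 3t, 9t, 15t of [chi_interp] select the indices 2t, 8t, 14t not exceeding them. Mod p
    only C(3t, 2t) counts, a unit; with the conjugate exponent 2t the first index would be 4t > 3t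
    and the sum would be 0 mod p. *)
Lemma jsum_binomials : eqm p 3 (8 * jsum) ((6 * t)%:R *
  (15 * 'C(3 * t, 2 * t)%:R - 10 * ('C(9 * t, 2 * t)%:R + 'C(9 * t, 8 * t)%:R)
   + 3 * ('C(15 * t, 2 * t)%:R + 'C(15 * t, 8 * t)%:R + 'C(15 * t, 14 * t)%:R))).
Proof.
have e1 : (6 * t * 1 - 4 * t = 2 * t)%N by clear; lia.
have e2 : (6 * t * 2 - 4 * t = 8 * t)%N by clear; lia.
have e3 : (6 * t * 3 - 4 * t = 14 * t)%N by clear; lia.
have S N := tau_binomial_eqm N.
have S3 := S (3 * t)%N; have S9 := S (9 * t)%N; have S15 := S (15 * t)%N.
have d k q r : (q * 6 <= k < q.+1 * 6)%N -> r = (k * t)%N -> (r %/ (6 * t) = q)%N.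
  by move=> hk ->; rewrite divnMr //; clear -hk; lia.
rewrite (d 7 1%N) // in S3; last by clear; lia.
rewrite (d 13 2) // in S9; last by clear; lia.
rewrite (d 19 3) // in S15; last by clear; lia.
rewrite big_nat1 e1 in S3.
rewrite big_nat_recr //= big_nat1 e1 e2 in S9.
rewrite big_nat_recr //= big_nat_recr //= big_nat1 e1 e2 e3 in S15.
have z15 : 15 \is a zp p by zp_solve.
have z10 : 10 \is a zp p by zp_solve.
have z3 : 3 \is a zp p by zp_solve.
have := eqmD (eqmB (eqmMl z15 S3) (eqmMl z10 S9)) (eqmMl z3 S15).
rewrite !mulr_sumr -sumrB -big_split /= => h.
rewrite [X in eqm _ _ _ X](_ : _ = 15 * ((6 * t)%:R * 'C(3 * t, 2 * t)%:R) -
    10 * ((6 * t)%:R * ('C(9 * t, 2 * t)%:R + 'C(9 * t, 8 * t)%:R)) +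
    3 * ((6 * t)%:R * ('C(15 * t, 2 * t)%:R + 'C(15 * t, 8 * t)%:R + 'C(15 * t, 14 * t)%:R))); last by ring.
apply: eqm_trans _ h; rewrite /jsum ?mulr_sumr; apply: eqm_sum => u _.
rewrite [X in eqm _ _ _ X](_ : _ = tau u ^+ (4 * t) * (15 * (1 - tau u) ^+ (3 * t) - 10 * (1 - tau u) ^+ (9 * t)
    + 3 * (1 - tau u) ^+ (15 * t))); last by ring.
rewrite mulrCA; apply: eqmMl; last by apply: eqm_sym; apply: chi_interp.
by have := tau_zp u => ?; zp_solve.
Qed.

(** Grouping by the value of the cubic character reduces this to [cubic_norm]; W lifts a primitive
    cube root of unity, so 2 W + 1 is a square root of -3 mod p^3. *)
Lemma jsum_norm : exists X Y : int, exists W : rat,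
  [/\ W \is a zp p, eqm p 3 (1 + W + W ^+ 2) 0, X ^+ 2 + 3 * Y ^+ 2 = p &
      eqm p 3 jsum (X%:~R + Y%:~R * (2 * W + 1))].
Proof.
have [c c0 ck] := exists_cubic_root t_gt0 q_eq.
have [X [Y [e1 e2 e3]]] := cubic_norm t_gt0 q_eq c0 ck.
pose w := c ^+ (4 * t); pose W := tau w.
have Wz : W \is a zp p by exact: tau_zp.
exists X, Y, W.
have W3 : eqm p 3 (W ^+ 3) 1.
  apply: eqm_trans (eqm_sym (tauX _ _)) _.
  by rewrite (cubic_root3 q_eq c0) tau1 eqm_refl.
have [mz mVz m0] := zpuE (tau_neq1 ck); rewrite -/w -/W in mz mVz m0.
have Wsum : eqm p 3 (1 + W + W ^+ 2) 0.
  have := eqmMl mVz (eqmB W3 (eqm_refl p 3 1)).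
  rewrite subrr mulr0 (_ : W ^+ 3 - 1 = (W - 1) * (1 + W + W ^+ 2)); last by ring.
  by rewrite mulKf.
split=> //; first by rewrite e3 pt addn1.
pose n y : int := \sum_(v : F | (v != 0) && (v ^+ (4 * t) == y)) chi (1 - v).
have class y : eqm p 3 (\sum_(v : F | (v != 0) && (v ^+ (4 * t) == y)) tau v ^+ (4 * t) * (chi (1 - v))%:~R)
    (tau y * (n y)%:~R).
  rewrite /n rmorph_sum /= mulr_sumr; apply: eqm_sum => v /andP [v0 /eqP vy].
  by apply: eqmMr; [zp_solve | rewrite -vy; apply/eqm_sym/tauX].
have cl (v : F) : v != 0 -> [|| v ^+ (4 * t) == 1, v ^+ (4 * t) == w | v ^+ (4 * t) == w ^+ 2].
  by move=> v0; apply: (cubic_class q_eq c0 ck).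
have split3 : jsum =
   \sum_(v : F | (v != 0) && (v ^+ (4 * t) == 1)) tau v ^+ (4 * t) * (chi (1 - v))%:~R +
   \sum_(v : F | (v != 0) && (v ^+ (4 * t) == w)) tau v ^+ (4 * t) * (chi (1 - v))%:~R +
   \sum_(v : F | (v != 0) && (v ^+ (4 * t) == w ^+ 2)) tau v ^+ (4 * t) * (chi (1 - v))%:~R.
  have w2n1 := cubic_root2_neq1 q_eq c0 ck; have w2nw := cubic_root2_neq c0 ck.
  rewrite /jsum (bigID (fun v : F => v ^+ (4 * t) == 1)) /= -addrA; congr (_ + _).
  rewrite (bigID (fun v : F => v ^+ (4 * t) == w)) /=; congr (_ + _); apply: eq_bigl => v.
    case: (eqVneq (v ^+ (4 * t)) w) => [->|vw]; last by rewrite !andbF.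
    by rewrite /w ck !andbT.
  case: (eqVneq v 0) => //= v0; have := cl v v0.
  case: (eqVneq (v ^+ (4 * t)) 1) => [->|_] /=; first by rewrite eq_sym (negbTE w2n1).
  by case: (eqVneq (v ^+ (4 * t)) w) => [->|_] /=; [rewrite eq_sym (negbTE w2nw) | move=> ->].
rewrite split3; have /(eqmP pr) [r0 rz0 h0] := class 1.
have /(eqmP pr) [r1 rz1 h1] := class w; have /(eqmP pr) [r2 rz2 h2] := class (w ^+ 2).
rewrite h0 h1 h2; have /(eqmP pr) [r3 rz3 h3] := tauX w 2.
have /(eqmP pr) [r4 rz4 h4] := Wsum.
have -> : n 1 = X + n (w ^+ 2) + Y by exact: e1.
have -> : n w = n (w ^+ 2) + 2 * Y by exact: e2.
have nz : (n (w ^+ 2))%:~R \is a zp p by apply: rpred_int.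
rewrite h3 -/W tau1 !rmorphD rmorphM /=.
apply/(eqmP pr); exists (r0 + r1 + r2 + r3 * (n (w ^+ 2))%:~R + r4 * (n (w ^+ 2))%:~R); first by zp_solve.
have -> : W ^+ 2 = P ^+ 3 * r4 - 1 - W by rewrite -[P ^+ 3 * r4]add0r -h4; ring.
by ring.
Qed.

End Teichmuller.

(** (x Y - y X) (x Y + y X) = p (Y^2 - y^2), so p divides one factor d. Brahmagupta's identity gives
    e^2 + 3 d^2 = p^2 for some e, which forces d = 0. *)
Lemma norm_form_unique (p : nat) (x y X Y : int) : prime p ->
  x ^+ 2 + 3 * y ^+ 2 = p -> X ^+ 2 + 3 * Y ^+ 2 = p -> x ^+ 2 = X ^+ 2.
Proof.
move=> pr exy eXY; have p0 : (0 < p)%N := prime_gt0 pr.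
(* If d is a nonzero multiple of p, then 3 d^2 alone exceeds p^2. *)
have zero (d e : int) : e ^+ 2 + 3 * d ^+ 2 = p%:Z ^+ 2 -> (p%:Z %| d)%Z -> d = 0.
  move=> ed /dvdzP [k dk]; rewrite dk in ed *.
  have k0 : k ^+ 2 = 0.
    apply/eqP; rewrite eq_le sqr_ge0 andbT leNgt; apply/negP => kpos.
    have k1 : 1 <= k ^+ 2 by rewrite -gtz0_ge1.
    have e0 : 0 <= e ^+ 2 by exact: sqr_ge0.
    have pp : 0 < p%:Z ^+ 2 by rewrite exprn_gt0 // ltz_nat.
    have : p%:Z ^+ 2 <= k ^+ 2 * p%:Z ^+ 2 by rewrite ler_peMl // ltW.
    rewrite exprMn in ed; rewrite -subr_ge0 => h.
    have : 0 < e ^+ 2 + 3 * (k ^+ 2 * p%:Z ^+ 2) - p%:Z ^+ 2.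
      rewrite (_ : _ - _ = e ^+ 2 + 2 * p%:Z ^+ 2 + 3 * (k ^+ 2 * p%:Z ^+ 2 - p%:Z ^+ 2)); last by ring.
      by rewrite ltr_wpDr ?mulr_ge0 // ltr_wpDl // mulr_gt0.
    by rewrite ed subrr ltxx.
  by move/eqP: k0; rewrite expf_eq0 /= => /eqP ->; rewrite mul0r.
have done_if : x * Y = y * X \/ x * Y = - (y * X) -> x ^+ 2 = X ^+ 2.
  move=> h; have hsq : x ^+ 2 * Y ^+ 2 = y ^+ 2 * X ^+ 2.
    by rewrite -!exprMn; case: h => ->; rewrite ?sqrrN.
  have pz : p%:Z != 0 by rewrite eqz_nat -lt0n.
  apply: (mulIf pz); rewrite -{1}eXY -exy !mulrDr !(mulrCA _ 3) hsq; ring.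
have d : (p%:Z %| (x * Y - y * X) * (x * Y + y * X))%Z.
  apply/dvdzP; exists (Y ^+ 2 - y ^+ 2).
  by rewrite [RHS]mulrBl -{1}exy -eXY; ring.
have : (p %| `|(x * Y - y * X)%R| * `|(x * Y + y * X)%R|)%N by move: d; rewrite dvdzE abszM absz_nat.
rewrite Euclid_dvdM // => /orP [h1|h1]; apply: done_if.
  left; apply/eqP; rewrite -subr_eq0; apply/eqP; apply: (zero _ (x * X + 3 * y * Y)).
    by rewrite [RHS]expr2 -{1}exy -eXY; ring.
  by rewrite dvdzE absz_nat.
right; apply/eqP; rewrite -addr_eq0; apply/eqP; apply: (zero _ (x * X - 3 * y * Y)).
  by rewrite [RHS]expr2 -{1}exy -eXY; ring.
by rewrite dvdzE absz_nat.
Qed.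

(** * Factorials above p *)

Section RisingProducts.
Variables (p : nat) (pr : prime p) (p_gt3 : (3 < p)%N).
Local Notation P := (p%:R : rat).

(** The quotient of (c p + 1) ... (c p + m) by m!. *)
Definition rprod (c : rat) (m : nat) : rat := \prod_(1 <= k < m.+1) (1 + P * (c * k%:R^-1)).

Lemma rprod_texp c m : c \is a zp p -> (m < p)%N ->
  eqm p 3 (rprod c m) (texp p (c * harm 1 m - P * 2^-1 * c ^+ 2 * harm 2 m)).
Proof.
move=> cz mp; have hz i : (1 <= i < m.+1)%N -> (i%:R^-1 : rat) \is a zp p.
  by move=> hi; apply: natV_zp => //; move: hi mp; clear; lia.
have := texp_prod_scaled pr p_gt3 cz hz; congr (eqm p 3 _ (texp p (_ - _ * _))).
by rewrite /harm; apply: eq_bigr => i _; rewrite exprVn.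
Qed.

Lemma rprod_unit c m : c \is a zp p -> (m < p)%N -> zpu p (rprod c m).
Proof.
move=> cz mp; rewrite /rprod big_nat; apply: zpu_prod => i hi.
have iz : (i%:R^-1 : rat) \is a zp p by apply: natV_zp => //; move: hi mp; clear; lia.
apply: (@eqm_zpu p pr 1 _ 1) => //; last exact: (zpu1 p).
by apply/(eqmP pr); exists (c * i%:R^-1); rewrite ?rpredM // expr1.
Qed.

Lemma fact_rprod (c m : nat) : (c * p + m)`!%:R = (c * p)`!%:R * m`!%:R * rprod c%:R m :> rat.
Proof.
elim: m => [|m IH]; first by rewrite addn0 fact0 /rprod big_geq // !mulr1.
rewrite addnS factS natrM IH /rprod [in RHS]big_nat_recr //= factS natrM.
rewrite -addnS natrD natrM.
have m0 : m.+1%:R != 0 :> rat by rewrite pnatr_eq0.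
by field; rewrite addrC natr1.
Qed.

(** Wolstenholme again: C(2p, p) is twice the product of 1 + p / k over 0 < k < p, whose logarithm
    vanishes mod p^3. *)
Lemma central_prime_bin : eqm p 3 ((2 * p)`!%:R / p`!%:R ^+ 2) 2.
Proof.
have pp : (p.-1 < p)%N by rewrite prednK // prime_gt0.
have e : ((2 * p)`!%:R / p`!%:R ^+ 2 : rat) = 2 * rprod 1 p.-1.
  have := fact_rprod 1 p.-1; rewrite mul1n => h.
  have p1 := prednK (prime_gt0 pr).
  have e1 : (2 * p)`!%:R = 2 * P * ((p + p.-1)`!%:R) :> rat.
    rewrite (_ : 2 * p = (p + p.-1).+1)%N; last by rewrite -addnS p1 mul2n addnn.
    by rewrite factS natrM -addnS p1 natrD; ring.
  have e2 : p`!%:R = P * (p.-1)`!%:R :> rat by rewrite -[in LHS]p1 factS p1 natrM.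
  rewrite e1 h; have f0 := fact_neq0 p; have f1 := fact_neq0 p.-1; have P0 := P_neq0 pr.
  by rewrite e2 in f0 *; field; rewrite P0 f1.
rewrite e -[X in eqm _ _ _ X]mulr1; apply: eqmMl; first exact: rpred_nat.
have z1 : (1 : rat) \is a zp p by exact: rpred1.
apply: eqm_trans (rprod_texp z1 pp) _; rewrite -[X in eqm _ _ _ X](texp0 p).
have h2 := zp_half pr p_gt3.
have a1 : harm 1 p.-1 \is a zp p by apply: harm_zp.
have a2 : harm 2 p.-1 \is a zp p by apply: harm_zp.
apply: texp_eqm => //; first by zp_solve.
have /(eqmP pr) [r1 rz1 ->] := harm1_full pr p_gt3; have /(eqmP pr) [r2 rz2 ->] := harm2_full pr p_gt3.
by apply/(eqmP pr); exists (r1 - 2^-1 * r2); [zp_solve | ring].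
Qed.

Lemma texp_trunc a d : a \is a zp p -> d \is a zp p ->
  eqm p 3 (texp p (a + P * d)) (1 + P * a + P ^+ 2 * (d + a ^+ 2 / 2)).
Proof.
move=> az dz; have h2 := zp_half pr p_gt3; apply/(eqmP pr).
by exists (a * d + P * d ^+ 2 / 2); [zp_solve | rewrite /texp; field].
Qed.

Lemma texp_ratio a b l m : zpu p b -> l \is a zp p -> m \is a zp p ->
  eqm p 3 a (texp p l) -> eqm p 3 b (texp p m) -> eqm p 3 (a / b) (texp p (l - m)).
Proof.
move=> bu lz mz ha hb; have [bz bVz b0] := zpuE bu.
have mu := texp_unit pr p_gt3 mz.
have nmz : - m \is a zp p by zp_solve.
apply: eqm_trans (texpD pr p_gt3 lz nmz); apply: eqmM => //; first exact: texp_zp.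
exact: eqm_trans (@eqmV p 3 _ _ isT bu mu hb) (texpN pr p_gt3 mz).
Qed.

End RisingProducts.

(** The denominators met in [shifted_binomials], with p = 6 s + 1: each is linear in s with positive
    coefficients. *)
Lemma shifted_denominators (s : rat) : 2 <= s ->
  [/\ 3 * (6 * s + 1) - 1 != 0, 6 * s + 1 + s != 0, 6 * s + 1 + 2 * s != 0,
      6 * s + 1 + 3 * s != 0
    & [/\ 5 * (6 * s + 1) - 1 != 0, 5 * (6 * s + 1) - 3 != 0, 2 * (6 * s + 1) + s != 0,
      2 * (6 * s + 1) + s - 1 != 0
    & [/\ 2 * (6 * s + 1) + 2 * s != 0, 2 * (6 * s + 1) + 2 * s - 1 != 0,
      2 * (6 * s + 1) + 3 * s != 0 & 2 * (6 * s + 1) + 3 * s - 1 != 0]]].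
Proof.
move=> s2; have nz (c d : nat) : (0 < d)%N -> c%:R * s + d%:R != 0.
  move=> d0; rewrite gt_eqF // ltr_wpDl ?ltr0n // mulr_ge0 ?ler0n //.
  exact: le_trans s2.
by split; [ | | | | split; [ | | | | split]];
  [ rewrite (_ : _ - 1 = 18 * s + 2); [exact: (nz 18 2) | ring]
  | rewrite (_ : _ + s = 7 * s + 1); [exact: (nz 7 1) | ring]
  | rewrite (_ : _ + _ = 8 * s + 1); [exact: (nz 8 1) | ring]
  | rewrite (_ : _ + _ = 9 * s + 1); [exact: (nz 9 1) | ring]
  | rewrite (_ : _ - 1 = 30 * s + 4); [exact: (nz 30 4) | ring]
  | rewrite (_ : _ - 3 = 30 * s + 2); [exact: (nz 30 2) | ring]
  | rewrite (_ : _ + s = 13 * s + 2); [exact: (nz 13 2) | ring]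
  | rewrite (_ : _ - 1 = 13 * s + 1); [exact: (nz 13 1) | ring]
  | rewrite (_ : _ + _ = 14 * s + 2); [exact: (nz 14 2) | ring]
  | rewrite (_ : _ - 1 = 14 * s + 1); [exact: (nz 14 1) | ring]
  | rewrite (_ : _ + _ = 15 * s + 2); [exact: (nz 15 2) | ring]
  | rewrite (_ : _ - 1 = 15 * s + 1); [exact: (nz 15 1) | ring]].
Qed.

(* [cof] is [((P - 1) * N + 72 * D1 * D2 * E) / P ^+ 3], where [N] is the main
   part of the right-hand side of the hypothesis, cleared of denominators, and
   [E] the truncated exponential of the conclusion: the point is that this
   quotient is a polynomial. *)
Lemma jsum_identity (P b x z X j r0 r1 r2 r3 r4 r5 r6 : rat) :
  let tr a d := 1 + P * a + P ^+ 2 * (d + a ^+ 2 / 2) in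
  let D1 := 3 * P - 1 in let D2 := (5 * P - 1) * (5 * P - 3) in
  let cof := ((-2016) + 1080 * x + (-1113) * X + (-405) * x ^+ 2 + (-456) * z + 360 * x * z + (-148) * z ^+ 2)
    + P ^+ 1 * (3168 + (-3168) * x + 5067 * X + 2295 * x ^+ 2 + 1536 * z + (-2208) * x * z + 824 * z ^+ 2)
    + P ^+ 2 * (2664 * x + (-8943) * X + (-4707) * x ^+ 2 + (-1464) * z + 4728 * x * z + (-1644) * z ^+ 2)
    + P ^+ 3 * (5037 * X + 2961 * x ^+ 2 + (-3072) * x * z + 1032 * z ^+ 2) in
  3 * P - 1 != 0 -> 5 * P - 1 != 0 -> 5 * P - 3 != 0 ->
  8 * j = (P - 1) * (15 * b
     - 10 * (b * ((7 * P - 1) / (3 * D1)) * (tr (- x) (3 * X) + P ^+ 3 * r1)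
           + b * (2 * (4 * P - 1) / (3 * D1)) * (tr (z - x) (2^-1 * X) + P ^+ 3 * r2))
     + 3 * (b * ((13 * P - 1) * (13 * P - 7) / (9 * D2)) * (tr (- 2 * x) (11 * X) + P ^+ 3 * r3)
          + b * (2 * (4 * P - 1) * (7 * P - 1) / (9 * D2)) * (2 * tr (z - 2 * x) (7 / 2 * X) + P ^+ 3 * r4)
          + b * (4 * (7 * P - 1) * (7 * P - 4) / (9 * D2)) * (tr (2 * z - 2 * x) (2 * X) + P ^+ 3 * r5)))
     + P ^+ 3 * r0 ->
  j = - b * (tr (x / 2 - z / 3) (X / 24) + P ^+ 3 * r6) + P ^+ 3 * ((72 * D1 * D2)^-1 *
    (b * cof + 9 * D1 * D2 * r0
     + (P - 1) * b * (- (30 * D2 * (7 * P - 1) * r1) - 60 * D2 * (4 * P - 1) * r2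
        + 3 * D1 * ((13 * P - 1) * (13 * P - 7) * r3 + 2 * (4 * P - 1) * (7 * P - 1) * r4
           + 4 * (7 * P - 1) * (7 * P - 4) * r5))
     + 72 * D1 * D2 * b * r6)).
Proof.
move=> tr D1 D2 cof n1 n2 n3 h.
rewrite [LHS](_ : j = 8^-1 * (8 * j)); last by clear; field.
by rewrite h /tr /cof /D1 /D2; field; rewrite n1 n2 n3.
Qed.

(** * The case p = 6 t + 1 *)

Section CaseOne.
Variables (p : nat) (pr : prime p) (p_gt7 : (7 < p)%N) (t : nat) (pt : p = (6 * t).+1).
Local Notation P := (p%:R : rat).
Local Notation x := (harm 1 (2 * t)).
Local Notation z := (harm 1 (3 * t)).
Local Notation X := (harm 2 (2 * t)).
Local Notation b := ('C(3 * t, t)%:R : rat).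
Ltac plia := clear -pt p_gt7; lia.
Let p_gt3 : (3 < p)%N. Proof. exact: leq_trans p_gt7. Qed.
Let h2 := zp_half pr p_gt3.
Let h3 := zp_third pr p_gt3.
Let h_eq : p./2 = (3 * t)%N. Proof. by have := p_half pr p_gt3; plia. Qed.
Let u_eq : uphalf (2 * t) = t. Proof. by rewrite uphalfE; plia. Qed.
Let N_half : (2 * t)./2 = t. Proof. by rewrite mul2n doubleK. Qed.
Let PE : P = 6 * t%:R + 1. Proof. by rewrite pt -natr1 natrM. Qed.
Let t_gt0 : (0 < t)%N. Proof. by plia. Qed.

Let t3p : (3 * t < p)%N. Proof. by plia. Qed.
Let t2p : (2 * t < p)%N. Proof. by plia. Qed.
Let tp : (t < p)%N. Proof. by plia. Qed.
Let xz : x \is a zp p. Proof. by apply: harm_zp => //; plia. Qed.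
Let zz : z \is a zp p. Proof. by apply: harm_zp => //; plia. Qed.
Let Xz : X \is a zp p. Proof. by apply: harm_zp => //; plia. Qed.

Lemma rprods_texp :
  [/\ eqm p 3 (rprod p 1 (3 * t)) (texp p z), eqm p 3 (rprod p 1 t) (texp p (x + z + P * (- 3 * X))),
      eqm p 3 (rprod p 1 (2 * t)) (texp p (x + P * (- 2^-1 * X)))
    & [/\ eqm p 3 (rprod p 2 (3 * t)) (texp p (2 * z)),
      eqm p 3 (rprod p 2 t) (texp p (2 * x + 2 * z + P * (- 11 * X)))
    & eqm p 3 (rprod p 2 (2 * t)) (texp p (2 * x + P * (- 2 * X)))]].
Proof.
have z1 : (1 : rat) \is a zp p by zp_solve.
have z2 : (2 : rat) \is a zp p by zp_solve.
have /(eqmP pr) [r0 rz0 g0] := harm2_half pr p_gt3; rewrite h_eq in g0.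
have [] := harm_relations pr p_gt3 (N := 2 * t) t2p; first by rewrite u_eq h_eq; plia.
rewrite N_half h_eq => /(eqmP pr) [q5 qz5 g5] /(eqmP pr) [q6 qz6 g6].
have go c m l : c \is a zp p -> (m < p)%N -> l \is a zp p ->
    eqm p 2 (c * harm 1 m - P * 2^-1 * c ^+ 2 * harm 2 m) l -> eqm p 3 (rprod p c m) (texp p l).
  move=> cz mp lz h; apply: eqm_trans (rprod_texp pr p_gt3 cz mp) _; apply: texp_eqm => //.
  by have a1 := harm_zp pr 1 mp; have a2 := harm_zp pr 2 mp; zp_solve.
split; [ | | | split]; apply: go => //; try by zp_solve.
- by rewrite g0; apply/(eqmP pr); exists (- 2^-1 * r0); [zp_solve | ring].
- rewrite g5 g6; apply/(eqmP pr); exists (q5 - 2^-1 * q6); [by zp_solve | by field].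
- by apply/(eqmP pr); exists 0; [zp_solve | field].
- by rewrite g0; apply/(eqmP pr); exists (- 2 * r0); [zp_solve | field].
- rewrite g5 g6; apply/(eqmP pr); exists (2 * q5 - 2 * q6); [by zp_solve | by field].
- by apply/(eqmP pr); exists 0; [zp_solve | field].
Qed.

Let R1u m : (m < p)%N -> zpu p (rprod p 1 m).
Proof. by apply: rprod_unit => //; apply: rpred1. Qed.
Let R2u m : (m < p)%N -> zpu p (rprod p 2 m).
Proof. by apply: rprod_unit => //; apply: rpred_nat. Qed.
Let R1n m : (m < p)%N -> rprod p 1 m != 0. Proof. by move=> /R1u /zpuE []. Qed.
Let R2n m : (m < p)%N -> rprod p 2 m != 0. Proof. by move=> /R2u /zpuE []. Qed.

Let bE : b = (3 * t)`!%:R / (t`!%:R * (2 * t)`!%:R).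
Proof.
rewrite bin_ratE; last by plia.
by rewrite (_ : 3 * t - t = 2 * t)%N //; plia.
Qed.

(** As p = 6 t + 1, the numbers 7t, 8t, 9t are one less than p + t, p + 2t, p + 3t, while 13t, 14t,
    15t are two less than 2p + t, 2p + 2t, 2p + 3t; hence one or two factors are divided out. *)
Let fact_lower1 m n k : (m = n.+1)%N -> (p + k = m)%N ->
  n`!%:R = p`!%:R * k`!%:R * rprod p 1 k / (P + k%:R) :> rat.
Proof.
move=> mn pk; have := fact_rprod p 1 k; rewrite mul1n pk mn factS natrM => h.
have n0 : P + k%:R != 0 by rewrite -natrD pk mn pnatr_eq0.
by rewrite -h -natrD pk mn mulrC mulKf // pnatr_eq0.
Qed.

Let fact_lower2 m n k : (m = n.+2)%N -> (2 * p + k = m)%N ->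
  n`!%:R = (2 * p)`!%:R * k`!%:R * rprod p 2 k / ((2 * P + k%:R) * (2 * P + k%:R - 1)) :> rat.
Proof.
move=> mn pk; have := fact_rprod p 2 k; rewrite pk mn !factS !natrM => h.
have e : 2 * P + k%:R = n.+2%:R by rewrite -natrM -natrD pk mn.
have e' : 2 * P + k%:R - 1 = n.+1%:R by rewrite e -natr1 addrK.
have n1 : n.+1%:R != 0 :> rat by rewrite pnatr_eq0.
have n2 : n.+2%:R != 0 :> rat by rewrite pnatr_eq0.
by rewrite -h e' e mulrA [_ * n`!%:R]mulrC mulfK ?mulf_neq0.
Qed.

Lemma shifted_binomials :
  let D := (5 * P - 1) * (5 * P - 3) in
  [/\ 'C(9 * t, 2 * t)%:R = b * ((7 * P - 1) / (3 * (3 * P - 1))) * (rprod p 1 (3 * t) / rprod p 1 t),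
      'C(9 * t, 8 * t)%:R = b * (2 * (4 * P - 1) / (3 * (3 * P - 1))) * (rprod p 1 (3 * t) / rprod p 1 (2 * t)),
      'C(15 * t, 2 * t)%:R = b * ((13 * P - 1) * (13 * P - 7) / (9 * D)) * (rprod p 2 (3 * t) / rprod p 2 t),
      'C(15 * t, 14 * t)%:R = b * (4 * (7 * P - 1) * (7 * P - 4) / (9 * D)) *
        (rprod p 2 (3 * t) / rprod p 2 (2 * t))
    & 'C(15 * t, 8 * t)%:R = b * (2 * (4 * P - 1) * (7 * P - 1) / (9 * D)) *
        ((2 * p)`!%:R / p`!%:R ^+ 2 * (rprod p 2 (3 * t) / (rprod p 1 (2 * t) * rprod p 1 t)))].
Proof.
have f0 n := fact_neq0 n.

have F9 : (9 * t)`!%:R = p`!%:R * (3 * t)`!%:R * rprod p 1 (3 * t) / (P + (3 * t)%:R).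
  by apply: (@fact_lower1 (9 * t).+1); plia.
have F7 : (7 * t)`!%:R = p`!%:R * t`!%:R * rprod p 1 t / (P + t%:R).
  by apply: (@fact_lower1 (7 * t).+1); plia.
have F8 : (8 * t)`!%:R = p`!%:R * (2 * t)`!%:R * rprod p 1 (2 * t) / (P + (2 * t)%:R).
  by apply: (@fact_lower1 (8 * t).+1); plia.
have F15 : (15 * t)`!%:R = (2 * p)`!%:R * (3 * t)`!%:R * rprod p 2 (3 * t) /
     ((2 * P + (3 * t)%:R) * (2 * P + (3 * t)%:R - 1)).
  by apply: (@fact_lower2 (15 * t).+2); plia.
have F13 : (13 * t)`!%:R = (2 * p)`!%:R * t`!%:R * rprod p 2 t /
     ((2 * P + t%:R) * (2 * P + t%:R - 1)).
  by apply: (@fact_lower2 (13 * t).+2); plia.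
have F14 : (14 * t)`!%:R = (2 * p)`!%:R * (2 * t)`!%:R * rprod p 2 (2 * t) /
     ((2 * P + (2 * t)%:R) * (2 * P + (2 * t)%:R - 1)).
  by apply: (@fact_lower2 (14 * t).+2); plia.
have T0 : t%:R != 0 :> rat by rewrite pnatr_eq0 -lt0n.
have tpos : 2 <= t%:R :> rat by rewrite (ler_nat _ 2); plia.
have r13 := R1n t3p; have r12 := R1n t2p; have r11 := R1n tp.
have r23 := R2n t3p; have r22 := R2n t2p; have r21 := R2n tp.
have g1 := f0 t; have g2 := f0 (2 * t)%N; have g3 := f0 (3 * t)%N; have gp := f0 p; have g2p := f0 (2 * p)%N.
have c9 : 'C(9 * t, 2 * t)%:R = (9 * t)`!%:R / ((2 * t)`!%:R * (7 * t)`!%:R) :> rat.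
  by rewrite bin_ratE; [rewrite (_ : 9 * t - 2 * t = 7 * t)%N //; plia | plia].
have c9' : 'C(9 * t, 8 * t)%:R = (9 * t)`!%:R / ((8 * t)`!%:R * t`!%:R) :> rat.
  by rewrite bin_ratE; [rewrite (_ : 9 * t - 8 * t = t)%N //; plia | plia].
have c15 : 'C(15 * t, 2 * t)%:R = (15 * t)`!%:R / ((2 * t)`!%:R * (13 * t)`!%:R) :> rat.
  by rewrite bin_ratE; [rewrite (_ : 15 * t - 2 * t = 13 * t)%N //; plia | plia].
have c15' : 'C(15 * t, 14 * t)%:R = (15 * t)`!%:R / ((14 * t)`!%:R * t`!%:R) :> rat.
  by rewrite bin_ratE; [rewrite (_ : 15 * t - 14 * t = t)%N //; plia | plia].
have c158 : 'C(15 * t, 8 * t)%:R = (15 * t)`!%:R / ((8 * t)`!%:R * (7 * t)`!%:R) :> rat.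
  by rewrite bin_ratE; [rewrite (_ : 15 * t - 8 * t = 7 * t)%N //; plia | plia].
rewrite c9 c9' c15 c15' c158 F9 F7 F8 F15 F13 F14 bE.
rewrite !natrM PE.
move: (t`!%:R) ((2 * t)`!%:R) ((3 * t)`!%:R) (p`!%:R) ((2 * p)`!%:R) g1 g2 g3 gp g2p =>
  A B C G H g1 g2 g3 gp g2p.
move: (rprod p 1 t) (rprod p 1 (2 * t)) (rprod p 1 (3 * t)) (rprod p 2 t)
  (rprod p 2 (2 * t)) (rprod p 2 (3 * t)) r11 r12 r13 r21 r22 r23 =>
  a1 a2' a3' d1 d2 d3 r11 r12 r13 r21 r22 r23.
move: (t%:R) T0 tpos => s T0 tpos D.
have [k1 k2 k3 k4 [k5 k6 k7 k8 [k9 k10 k11 k12]]] := shifted_denominators tpos.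
by split; rewrite /D; field; rewrite ?g1 ?g2 ?g3 ?gp ?g2p ?r11 ?r12 ?r13 ?r21 ?r22 ?r23 ?T0
  ?k1 ?k2 ?k3 ?k4 ?k5 ?k6 ?k7 ?k8 ?k9 ?k10 ?k11 ?k12.
Qed.

Let bz : b \is a zp p. Proof. exact: rpred_nat. Qed.

Let trunc (a d : rat) : rat := 1 + P * a + P ^+ 2 * (d + a ^+ 2 / 2).

Let ratio_trunc q r l m a d : zpu p r -> l \is a zp p -> m \is a zp p -> a \is a zp p -> d \is a zp p ->
  l - m = a + P * d -> eqm p 3 q (texp p l) -> eqm p 3 r (texp p m) -> eqm p 3 (q / r) (trunc a d).
Proof.
move=> ru lz mz az dz e hq hr; apply: eqm_trans (texp_ratio pr p_gt3 ru lz mz hq hr) _.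
by rewrite e; apply: texp_trunc.
Qed.

Let denoms_unit : [/\ zpu p (3 * P - 1), zpu p (5 * P - 1) & zpu p (5 * P - 3)].
Proof.
have u1 : zpu p (-1) by apply/zpuN/zpu1.
have u3 : zpu p (- 3) by apply: zpuN; apply: (zpu_nat pr (n := 3)); plia.
split; [apply: (eqm_zpu pr (n := 1)) u1 | apply: (eqm_zpu pr (n := 1)) u1 | apply: (eqm_zpu pr (n := 1)) u3] => //;
  apply/(eqmP pr).
- by exists 3; [zp_solve | ring].
- by exists 5; [zp_solve | ring].
- by exists 5; [zp_solve | ring].
Qed.

(** The refinement mod p^3 of J = -C(3t, t) mod p. The exponent is half the one in [caseone_psum1],
    so T(0) is J^2. *)
Lemma jsum_eval : eqm p 3 (jsum p t) (- b * texp p (x / 2 - z / 3 + P * (X / 24))).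
Proof.
have [R13 R11 R12 [R23 R21 R22]] := rprods_texp.
have h4 : 4^-1 \is a zp p by rewrite (_ : 4^-1 = 2^-1 * 2^-1) //; zp_solve.
have h24 : 24^-1 \is a zp p by rewrite (_ : 24^-1 = 4^-1 * 2^-1 * 3^-1) //; zp_solve.
have E1 : eqm p 3 (rprod p 1 (3 * t) / rprod p 1 t) (trunc (- x) (3 * X)).
  by apply: ratio_trunc R13 R11; [exact: R1u | zp_solve | zp_solve | zp_solve | zp_solve | ring].
have E2 : eqm p 3 (rprod p 1 (3 * t) / rprod p 1 (2 * t)) (trunc (z - x) (2^-1 * X)).
  by apply: ratio_trunc R13 R12; [exact: R1u | zp_solve | zp_solve | zp_solve | zp_solve | ring].
have E3 : eqm p 3 (rprod p 2 (3 * t) / rprod p 2 t) (trunc (- 2 * x) (11 * X)).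
  by apply: ratio_trunc R23 R21; [exact: R2u | zp_solve | zp_solve | zp_solve | zp_solve | ring].
have E5 : eqm p 3 (rprod p 2 (3 * t) / rprod p 2 (2 * t)) (trunc (2 * z - 2 * x) (2 * X)).
  by apply: ratio_trunc R23 R22; [exact: R2u | zp_solve | zp_solve | zp_solve | zp_solve | ring].
have R12R11 : eqm p 3 (rprod p 1 (2 * t) * rprod p 1 t)
    (texp p ((x + P * (- 2^-1 * X)) + (x + z + P * (- 3 * X)))).
  have l1 : x + P * (- 2^-1 * X) \is a zp p by zp_solve.
  have l2 : x + z + P * (- 3 * X) \is a zp p by zp_solve.
  apply: eqm_trans (texpD pr p_gt3 l1 l2); apply: eqmM => //; first exact: texp_zp.
  by have [] := zpuE (R1u tp).
have E4' : eqm p 3 (rprod p 2 (3 * t) / (rprod p 1 (2 * t) * rprod p 1 t)) (trunc (z - 2 * x) (7 / 2 * X)).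
  apply: ratio_trunc R23 R12R11; [by apply: zpuM; exact: R1u | zp_solve | zp_solve | zp_solve | zp_solve | ].
  by field.
have truncz a d : a \is a zp p -> d \is a zp p -> trunc a d \is a zp p.
  by move=> az dz; rewrite /trunc; zp_solve.
have E4 : eqm p 3 ((2 * p)`!%:R / p`!%:R ^+ 2 * (rprod p 2 (3 * t) / (rprod p 1 (2 * t) * rprod p 1 t)))
   (2 * trunc (z - 2 * x) (7 / 2 * X)).
  apply: eqmM; [zp_solve | | exact: central_prime_bin | exact: E4'].
  by apply: (eqm_zpl pr E4'); apply: truncz; zp_solve.
have TE : eqm p 3 (texp p (x / 2 - z / 3 + P * (X / 24))) (trunc (x / 2 - z / 3) (X / 24)).
  by apply: texp_trunc => //; zp_solve.
have [u1 u2 u3] := denoms_unit; have [_ _ n1] := zpuE u1; have [_ _ n2] := zpuE u2; have [_ _ n3] := zpuE u3.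
have J := jsum_binomials pr t_gt0 pt.
have [B1 B2 B3 B5 B4] := shifted_binomials.
have b_alt : 'C(3 * t, 2 * t) = 'C(3 * t, t).
  by rewrite -bin_sub; [congr 'C(_, _); plia | plia].
have P1 : (6 * t)%:R = P - 1 by rewrite natrM PE; ring.
rewrite b_alt B1 B2 B3 B4 B5 P1 in J.
move: E1 E2 E3 E4 E5 TE J => /(eqmP pr) [r1 rz1 ->] /(eqmP pr) [r2 rz2 ->] /(eqmP pr) [r3 rz3 ->]
  /(eqmP pr) [r4 rz4 ->] /(eqmP pr) [r5 rz5 ->] /(eqmP pr) [r6 rz6 ->] /(eqmP pr) [r0 rz0 eJ].
have vu : zpu p (72 * (3 * P - 1) * ((5 * P - 1) * (5 * P - 3))).
  apply: zpuM (zpuM _ u1) (zpuM u2 u3).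
  have c2 : coprime p 2 by rewrite prime_coprime // gtnNdvd // ltnW.
  have c3 : coprime p 3 by rewrite prime_coprime // gtnNdvd.
  by apply: (zpu_natC pr (n := 72)); rewrite (_ : 72 = 2 ^ 3 * 3 ^ 2)%N // coprimeMr !coprimeXr.
have [vz vVz v0] := zpuE vu.
(* The witness is the cofactor of p^3 in [jsum_identity]; only its p-integrality remains to be
   checked. *)
apply/(eqmP pr); eexists; last exact: (@jsum_identity P b x z X _ r0 r1 r2 r3 r4 r5 r6).
by zp_solve.
Qed.

Lemma caseone_sum (u v : int) : p%:Z = u ^+ 2 + 3 * v ^+ 2 ->
  let R := 32 / 25 * u%:~R ^+ 2 - 16 / 25 * P - 99 * P ^+ 2 / (2800 * u%:~R ^+ 2) in
  R \is a zp p /\ eqm p 3 (sumS p) R.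
Proof.
move=> uv R.
have h5 := @zpV_small p pr p_gt7 5 isT; have h7 := @zpV_small p pr p_gt7 7 isT.
have h4 : 4^-1 \is a zp p by rewrite (_ : 4^-1 = 2^-1 * 2^-1) //; zp_solve.
have h24 : 24^-1 \is a zp p by rewrite (_ : 24^-1 = 4^-1 * 2^-1 * 3^-1) //; zp_solve.
have h12 : 12^-1 \is a zp p by rewrite (_ : 12^-1 = 4^-1 * 3^-1) //; zp_solve.
have h25 : 25^-1 \is a zp p by rewrite (_ : 25^-1 = 5^-1 * 5^-1) //; zp_solve.
have h28 : 28^-1 \is a zp p by rewrite (_ : 28^-1 = 4^-1 * 7^-1) //; zp_solve.
have h700 : 700^-1 \is a zp p by rewrite (_ : 700^-1 = 25^-1 * 28^-1) //; zp_solve.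
have h126 : 126^-1 \is a zp p by rewrite (_ : 126^-1 = 2^-1 * 3^-1 * 3^-1 * 7^-1) //; zp_solve.
have bu : zpu p b by exact: (caseone_bin_unit pr p_gt7 pt).
have [_ bVz b0] := zpuE bu.
have [X0 [Y0 [W [Wz hW XY hJ]]]] := jsum_norm pr t_gt0 pt.
have uX : u%:~R ^+ 2 = X0%:~R ^+ 2 :> rat.
  by rewrite -!rmorphXn /= (norm_form_unique pr (esym uv) XY).
set m := x / 2 - z / 3 + P * (X / 24).
have mz : m \is a zp p by rewrite /m; zp_solve.
have [J JD] : exists J : rat, J = X0%:~R + Y0%:~R * (2 * W + 1) by eexists.
have JE : eqm p 3 J (- b * texp p m).
  by rewrite JD; exact: eqm_trans (eqm_sym hJ) jsum_eval.
have tu := texp_unit pr p_gt3 mz; have [tz _ _] := zpuE tu.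
have Ju : zpu p J by apply: (eqm_zpu pr _ JE) => //; apply: zpuM => //; apply: zpuN.
have [Jz JVz J0] := zpuE Ju.
have J1 : eqm p 1 J (- b).
  apply: eqm_trans (eqmW pr _ JE) _ => //; rewrite -[X in eqm _ _ _ X]mulr1.
  apply: eqmMl; first by rewrite rpredN.
  by apply/(eqmP pr); exists (m + P * m ^+ 2 / 2); [zp_solve | rewrite /texp; field].
have J2 : eqm p 3 (psum p 1 0) (J ^+ 2).
  apply: eqm_trans (caseone_psum1 pr p_gt7 pt) _; apply: eqm_sym.
  apply: eqm_trans (eqmX 2 Jz _ JE) _ => //; first by rewrite rpredM ?rpredN.
  rewrite exprMn sqrrN; apply: eqmMl; first exact: rpredX.
  rewrite expr2; apply: eqm_trans (texpD pr p_gt3 mz mz) _.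
  by rewrite (_ : m + m = x - 2 / 3 * z + P / 12 * X); [exact: eqm_refl | rewrite /m; field].
have bJ : eqm p 1 (b ^- 2) (J ^- 2).
  apply: eqmV => //; [exact: zpuX | exact: zpuX | rewrite -(sqrrN b)].
  by apply: eqmX; [rewrite rpredN | | exact: eqm_sym].
move: J2 (caseone_psum2 pr p_gt7 pt) bJ hW => /(eqmP pr) [r1 rz1 e1] /(eqmP pr) [r2 rz2 e2]
  /(eqmP pr) [r3 rz3 e3] /(eqmP pr) [w wz ew].
have [s sD] : exists s : rat, s = - (4 * Y0%:~R ^+ 2 * w) / J by eexists.
have Yz : (Y0%:~R : rat) \is a zp p by apply: rpred_int.
have sz : s \is a zp p by rewrite sD; zp_solve.
have PXY : P = X0%:~R ^+ 2 + 3 * Y0%:~R ^+ 2.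
  have := congr1 (fun n : int => n%:~R : rat) XY.
  by rewrite rmorphD rmorphM !rmorphXn /= -pmulrn => <-.
(* J (2 X0 - J) = X0^2 - (2 W + 1)^2 Y0^2 with (2 W + 1)^2 = -3 + 4 (1 + W + W^2), and the last
   bracket is p^3 w. *)
have ZE : 2 * X0%:~R = J + P / J + P ^+ 3 * s.
  have clear_denom (j q y v0 : rat) : j != 0 ->
      (j + q / j + q ^+ 3 * (- (4 * y ^+ 2 * v0) / j)) * j = j ^+ 2 + q - 4 * y ^+ 2 * (q ^+ 3 * v0).
    by move=> j0; field.
  apply: (mulIf J0); rewrite sD clear_denom //.
  have -> : P ^+ 3 * w = 1 + W + W ^+ 2 by rewrite ew add0r.
  by rewrite PXY JD; ring.
have Zu : zpu p (2 * X0%:~R).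
  apply: (eqm_zpu pr (n := 1) _ _ Ju) => //; rewrite ZE; apply/(eqmP pr).
  by exists (J^-1 + P ^+ 2 * s); [zp_solve | ring].
have [Zz ZVz Z0] := zpuE Zu.
have ZJ : eqm p 1 ((2 * X0%:~R) ^- 2) (J ^- 2).
  apply: eqmV; [by [] | exact: zpuX | exact: zpuX | apply: eqmX => //; rewrite ZE].
  by apply/(eqmP pr); exists (J^-1 + P ^+ 2 * s); [zp_solve | ring].
have RE : R = 8 / 25 * (2 * X0%:~R) ^+ 2 - 16 / 25 * P - 99 / 700 * P ^+ 2 * (2 * X0%:~R) ^- 2.
  have X00 : X0%:~R != 0 :> rat by apply: contraNneq Z0 => ->; rewrite mulr0.
  by rewrite /R uX; field.
(* Squaring 2 X0 = J + p / J produces 16/25 p, which cancels, and 8/25 p^2 / J^2; the constant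
   99/700 comes from 8/25 - 99/700 = 5/28 = (5/126) (9/2). *)
have fin : eqm p 3 R (8 / 25 * psum p 1 0 - 5 / 126 * psum p 2 0).
  move/(eqmP pr): ZJ => [r4 rz4 e4]; rewrite RE e4 ZE e2 e1 e3; apply/(eqmP pr).
  exists (8 / 25 * (2 * s * (J + P / J) + P ^+ 3 * s ^+ 2 - r1) - 99 / 700 * r4 - 5 / 28 * r3 + 5 / 126 * r2).
    by zp_solve.
  by field.
split; last exact: eqm_trans (sumS_reduction pr p_gt7) (eqm_sym fin).
have b2z : b ^- 2 \is a zp p by rewrite -exprVn rpredX.
by apply: (eqm_zpl pr fin); rewrite e1 e2; zp_solve.
Qed.

End CaseOne.

(** * Both residue classes together *)

Theorem theorem11p3 (p : nat) (p_prime : prime p) (p_gt7 : (7 < p)%N) :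
  let S : rat :=
    \sum_(0 <= k < p - 3)
      ('C(2 * k, k) ^ 2 * 'C(3 * k, k))%N%:Q / (108%:Q ^+ k * (k + 3)%N%:Q) in
  let q2 : rat := fermat_quotient p 2 in
  let q3 : rat := fermat_quotient p 3 in
  let P : rat := p%:Q in
  let B : rat := 'C((p - 1) %/ 2, (p - 5) %/ 6)%:Q in
  ((p %% 3)%N = 1%N ->
     forall x y : int, p%:Z = x ^+ 2 + 3 * y ^+ 2 ->
       rat_congr p 3 S
         (32 / 25 * x%:Q ^+ 2 - 16 / 25 * P
          - 99 * P ^+ 2 / (2800 * x%:Q ^+ 2)))
  /\
  ((p %% 3)%N = 2%N ->
     rat_congr p 3 S
       (- (5 / 14) * B ^+ 2 *
          (1 + P * (2 + 4 / 3 * q2 - 3 / 2 * q3)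
           + P ^+ 2 * (1 + 8 / 3 * q2 + 2 / 9 * q2 ^+ 2 - 3 * q3
                       - 2 * q2 * q3 + 15 / 8 * q3 ^+ 2
                       + 3 / 4 * (U (p - 3))%:Q))
        - 4 / 25 * P ^+ 2 * B ^- 2)).
Proof.
move=> S q2 q3 P B.
have SE : S = sumS p.
  by apply: eq_bigr => k _; rewrite /term -!pmulrn invfM mulrA.
have PE : P = p%:R by rewrite /P -pmulrn.
have p_odd : (p %% 2 = 1)%N.
  by have [p2|] := even_prime p_prime; [move: p_gt7; rewrite p2 | rewrite modn2 => ->].
rewrite SE PE; split=> p3.
  have [t pt] : exists t, p = (6 * t).+1 by exists (p %/ 6)%N; move: p3 p_odd; clear; lia.
  move=> x y pxy; have [Rz RS] := caseone_sum p_prime p_gt7 pt pxy.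
  exact: rat_congrI (eqm_zpl p_prime RS Rz) Rz RS.
have [t pt] : exists t, p = (6 * t - 1)%N by exists (p.+1 %/ 6)%N; move: p3 p_odd p_gt7; clear; lia.
have -> : B = 'C(3 * t - 1, t - 1)%:R.
  rewrite /B -pmulrn; congr ('C(_, _)%:R); lia.
have [Rz RS] := casetwo_sum p_prime p_gt7 pt.
exact: rat_congrI (eqm_zpl p_prime RS Rz) Rz RS.
Qed.
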